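(* Consider the contextual MNL bandit and the maximum-likelihood-based algorithm described in the context. Let $\delta\in(0,1]$, and assume $\|x_{ti}\|_2\le1$ and $r_{ti}\in[0,1]$ for all $t\ge1$, $i\in[N]$, and $\|\mathbf{w}^\star\|_2\le B$ for a known constant $B$. Then, with probability at least $1-\delta$, the regret of the algorithm is bounded as $$\mathbf{Reg}_T(\mathbf{w}^\star)\lesssim d\log(BT)\sqrt{\sum_{t=1}^T\sigma_t^2}+\frac1\kappa d^2(\log(BT))^2.$$
   Context: $\mathcal{W}=\{\mathbf{w}\in\mathbb{R}^d:\|\mathbf{w}\|_2\le B\}$; $\mathcal{S}=\{S\subseteq[N]:|S|\le K\}$; $\lesssim$ denotes inequality up to constant factors, as in $O$-notation. MNL bandit. At each round $t\in[T]$, features $x_{ti}\in\mathbb{R}^d$ and rewards $r_{ti}$, $i\in[N]$, are revealed (they may be chosen arbitrarily by an adversary); the learner offers $S_t\in\mathcal{S}$ and observes a choice $c_t\in S_t\cup\{0\}$ ($0$ is the outside option, $x_{t0}=\mathbf 0$, $r_{t0}=0$); $y_{ti}=\mathbb{1}(c_t=i)$. The choice $c_t=i$ has probability $p_t(i\mid S_t,\mathbf{w}^\star)$, with $p_t(i\mid S,\mathbf{w})=\exp(x_{ti}^\top\mathbf{w})/(1+\sum_{j\in S}\exp(x_{tj}^\top\mathbf{w}))$ for $i\in S\cup\{0\}$, $\mathbf{w}^\star\in\mathbb{R}^d$ unknown. Let $R_t(S,\mathbf{w})=\sum_{i\in S}p_t(i\mid S,\mathbf{w})r_{ti}$, $S_t^\star\in\arg\max_{S\in\mathcal{S}}R_t(S,\mathbf{w}^\star)$,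 and $\mathbf{Reg}_T(\mathbf{w}^\star)=\sum_{t=1}^T \big(R_t(S_t^\star,\mathbf{w}^\star)-R_t(S_t,\mathbf{w}^\star)\big)$. The reward variance is $\sigma_t^2=\mathbb{E}_{i\sim p_t(\cdot\mid S_t,\mathbf{w}^\star)}\big[(r_{ti}-\mathbb{E}_{j\sim p_t(\cdot\mid S_t,\mathbf{w}^\star)}[r_{tj}])^2\big]$ (over $S_t\cup\{0\}$). The constant $\kappa>0$ is such that $\min_{\mathbf{w}\in\mathcal{W}}p_t(i\mid S,\mathbf{w})p_t(0\mid S,\mathbf{w})\ge\kappa$ for all $i\in S$, $S\in\mathcal{S}$, $t\in[T]$. Algorithm (failure level $\delta$). Let $\ell_s(\mathbf{w})=-\sum_{i\in S_s\cup\{0\}}y_{si}\log p_s(i\mid S_s,\mathbf{w})$ and $\mathcal{L}_t(\mathbf{w})=\sum_{s=1}^{t-1}\ell_s(\mathbf{w})$. At round $t$: compute $\hat{\mathbf{w}}_t\in\arg\min_{\mathbf{w}\in\mathcal{W}}\mathcal{L}_t(\mathbf{w})$; form $\hat{\mathcal{C}}_t(\delta)=\{\mathbf{w}\in\mathcal{W}:\mathcal{L}_t(\mathbf{w})-\mathcal{L}_t(\hat{\mathbf{w}}_t)\le\hat\beta_t(\delta)^2\}$ with $\hat\beta_t(\delta)^2=\log\frac1\delta+d\log\big(\max\{e,\frac{4eB(t-1)}{d}\}\big)$; for each $i\in[N]$ let $\tilde{\mathbf{w}}_{ti}\in\arg\max_{\mathbf{w}\in\hat{\mathcal{C}}_t(\delta)}x_{ti}^\top\mathbf{w}$;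 offer $S_t\in\arg\max_{S\in\mathcal{S}}\frac{\sum_{i\in S}\exp(x_{ti}^\top\tilde{\mathbf{w}}_{ti})r_{ti}}{1+\sum_{j\in S}\exp(x_{tj}^\top\tilde{\mathbf{w}}_{tj})}$ and observe the choice.
   Formalization: The constant hidden in ≲ is allowed to depend on the failure level δ (no δ-free constant exists, since the bound omits log(1/δ)), and BT ≥ 2 is assumed, because at BT = 1 the right-hand side vanishes while the regret can be positive. *)

(* Defs.v *)
From mathcomp Require Import all_boot all_order all_algebra.
From mathcomp Require Import all_classical all_reals all_analysis.

Set Implicit Arguments.
Unset Strict Implicit.
Unset Printing Implicit Defensive.

Import Order.TTheory GRing.Theory Num.Theory.
Import numFieldNormedType.Exports.

Local Open Scope classical_set_scope.
Local Open Scope ring_scope.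

Definition dotv (R : realType) (d : nat) (u v : 'rV[R]_d) : R :=
  \sum_(k < d) u 0 k * v 0 k.

(* The library norm on row vectors is the sup norm, hence a separate
   Euclidean one. *)
Definition l2norm (R : realType) (d : nat) (u : 'rV[R]_d) : R :=
  Num.sqrt (dotv u u).

Definition l2ball (R : realType) (d : nat) (B : R) : set 'rV[R]_d :=
  [set w | l2norm w <= B].
Arguments l2ball {R} d B.

Definition is_argmax (R : realType) (U : Type) (A : set U) (f : U -> R)
    (a : U) : Prop :=
  A a /\ forall b, A b -> f b <= f a.

Definition is_argmin (R : realType) (U : Type) (A : set U) (f : U -> R)
    (a : U) : Prop :=
  A a /\ forall b, A b -> f a <= f b.

(* Items are elements of 'I_N; alternatives are elements of option 'I_N, with
   None the outside option (null feature, null reward). *)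
Section Round.
Context {R : realType} {d N : nat}.
Implicit Types (x : 'I_N -> 'rV[R]_d) (r : 'I_N -> R).
Implicit Types (S : {set 'I_N}) (w : 'rV[R]_d) (i : option 'I_N).

Definition assortments (K : nat) : set {set 'I_N} :=
  [set S | (#|S| <= K)%N].

Definition alternatives S : {set option 'I_N} :=
  (None |: [set Some i | i in S])%SET.

Definition feature x i : 'rV[R]_d := if i is Some j then x j else 0.

Definition reward r i : R := if i is Some j then r j else 0.

(* Extended by 0 outside of the offered alternatives, so that it is a
   probability mass function on option 'I_N. *)
Definition mnl_prob x S w i : R :=
  if i \in alternatives S then
    expR (dotv (feature x i) w) / (1 + \sum_(j in S) expR (dotv (x j) w))
  else 0.

Definition exp_revenue x r S w : R :=
  \sum_(i in S) mnl_prob x S w (Some i) * r i.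

Definition mnl_mean x S w (f : option 'I_N -> R) : R :=
  \sum_(i in alternatives S) mnl_prob x S w i * f i.

Definition reward_variance x r S w : R :=
  mnl_mean x S w (fun i => (reward r i - mnl_mean x S w (reward r)) ^+ 2).

Definition round_loss x S (c : option 'I_N) w : R :=
  - \sum_(i in alternatives S) (c == i)%:R * ln (mnl_prob x S w i).

Definition optimistic_revenue x r (wtil : 'I_N -> 'rV[R]_d) S : R :=
  (\sum_(i in S) expR (dotv (x i) (wtil i)) * r i) /
  (1 + \sum_(j in S) expR (dotv (x j) (wtil j))).

End Round.

(* One trajectory: x t, r t, S t, c t are the features, rewards, offered
   assortment and observed choice of round t; rounds are numbered from 1. *)
Section Trajectory.
Context {R : realType} {d N : nat}.
Implicit Types (x : nat -> 'I_N -> 'rV[R]_d) (r : nat -> 'I_N -> R).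
Implicit Types (S Sstar : nat -> {set 'I_N}) (c : nat -> option 'I_N).

Definition cumulative_loss x S c (t : nat) (w : 'rV[R]_d) : R :=
  \sum_(1 <= s < t) round_loss (x s) (S s) (c s) w.

Definition conf_radius2 (B delta : R) (t : nat) : R :=
  ln (1 / delta)
  + d%:R * ln (Num.max (expR 1) (4 * expR 1 * B * (t.-1)%:R / d%:R)).

Definition conf_set (B delta : R) x S c (t : nat) (what : 'rV[R]_d)
    : set 'rV[R]_d :=
  [set w | l2ball d B w /\
    cumulative_loss x S c t w - cumulative_loss x S c t what
      <= conf_radius2 B delta t].

(* what and wtil are the maximum-likelihood estimator and the optimistic
   parameters computed by the algorithm at round t. All ties may be broken
   arbitrarily. *)
Record mle_algorithm_round (K : nat) (B delta : R) x r S c (t : nat)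
    (what : 'rV[R]_d) (wtil : 'I_N -> 'rV[R]_d) : Prop := {
  mle_estimate : is_argmin (l2ball d B) (cumulative_loss x S c t) what;
  mle_optimism : forall i : 'I_N,
    is_argmax (conf_set B delta x S c t what) (dotv (x t i)) (wtil i);
  mle_offer :
    is_argmax (assortments K) (optimistic_revenue (x t) (r t) wtil) (S t) }.

Definition regret x r S Sstar (wstar : 'rV[R]_d) (T : nat) : R :=
  \sum_(1 <= t < T.+1)
    (exp_revenue (x t) (r t) (Sstar t) wstar
     - exp_revenue (x t) (r t) (S t) wstar).

Definition total_variance x r S (wstar : 'rV[R]_d) (T : nat) : R :=
  \sum_(1 <= t < T.+1) reward_variance (x t) (r t) (S t) wstar.

End Trajectory.
Arguments conf_radius2 {R} d B delta t.

(* F t is the information available just before the choice of round t is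
   drawn: everything up to the choice of round t.-1, the features and rewards
   of round t (which may thus depend on the past and on extra randomness), and
   the assortment offered. The field mnl_choice_law is the defining property of
     P(c t = i | F t) = p_t(i | S_t, wstar). *)
Record mnl_bandit (R : realType) (d N T : nat) (disp : measure_display)
    (Omega : measurableType disp) (P : probability Omega R)
    (F : nat -> set (set Omega)) (wstar : 'rV[R]_d)
    (x : nat -> Omega -> 'I_N -> 'rV[R]_d) (r : nat -> Omega -> 'I_N -> R)
    (S : nat -> Omega -> {set 'I_N}) (c : nat -> Omega -> option 'I_N)
    : Prop := {
  mnl_sigma_algebra : forall t, sigma_algebra setT (F t);
  mnl_sub : forall t, F t `<=` measurable;
  mnl_filtration : forall s t, (s <= t)%N -> F s `<=` F t;
  mnl_features_measurable : forall t, (1 <= t <= T)%N ->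
    forall (i : 'I_N) (k : 'I_d) (Y : set R), measurable Y ->
    F t ((fun omega => x t omega i 0 k) @^-1` Y);
  mnl_rewards_measurable : forall t, (1 <= t <= T)%N ->
    forall (i : 'I_N) (Y : set R), measurable Y ->
    F t ((fun omega => r t omega i) @^-1` Y);
  mnl_offer_measurable : forall t, (1 <= t <= T)%N ->
    forall A : {set 'I_N}, F t (S t @^-1` [set A]);
  mnl_choice_measurable : forall t, (1 <= t <= T)%N ->
    forall i : option 'I_N, F t.+1 (c t @^-1` [set i]);
  mnl_choice_offered : forall t, (1 <= t <= T)%N ->
    forall omega, c t omega \in alternatives (S t omega);
  mnl_choice_law : forall t, (1 <= t <= T)%N ->
    forall (A : set Omega) (i : option 'I_N), F t A ->
    (P (A `&` (c t @^-1` [set i]))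
     = \int[P]_(omega in A)
         (mnl_prob (x t omega) (S t omega) wstar i)%:E)%E }.

(* Main.v *)
(** Confidence.  For a fixed finite prior q on R^d, the mixture of likelihood
    ratios M_t = sum_g q(g) exp(L_t(w* ) - L_t(g)) is a supermartingale, so by
    Ville's inequality it stays below 1/delta with probability at least
    1 - delta.  With q a product of discretized logistic laws, a Jensen lower
    bound for M_t shows that w* then belongs to every confidence set.

    Regret.  If w is in the confidence set of round b, then comparing the losses
    of w, w* and of their midpoint with the minimal loss gives a bound 2 beta^2
    on the sum over s < b of the midpoint gaps
      l_s(w) + l_s(w* ) - 2 l_s((w + w* )/2) >= ln(1 + Var(x_s . (w - w* )) / 16),
    where the variance is over the choice law at the midpoint.  Call a round bad
    if some later (or current) confidence set contains w with
    |x_i . (w - w* )| > 1 for an offered item i.  On good rounds the gap controls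
    the variance under w* up to an absolute constant, and on all rounds it
    controls kappa (x_i . (w - w* ))^2.  The first bound and an elliptical
    potential argument give the leading term, because the optimistic regret of a
    round is at most a constant times sum_i p_i (r_i - R)(x_i . (w~_i - w* )),
    to which the Cauchy-Schwarz inequality applies once the features are centred.
    The second bound, with another potential argument, limits the number of bad
    rounds to O(d^2 log^2(BT) / kappa). *)

Require Import Defs.
From mathcomp Require Import all_boot all_order all_algebra.
From mathcomp Require Import all_classical all_reals all_analysis.
From mathcomp Require Import measurable_realfun lra.
Import Order.TTheory GRing.Theory Num.Theory.
Import numFieldNormedType.Exports.
Import HBNNSimple.
Local Open Scope classical_set_scope.
Local Open Scope ring_scope.

(** * Quadratic forms and determinants *)

(** Comparing losses at a midpoint takes the place of gradient and Hessian estimates. The data term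
    of the loss is linear and cancels, so what remains is the logarithm of a product E exp(u) E
    exp(-u) under a finite law, and an elementary inequality bounds this product below. The obstacle
    is that the curvature so obtained is that of the midpoint, whose choice law may differ from the
    law at w* by a factor exponential in B. Deviation 1 is the threshold because up to there the
    midpoint law keeps at least a quarter of each probability under w*; beyond it only kappa is
    left.

    On the confidence side, the prior has to be fixed before any data is seen, while the radius to
    be met changes with t. The mesh is therefore chosen for the horizon T, and only the box of grid
    points used in the lower bound is adapted to t.

    All bounds are expressed through D = d ln(BT), which is at least 1/2 because BT >= 2; additive
    constants are absorbed in D, and delta enters only through a = 5 + 2 ln(1/delta). *)

Definition bilf {R : realType} {d : nat} (V : 'M[R]_d) (u v : 'rV[R]_d) : R :=
  (u *m V *m v^T) 0 0.

Definition posdef {R : realType} {d : nat} (V : 'M[R]_d) : Prop :=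
  V^T = V /\ forall u, u != 0 -> 0 < bilf V u u.

Lemma dotvE {R : realType} {d} (u v : 'rV[R]_d) : dotv u v = (u *m v^T) 0 0.
Proof. by rewrite mxE; apply: eq_bigr => k _; rewrite mxE. Qed.

Lemma dotvC {R : realType} {d} (u v : 'rV[R]_d) : dotv u v = dotv v u.
Proof. by apply: eq_bigr => k _; rewrite mulrC. Qed.

Lemma dotvDl {R : realType} {d} (u v w : 'rV[R]_d) :
  dotv (u + v) w = dotv u w + dotv v w.
Proof. by rewrite !dotvE mulmxDl mxE. Qed.

Lemma dotvDr {R : realType} {d} (u v w : 'rV[R]_d) :
  dotv w (u + v) = dotv w u + dotv w v.
Proof. by rewrite -!(dotvC _ w) dotvDl. Qed.

Lemma dotvZl {R : realType} {d} a (u w : 'rV[R]_d) :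
  dotv (a *: u) w = a * dotv u w.
Proof. by rewrite !dotvE -scalemxAl mxE. Qed.

Lemma dotvZr {R : realType} {d} a (u w : 'rV[R]_d) :
  dotv w (a *: u) = a * dotv w u.
Proof. by rewrite -!(dotvC _ w) dotvZl. Qed.

Lemma dotvNl {R : realType} {d} (u w : 'rV[R]_d) : dotv (- u) w = - dotv u w.
Proof. by rewrite -scaleN1r dotvZl mulN1r. Qed.

Lemma dotvNr {R : realType} {d} (u w : 'rV[R]_d) : dotv w (- u) = - dotv w u.
Proof. by rewrite -!(dotvC _ w) dotvNl. Qed.

Lemma dotvBr {R : realType} {d} (u v w : 'rV[R]_d) :
  dotv w (u - v) = dotv w u - dotv w v.
Proof. by rewrite dotvDr dotvNr. Qed.

Lemma dotvBl {R : realType} {d} (u v w : 'rV[R]_d) :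
  dotv (u - v) w = dotv u w - dotv v w.
Proof. by rewrite dotvDl dotvNl. Qed.

Lemma dotv0l {R : realType} {d} (w : 'rV[R]_d) : dotv 0 w = 0.
Proof. by rewrite dotvE mul0mx mxE. Qed.

Lemma dotv_suml {R : realType} {d} (J : finType) (f : J -> 'rV[R]_d) w :
  dotv (\sum_j f j) w = \sum_j dotv (f j) w.
Proof.
rewrite dotvE mulmx_suml summxE.
by apply: eq_bigr => j _; rewrite dotvE.
Qed.

Lemma dotv_ge0 {R : realType} {d} (u : 'rV[R]_d) : 0 <= dotv u u.
Proof. by apply: sumr_ge0 => k _; rewrite -expr2 sqr_ge0. Qed.

Lemma bilfC {R : realType} {d} (V : 'M[R]_d) u v :
  V^T = V -> bilf V u v = bilf V v u.
Proof.
move=> sV; rewrite /bilf -[in LHS](trmxK V) sV.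
have -> : u *m V^T *m v^T = (v *m V *m u^T)^T by rewrite !trmx_mul trmxK mulmxA.
by rewrite mxE.
Qed.

Lemma bilfDl {R : realType} {d} (V : 'M[R]_d) u v w :
  bilf V (u + v) w = bilf V u w + bilf V v w.
Proof. by rewrite /bilf !mulmxDl mxE. Qed.

Lemma bilfDr {R : realType} {d} (V : 'M[R]_d) u v w :
  bilf V w (u + v) = bilf V w u + bilf V w v.
Proof. by rewrite /bilf linearD /= mulmxDr mxE. Qed.

Lemma bilfZl {R : realType} {d} (V : 'M[R]_d) a u w :
  bilf V (a *: u) w = a * bilf V u w.
Proof. by rewrite /bilf -!scalemxAl mxE. Qed.

Lemma bilfZr {R : realType} {d} (V : 'M[R]_d) a u w :
  bilf V w (a *: u) = a * bilf V w u.
Proof. by rewrite /bilf linearZ /= -scalemxAr mxE. Qed.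

Lemma bilf_addm {R : realType} {d} (V W : 'M[R]_d) u v :
  bilf (V + W) u v = bilf V u v + bilf W u v.
Proof. by rewrite /bilf mulmxDr mulmxDl mxE. Qed.

Lemma bilf_rank1 {R : realType} {d} (y u : 'rV[R]_d) :
  bilf (y^T *m y) u u = dotv y u ^+ 2.
Proof.
rewrite /bilf mulmxA -(mulmxA _ y) mxE big_ord1.
by rewrite -!dotvE (dotvC u) expr2.
Qed.

Lemma bilf_scalar {R : realType} {d} (a : R) (u : 'rV[R]_d) :
  bilf a%:M u u = a * dotv u u.
Proof. by rewrite /bilf mul_mx_scalar -scalemxAl mxE dotvE. Qed.

Lemma posdef_ge0 {R : realType} {d} (V : 'M[R]_d) u :
  posdef V -> 0 <= bilf V u u.
Proof.
move=> [_ hV]; have [->|/hV/ltW//] := eqVneq u 0.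
by rewrite /bilf !mul0mx mxE.
Qed.

Lemma bilf_CS {R : realType} {d} (V : 'M[R]_d) u v : posdef V ->
  bilf V u v ^+ 2 <= bilf V u u * bilf V v v.
Proof.
move=> pV; have [sV hV] := pV.
have [->|v0] := eqVneq v 0.
  by rewrite /bilf trmx0 !mulmx0 mxE expr0n mulr0.
have p := hV _ v0.
have := posdef_ge0 _ (bilf V v v *: u - bilf V u v *: v) pV.
rewrite -scaleNr !(bilfDl, bilfDr, bilfZl, bilfZr) (bilfC V v u sV).
set a := bilf V u v; set b := bilf V u u; set c := bilf V v v in p *.
move=> h; have : 0 <= c * (b * c - a ^+ 2) by lra.
by rewrite pmulr_rge0 // subr_ge0.
Qed.

Lemma posdef_unit {R : realType} {d} (V : 'M[R]_d) : posdef V -> V \in unitmx.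
Proof.
move=> [_ hV]; rewrite -row_free_unit -kermx_eq0.
apply/rowV0P => v /sub_kermxP hv.
by apply/eqP/negPn/negP => /hV; rewrite /bilf hv mul0mx mxE ltxx.
Qed.

Lemma invmx_sym {R : realType} {d} (V : 'M[R]_d) : V^T = V ->
  (invmx V)^T = invmx V.
Proof. by move=> sV; rewrite trmx_inv sV. Qed.

Lemma bilf_inv {R : realType} {d} (V : 'M[R]_d) u v : posdef V ->
  bilf (invmx V) u v = bilf V (u *m invmx V) (v *m invmx V).
Proof.
move=> pV; have [sV _] := pV.
by rewrite /bilf mulmxKV ?posdef_unit// trmx_mul invmx_sym // mulmxA.
Qed.

Lemma bilf_invr {R : realType} {d} (V : 'M[R]_d) u v : posdef V ->
  dotv u v = bilf V (u *m invmx V) v.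
Proof. by move=> pV; rewrite /bilf mulmxKV ?posdef_unit// dotvE. Qed.

Lemma bilf_inv_ge0 {R : realType} {d} (V : 'M[R]_d) u : posdef V ->
  0 <= bilf (invmx V) u u.
Proof. by move=> pV; rewrite bilf_inv // posdef_ge0. Qed.

Lemma dual_CS {R : realType} {d} (V : 'M[R]_d) u v : posdef V ->
  dotv u v ^+ 2 <= bilf (invmx V) u u * bilf V v v.
Proof.
by move=> pV; rewrite (bilf_invr V) // bilf_inv //; apply: bilf_CS.
Qed.

Lemma posdef_rank1 {R : realType} {d} (V : 'M[R]_d) (y : 'rV[R]_d) :
  posdef V -> posdef (V + y^T *m y).
Proof.
move=> [sV hV]; split; first by rewrite linearD /= trmx_mul trmxK sV.
move=> u /hV hu; rewrite bilf_addm bilf_rank1.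
by rewrite ltr_pwDl // sqr_ge0.
Qed.

Lemma det_rank1 {R : realType} {d} (V : 'M[R]_d) (y : 'rV[R]_d) : posdef V ->
  \det (V + y^T *m y) = \det V * (1 + bilf (invmx V) y y).
Proof.
move=> pV.
set q : 'M[R]_1 := 1%:M + y *m invmx V *m y^T.
(* Two block triangular factorizations of one bordered matrix; equating their determinants gives the
   matrix determinant lemma. *)
have e1 : block_mx 1%:M (- y) y^T V =
    block_mx 1%:M 0 y^T 1%:M *m block_mx 1%:M (- y) 0 (V + y^T *m y).
  rewrite mulmx_block !mul1mx !mul0mx !mulmx1 ?mulmx0 ?addr0.
  by rewrite mulmxN addrCA addNr addr0.
have e2 : block_mx 1%:M (- y) y^T V =
    block_mx 1%:M (- y *m invmx V) 0 1%:M *m block_mx q 0 y^T V.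
  rewrite mulmx_block !mul1mx !mul0mx ?mulmx0 ?addr0 ?add0r.
  rewrite mulmxKV ?posdef_unit // /q !mulNmx addrK //.
have := congr1 determinant e1; rewrite e2 !det_mulmx.
rewrite !det_lblock !det_ublock !det1 !mul1r => <-.
by rewrite mulrC det_mx11 mxE [X in X + _]mxE eqxx.
Qed.

Lemma posdef_sum {R : realType} {d} (V : 'M[R]_d) (s : seq 'rV[R]_d) :
  posdef V -> posdef (V + \sum_(y <- s) y^T *m y).
Proof.
elim: s V => [|z s IH] V pV; first by rewrite big_nil addr0.
by rewrite big_cons addrA; apply: IH; apply: posdef_rank1.
Qed.

(** Duality replaces the Sherman-Morrison formula: the vector [y *m invmx V] is tested in [dual_CS]
    for the updated matrix, and the rank-one part of its norm is bounded by [dual_CS] for [V]. *)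
Lemma bilf_inv_rank1 {R : realType} {d} (V : 'M[R]_d) (y z : 'rV[R]_d) : posdef V ->
  bilf (invmx V) y y <=
  (1 + bilf (invmx V) z z) * bilf (invmx (V + z^T *m z)) y y.
Proof.
move=> pV; have pW := posdef_rank1 _ z pV.
set n := bilf _ y y; set m := bilf _ z z.
have m0 : 0 <= m by apply: bilf_inv_ge0.
have n0 : 0 <= n by apply: bilf_inv_ge0.
have [n00|nn] := eqVneq n 0.
  by rewrite n00 mulr_ge0 ?addr_ge0 ?ler01 ?bilf_inv_ge0.
have np : 0 < n by rewrite lt_def nn.
have h := dual_CS _ y (y *m invmx V) pW.
have e : dotv y (y *m invmx V) = n by rewrite /n bilf_inv// -bilf_invr.
have h2 := dual_CS _ z (y *m invmx V) pV.
have h3 : bilf V (y *m invmx V) (y *m invmx V) = n by rewrite /n bilf_inv.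
rewrite e bilf_addm bilf_rank1 h3 in h; rewrite h3 -/m in h2.
set k := bilf (invmx (V + _)) y y in h *.
have k0 : 0 <= k by apply: bilf_inv_ge0.
rewrite -(ler_pM2r np) -expr2 (le_trans h) //.
rewrite [leRHS](_ : _ = k * (n + m * n)); last by lra.
by apply: ler_wpM2l => //; rewrite lerD2l.
Qed.

Lemma det_schur {R : realType} {d} (M : 'M[R]_(1 + d)) : posdef M ->
  let a := ulsubmx M 0 0 in
  let D := drsubmx M - a^-1 *: ((ursubmx M)^T *m ursubmx M) in
  [/\ 0 < a, posdef D & \det M = a * \det D].
Proof.
move=> [sM hM] a D.
have eM := submxK M.
set b := ursubmx M in D eM *.
have eb : dlsubmx M = b^T by rewrite trmx_ursub sM.
have ea : ulsubmx M = a%:M by rewrite [LHS]mx11_scalar.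
have eD : (drsubmx M)^T = drsubmx M by rewrite trmx_drsub sM.
rewrite eb ea in eM.
have bil u v : bilf M (row_mx u%:M v) (row_mx u%:M v) =
    u ^+ 2 * a + 2 * u * dotv b v + bilf (drsubmx M) v v.
  rewrite /bilf -{1}eM mul_row_block tr_row_mx mul_row_col.
  rewrite !mulmxDl ![(_ + _ : 'M[R]_(1, 1)) _ _]mxE.
  rewrite tr_scalar_mx !mul_scalar_mx !mul_mx_scalar -!scalemxAl.
  have sE (c : R) (A : 'M[R]_1) : (c *: A) 0 0 = c * A 0 0 by rewrite mxE.
  rewrite !sE -(dotvE b v) [a%:M _ _]mxE eqxx mulr1n.
  have -> : (v *m b^T) 0 0 = dotv b v by rewrite dotvC dotvE.
  by lra.
have a0 : 0 < a.
  have := hM (row_mx 1%:M 0).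
  rewrite bil /bilf mul0mx dotvC dotv0l mul0mx mxE mulr0 !addr0 expr1n mul1r.
  apply; apply/eqP; rewrite -(@row_mx0 _ 1 1 d) => /eq_row_mx[h _].
  have := congr1 determinant h; rewrite det1 det_mx11 mxE => /eqP.
  by rewrite oner_eq0.
have pD : posdef D.
  split; first by rewrite linearB /= linearZ /= trmx_mul trmxK eD.
  move=> v v0.
  (* For given [v] this first coordinate minimises the form, and the minimum is the value of the
     Schur complement at [v]. *)
  have := hM (row_mx (- (a^-1 * dotv b v))%:M v).
  rewrite bil.
  have -> : bilf D v v = bilf (drsubmx M) v v - a^-1 * dotv b v ^+ 2.
    rewrite -bilf_rank1 /D /bilf mulmxBr mulmxBl mxE [X in _ + X]mxE.
    by rewrite -scalemxAr -scalemxAl [X in - X]mxE.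
  have -> : (- (a^-1 * dotv b v)) ^+ 2 * a = a^-1 * dotv b v ^+ 2.
    by rewrite sqrrN exprMn mulrAC (expr2 a^-1) -(mulrA a^-1) mulVf ?gt_eqF// mulr1.
  move=> h; have {h} := h.
  have hn : row_mx (- (a^-1 * dotv b v))%:M v != 0.
    apply: contra v0 => /eqP; rewrite -(@row_mx0 _ 1 1 d) => /eq_row_mx[_ ->//].
  by move=> /(_ hn); lra.
split=> //.
have e1 : M = block_mx 1%:M 0 (a^-1 *: b^T) 1%:M *m block_mx a%:M b 0 D.
  rewrite -[LHS]eM mulmx_block ?mul1mx ?mul0mx ?mulmx0 ?mulmx1 ?addr0.
  congr block_mx.
    by rewrite mul_mx_scalar scalerA mulfV ?gt_eqF// scale1r.
  by rewrite /D -scalemxAl addrCA subrr addr0.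
rewrite [in LHS]e1 det_mulmx det_lblock det_ublock !det1 !mul1r det_scalar1 //.
Qed.

(** Hadamard's inequality by elimination: passing to the Schur complement subtracts a nonnegative
    amount from each diagonal entry. Determinants of Gram matrices can then be bounded coordinate by
    coordinate. *)
Lemma hadamard {R : realType} {d} (M : 'M[R]_d) : posdef M ->
  0 < \det M <= \prod_i M i i.
Proof.
elim: d M => [|d IH] M pM; first by rewrite det_mx00 big_ord0 ltr01 lexx.
have [a0 pD ->] := @det_schur R d M pM.
have /andP[D0 D1] := IH _ pD.
rewrite mulr_gt0 //= big_ord_recl.
have -> : M ord0 ord0 = ulsubmx (M : 'M[R]_(1 + d)) 0 0.
  by rewrite !mxE; congr (M _ _); apply/val_inj.
rewrite ler_wpM2l ?(ltW a0)// (le_trans D1) //.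
apply: ler_prod => i _; apply/andP; split.
  have := posdef_ge0 _ (delta_mx 0 i) pD.
  by rewrite /bilf -rowE trmx_delta -colE !mxE.
rewrite !mxE big_ord1 !mxE.
have -> : rshift 1 i = lift ord0 i by apply/val_inj.
rewrite gerBl mulr_ge0 ?invr_ge0 -?expr2 ?sqr_ge0 //.
by move: a0; rewrite !mxE => /ltW.
Qed.

(* The factor lost by [bilf_inv_rank1] at each rank-one update is exactly the
   growth of the determinant. *)
Lemma det_sum_ge {R : realType} {d} (V : 'M[R]_d) (s : seq 'rV[R]_d) :
  posdef V ->
  \det V * (1 + \sum_(y <- s) bilf (invmx V) y y) <=
  \det (V + \sum_(y <- s) y^T *m y).
Proof.
elim: s V => [|z s IH] V pV; first by rewrite !big_nil !addr0 mulr1.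
have pW := posdef_rank1 _ z pV.
rewrite !big_cons !addrA; apply: le_trans (IH _ pW).
rewrite det_rank1 // -mulrA ler_wpM2l //; first by have /andP[/ltW] := hadamard _ pV.
rewrite mulrDr mulr1 lerD2l mulr_sumr ler_sum // => y _.
exact: bilf_inv_rank1.
Qed.

(** * Elliptical potential *)

(** A round contributes a whole family of directions, since a variance under a choice law is a sum
    of squares over all alternatives. *)
Definition gram {R : realType} {d : nat} {J : finType} (lam : R)
    (Y : nat -> J -> 'rV[R]_d) (t : nat) : 'M[R]_d :=
  lam%:M + \sum_(1 <= s < t) \sum_j (Y s j)^T *m Y s j.

Lemma gramS {R : realType} {d : nat} {J : finType} (lam : R)
    (Y : nat -> J -> 'rV[R]_d) (t : nat) : (1 <= t)%N ->
  gram lam Y t.+1 = gram lam Y t + \sum_j (Y t j)^T *m Y t j.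
Proof. by move=> t1; rewrite /gram big_nat_recr //= addrA. Qed.

Lemma gram_le1 {R : realType} {d : nat} {J : finType} (lam : R)
    (Y : nat -> J -> 'rV[R]_d) (t : nat) : (t <= 1)%N -> gram lam Y t = lam%:M.
Proof. by move=> t1; rewrite /gram big_geq // addr0. Qed.

Lemma posdef_gram {R : realType} {d : nat} {J : finType} (lam : R)
    (Y : nat -> J -> 'rV[R]_d) (t : nat) : 0 < lam -> posdef (gram lam Y t).
Proof.
move=> l0.
have p1 : posdef (lam%:M : 'M[R]_d).
  split; first by rewrite tr_scalar_mx.
  move=> u u0; rewrite bilf_scalar mulr_gt0 // lt_def dotv_ge0 andbT.
  apply: contra u0 => /eqP h; apply/eqP/rowP => k; rewrite mxE.
  have h2 : forall k, true -> u 0 k * u 0 k = 0.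
    by apply/psumr_eq0P; [move=> i _; rewrite -expr2 sqr_ge0|exact: h].
  by have /eqP := h2 k isT; rewrite mulf_eq0 orbb => /eqP.
elim: t => [|[|t] IH]; [by rewrite gram_le1|by rewrite gram_le1|rewrite gramS //].
by have := posdef_sum _ [seq Y t.+1 j | j <- index_enum J] IH; rewrite big_map.
Qed.

Lemma bilf_gram {R : realType} {d : nat} {J : finType} (lam : R)
    (Y : nat -> J -> 'rV[R]_d) (t : nat) u :
  bilf (gram lam Y t) u u =
  lam * dotv u u + \sum_(1 <= s < t) \sum_j dotv (Y s j) u ^+ 2.
Proof.
rewrite /gram bilf_addm bilf_scalar; congr (_ + _).
elim/big_rec2: _ => [|s a V _ <-]; first by rewrite /bilf mulmx0 mul0mx mxE.
rewrite bilf_addm; congr (_ + _).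
elim/big_rec2: _ => [|j b W _ <-]; first by rewrite /bilf mulmx0 mul0mx mxE.
by rewrite bilf_addm bilf_rank1.
Qed.

(** By [det_sum_ge] each summand is at most the increment of ln det, so the sum telescopes;
    [hadamard] bounds the last determinant by (lam + T)^d, which is why the directions are
    normalised coordinatewise. *)
Lemma elliptical_potential {R : realType} {d : nat} {J : finType} (lam : R)
    (Y : nat -> J -> 'rV[R]_d) (T : nat) : 0 < lam ->
  (forall t k, (1 <= t <= T)%N -> \sum_j (Y t j 0 k) ^+ 2 <= 1) ->
  \sum_(1 <= t < T.+1)
     ln (1 + \sum_j bilf (invmx (gram lam Y t)) (Y t j) (Y t j)) <=
  d%:R * ln (1 + T%:R / lam).
Proof.
move=> l0 hY.
have detp t : 0 < \det (gram lam Y t).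
  by have /andP[] := hadamard _ (posdef_gram _ Y t l0).
have h1 n : \sum_(1 <= t < n.+1)
     ln (1 + \sum_j bilf (invmx (gram lam Y t)) (Y t j) (Y t j)) <=
     ln (\det (gram lam Y n.+1)) - ln (lam ^+ d).
  elim: n => [|n IH]; first by rewrite big_geq // gram_le1 // det_scalar subrr.
  rewrite big_nat_recr //=; apply: le_trans (lerD IH (lexx _)) _.
  rewrite addrAC lerD2r.
  have X0 : 0 <= \sum_j bilf (invmx (gram lam Y n.+1)) (Y n.+1 j) (Y n.+1 j).
    by apply: sumr_ge0 => j _; apply/bilf_inv_ge0/posdef_gram.
  rewrite -lnM ?posrE //; last by rewrite ltr_pwDl.
  rewrite ler_ln ?posrE //; last by rewrite mulr_gt0 // ltr_pwDl.
  rewrite (gramS _ _ n.+1) //.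
  have := det_sum_ge _ [seq Y n.+1 j | j <- index_enum J] (posdef_gram _ Y n.+1 l0).
  by rewrite !big_map.
apply: le_trans (h1 T) _.
have hdet : \det (gram lam Y T.+1) <= (lam + T%:R) ^+ d.
  have /andP[_ h] := hadamard _ (posdef_gram _ Y T.+1 l0).
  apply: le_trans h _; rewrite -[d in leRHS]card_ord -prodr_const.
  apply: ler_prod => k _; apply/andP; split.
    have := posdef_ge0 _ (delta_mx 0 k) (posdef_gram _ Y T.+1 l0).
    by rewrite /bilf -rowE trmx_delta -colE !mxE.
  rewrite !mxE eqxx mulr1n lerD2l summxE.
  apply: (@le_trans _ _ (\sum_(1 <= t < T.+1) 1)).
    rewrite !big_nat; apply: ler_sum => t tT; rewrite summxE.
    apply: le_trans (hY t k _); last by move: tT; rewrite ltnS.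
    by apply: ler_sum => j _; rewrite mxE big_ord1 mxE expr2.
  by rewrite sumr_const_nat subSS subn0.
have lT : 0 < lam + T%:R by rewrite ltr_pwDl.
rewrite -ler_ln ?posrE ?exprn_gt0 // in hdet.
apply: le_trans (lerB hdet (lexx _)) _.
rewrite !lnXn // -mulrnBl mulr_natl -ln_div ?posrE //.
by rewrite mulrDl mulfV ?gt_eqF.
Qed.

Lemma ln1Dx_ge {R : realType} (x : R) : 0 <= x -> x / (1 + x) <= ln (1 + x).
Proof.
move=> x0; have x1 : 0 < 1 + x by rewrite ltr_pwDl.
have := @le_ln1Dx R ((1 + x)^-1 - 1).
rewrite addrCA subrr addr0 lnV ?posrE// ltrBDr [_ + 1]addrC subrr invr_gt0 x1.
move=> /(_ isT) h.
have h1 : (1 + x) * (1 + x)^-1 = 1 by rewrite mulfV ?gt_eqF.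
lra.
Qed.

Lemma ln1Dx_ge_half {R : realType} (x : R) : 0 <= x <= 1 -> x / 2 <= ln (1 + x).
Proof.
move=> /andP[x0 x1]; apply: le_trans (ln1Dx_ge _ x0).
by rewrite ler_wpM2l // lef_pV2 ?posrE; lra.
Qed.

(** * Variances of finite laws *)

Definition pvar {R : realType} {J : finType} (p u : J -> R) : R :=
  \sum_j p j * (u j - \sum_k p k * u k) ^+ 2.

Section Variance.
Context {R : realType} {J : finType} (p : J -> R).
Hypotheses (p0 : forall j, 0 <= p j) (p1 : \sum_j p j = 1).

Lemma pvar_ge0 (u : J -> R) : 0 <= pvar p u.
Proof. by apply: sumr_ge0 => j _; rewrite mulr_ge0 // sqr_ge0. Qed.

Lemma pvar_le (u : J -> R) c : pvar p u <= \sum_j p j * (u j - c) ^+ 2.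
Proof.
rewrite /pvar; set m := \sum_k p k * u k.
have -> : \sum_j p j * (u j - c) ^+ 2 =
    \sum_j (p j * (u j - m) ^+ 2 + (2 * (m - c) * (p j * u j)
      + (c ^+ 2 - m ^+ 2) * p j)) by apply: eq_bigr => j _; lra.
rewrite !big_split /= -!mulr_sumr p1 -/m.
by have := sqr_ge0 (m - c); lra.
Qed.

(** This is where kappa enters: taking the outside option for [i], where the deviation vanishes, one
    offered item alone guarantees variance p_0 p_j u_j^2. *)
Lemma pvar_pair (u : J -> R) i j : i != j -> u i = 0 ->
  p i * p j * u j ^+ 2 <= pvar p u.
Proof.
move=> ij ui; rewrite /pvar; set m := \sum_k p k * u k.
have h : p i + p j <= 1.
  by rewrite -p1 (bigD1 i) //= (bigD1 j) 1?eq_sym //= addrA lerDl sumr_ge0.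
apply: (@le_trans _ _ (p i * m ^+ 2 + p j * (u j - m) ^+ 2)).
  set X := _ + _.
  have X0 : 0 <= X by rewrite addr_ge0 // mulr_ge0 // sqr_ge0.
  apply: (@le_trans _ _ ((p i + p j) * X)); last by rewrite ler_piMl.
  (* This square is exactly the difference of the two sides. *)
  by have := sqr_ge0 ((p i + p j) * m - p j * u j); rewrite /X; lra.
rewrite (bigD1 i) //= (bigD1 j) 1?eq_sym //= addrA ui sub0r sqrrN lerDl.
by rewrite sumr_ge0 // => k _; rewrite mulr_ge0 // sqr_ge0.
Qed.

Lemma cosh_ge (y : R) : y ^+ 2 / 4 <= expR y + expR (- y) - 2.
Proof.
wlog y0 : y / 0 <= y => [H|].
  have [/H//|/ltW yn] := lerP 0 y.
  by have := H (- y); rewrite oppr_ge0 opprK sqrrN => /(_ yn); lra.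
set E := expR (y / 2).
have E0 : 0 < E by apply: expR_gt0.
have e1 : expR y = E ^+ 2 by rewrite expr2 -expRD -splitr.
have e2 : expR (- y) = E^-1 ^+ 2.
  by rewrite expr2 -expRN -expRD -opprD -splitr.
have h : 1 + y / 2 <= E by apply: expR_ge1Dx.
have h1 : E * E^-1 = 1 by rewrite mulfV ?gt_eqF.
have h2 : E^-1 <= 1 by rewrite invf_le1 //; lra.
have : (y / 2) ^+ 2 <= (E - E^-1) ^+ 2.
  by rewrite ler_sqr ?nnegrE; lra.
by rewrite e1 e2; lra.
Qed.

Lemma pmean_expR_gt0 (u : J -> R) : 0 < \sum_j p j * expR (u j).
Proof.
rewrite lt_def sumr_ge0 ?andbT; last by move=> j _; rewrite mulr_ge0 ?expR_ge0.
apply/eqP => /psumr_eq0P h; have : \sum_j p j = 0.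
  apply: big1 => j _; have /eqP := h (fun i _ => mulr_ge0 (p0 i) (expR_ge0 _)) j isT.
  by rewrite mulf_eq0 [expR _ == 0]gt_eqF ?expR_gt0 // orbF => /eqP.
by rewrite p1 => /eqP; rewrite oner_eq0.
Qed.

(** Shifting [u] by m = ln E exp(u) gives E exp(u - m) = 1, so the product equals 1 +
    E[2 cosh(u - m) - 2]. A quadratic lower bound on cosh leaves a second moment about [m], which
    dominates the variance. *)
Lemma pvar_expR (u : J -> R) :
  1 + pvar p u / 4 <=
  (\sum_j p j * expR (u j)) * (\sum_j p j * expR (- u j)).
Proof.
set mu := \sum_j p j * expR (u j).
have mu0 : 0 < mu by apply: pmean_expR_gt0.
have e : mu = expR (ln mu) by rewrite lnK.
set m := ln mu in e.
have k : mu * mu^-1 = 1 by rewrite mulfV ?gt_eqF.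
have -> : mu * (\sum_j p j * expR (- u j)) =
   1 + \sum_j p j * (expR (u j - m) + expR (- (u j - m)) - 2).
  have -> : \sum_j p j * (expR (u j - m) + expR (- (u j - m)) - 2) =
     \sum_j (mu^-1 * (p j * expR (u j)) + (mu * (p j * expR (- u j)) - 2 * p j)).
    apply: eq_bigr => j _.
    by rewrite opprB [expR (u j - m)]expRB [expR (m - u j)]expRD -e; lra.
  rewrite !big_split /= sumrN -!mulr_sumr p1 -/mu.
  by rewrite (mulrC mu^-1); lra.
rewrite lerD2l; apply: le_trans (_ : _ <= (\sum_j p j * (u j - m) ^+ 2) / 4) _.
  by rewrite ler_wpM2r // ?invr_ge0 // pvar_le.
rewrite mulr_suml; apply: ler_sum => j _; rewrite -mulrA.
by rewrite ler_wpM2l // cosh_ge.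
Qed.
End Variance.

(** * The multinomial logit model *)

Definition mnl_norm {R : realType} {d N : nat} (x : 'I_N -> 'rV[R]_d)
    (S : {set 'I_N}) (w : 'rV[R]_d) : R :=
  1 + \sum_(j in S) expR (dotv (x j) w).

Section MNL.
Context {R : realType} {d N : nat} (x : 'I_N -> 'rV[R]_d) (S : {set 'I_N}).
Implicit Types (w v : 'rV[R]_d) (i : option 'I_N).

Lemma None_alternatives : None \in alternatives S.
Proof. by rewrite !inE eqxx. Qed.

Lemma Some_alternatives (j : 'I_N) : (Some j \in alternatives S) = (j \in S).
Proof.
rewrite !inE /=; apply/imsetP/idP => [[k kS [->]]//|jS]; by exists j.
Qed.

Lemma sum_alternatives (F : option 'I_N -> R) :
  \sum_(i in alternatives S) F i = F None + \sum_(j in S) F (Some j).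
Proof.
rewrite big_setU1 /=; last by apply/imsetP => -[].
by rewrite big_imset //= => a b _ _ [].
Qed.

Lemma mnl_normE w :
  mnl_norm x S w = \sum_(i in alternatives S) expR (dotv (feature x i) w).
Proof. by rewrite sum_alternatives /= dotv0l expR0. Qed.

Lemma mnl_norm_ge1 w : 1 <= mnl_norm x S w.
Proof. by rewrite /mnl_norm lerDl sumr_ge0 // => j _; apply: expR_ge0. Qed.

Lemma mnl_norm_gt0 w : 0 < mnl_norm x S w.
Proof. exact: lt_le_trans ltr01 (mnl_norm_ge1 w). Qed.

Lemma mnl_probE w i : i \in alternatives S ->
  mnl_prob x S w i = expR (dotv (feature x i) w) / mnl_norm x S w.
Proof. by rewrite /mnl_prob => ->. Qed.

Lemma mnl_prob_ge0 w i : 0 <= mnl_prob x S w i.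
Proof.
rewrite /mnl_prob; case: ifP => // _.
by rewrite divr_ge0 ?expR_ge0 // ltW // mnl_norm_gt0.
Qed.

Lemma mnl_prob_gt0 w i : i \in alternatives S -> 0 < mnl_prob x S w i.
Proof. by move=> iS; rewrite mnl_probE // divr_gt0 ?expR_gt0 // mnl_norm_gt0. Qed.

Lemma mnl_prob_notin w i : i \notin alternatives S -> mnl_prob x S w i = 0.
Proof. by rewrite /mnl_prob => /negbTE ->. Qed.

Lemma mnl_meanE w f : mnl_mean x S w f = \sum_i mnl_prob x S w i * f i.
Proof.
rewrite /mnl_mean big_mkcond /=; apply: eq_bigr => i _.
by case: ifPn => // /mnl_prob_notin ->; rewrite mul0r.
Qed.

Lemma mnl_prob_sum w : \sum_i mnl_prob x S w i = 1.
Proof.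
transitivity (mnl_mean x S w (fun=> 1)).
  by rewrite mnl_meanE; apply: eq_bigr => i _; rewrite mulr1.
rewrite /mnl_mean; under eq_bigr => i iS do rewrite mnl_probE // mulr1.
by rewrite -mulr_suml -mnl_normE mulfV // gt_eqF // mnl_norm_gt0.
Qed.

Lemma mnl_prob_le1 w i : mnl_prob x S w i <= 1.
Proof.
rewrite -(mnl_prob_sum w) (bigD1 i) //= lerDl.
by rewrite sumr_ge0 // => j _; apply: mnl_prob_ge0.
Qed.

Lemma reward_varianceE (r : 'I_N -> R) w :
  reward_variance x r S w = pvar (mnl_prob x S w) (reward r).
Proof. by rewrite /reward_variance mnl_meanE mnl_meanE. Qed.

Lemma mnl_norm_ratio w v : mnl_norm x S w / mnl_norm x S v =
  \sum_i mnl_prob x S v i * expR (dotv (feature x i) (w - v)).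
Proof.
rewrite -mnl_meanE /mnl_mean mnl_normE mulr_suml; apply: eq_bigr => i iS.
by rewrite mnl_probE // mulrAC -expRD -dotvDr addrC subrK.
Qed.

Lemma round_lossE c w : c \in alternatives S ->
  round_loss x S c w = ln (mnl_norm x S w) - dotv (feature x c) w.
Proof.
move=> cS; rewrite /round_loss (bigD1 c) //= eqxx mul1r big1 ?addr0; last first.
  by move=> i /andP[_ /negbTE ic]; rewrite eq_sym ic mul0r.
rewrite mnl_probE // ln_div ?posrE ?expR_gt0 ?mnl_norm_gt0 //.
by rewrite expRK opprB.
Qed.

(* Midpoint convexity gap of the loss. The terms linear in the parameter cancel,
   so the gap does not depend on the observed choice. *)
Definition loss_gap c w v : R :=
  round_loss x S c w + round_loss x S c v
  - 2 * round_loss x S c (2^-1 *: (w + v)).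

(** Relative to the midpoint, the two normalisers are the generating functions of [u] and [- u],
    where [u] comes from half of [w - v]. Halving turns the 4 of [pvar_expR] into 16. *)
Lemma loss_gap_ge c w v : c \in alternatives S ->
  ln (1 + pvar (mnl_prob x S (2^-1 *: (w + v)))
             (fun i => dotv (feature x i) (w - v)) / 16) <= loss_gap c w v.
Proof.
move=> cS; rewrite /loss_gap !round_lossE //; set m := _ *: _.
set z := fun i => _.
have e1 : w - m = 2^-1 *: (w - v) by apply/rowP => k; rewrite !mxE; lra.
have e2 : v - m = - (2^-1 *: (w - v)) by apply/rowP => k; rewrite !mxE; lra.
set u := fun i => dotv (feature x i) (w - m).
have ez : pvar (mnl_prob x S m) z / 16 = pvar (mnl_prob x S m) u / 4.
  rewrite /pvar !mulr_suml; apply: eq_bigr => i _.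
  rewrite (_ : \sum_k _ * u k = 2^-1 * \sum_k mnl_prob x S m k * z k).
    by rewrite /u e1 dotvZr -/(z i); lra.
  by rewrite mulr_sumr; apply: eq_bigr => k _; rewrite /u e1 dotvZr -/(z k); lra.
rewrite ez.
have -> : ln (mnl_norm x S w) - dotv (feature x c) w +
    (ln (mnl_norm x S v) - dotv (feature x c) v) -
    2 * (ln (mnl_norm x S m) - dotv (feature x c) m) =
    ln ((mnl_norm x S w / mnl_norm x S m) * (mnl_norm x S v / mnl_norm x S m)).
  rewrite lnM ?posrE ?divr_gt0 ?mnl_norm_gt0 //.
  rewrite !ln_div ?posrE ?divr_gt0 ?mnl_norm_gt0 //.
  by rewrite /m dotvZr dotvDr; lra.
have h := pvar_expR _ (mnl_prob_ge0 m) (mnl_prob_sum m) u.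
have p0 : 0 < 1 + pvar (mnl_prob x S m) u / 4.
  by rewrite ltr_pwDl // divr_ge0 // pvar_ge0 // => i; apply: mnl_prob_ge0.
have e3 : (\sum_j mnl_prob x S m j * expR (u j)) *
    (\sum_j mnl_prob x S m j * expR (- u j)) =
    mnl_norm x S w / mnl_norm x S m * (mnl_norm x S v / mnl_norm x S m).
  rewrite !mnl_norm_ratio; congr (_ * _); apply: eq_bigr => i _.
  by rewrite e2 -e1 dotvNr.
rewrite e3 in h; rewrite ler_ln ?posrE //; exact: lt_le_trans p0 h.
Qed.

Lemma loss_gap_ge0 c w v : c \in alternatives S -> 0 <= loss_gap c w v.
Proof.
move=> cS; apply: le_trans (loss_gap_ge _ _ _ cS).
by rewrite ln_ge0 // lerDl divr_ge0 // pvar_ge0 // => i; apply: mnl_prob_ge0.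
Qed.

Lemma sqr_le_expR (y : R) : 0 <= y -> y ^+ 2 <= expR y.
Proof.
move=> y0; have h : 1 + y / 4 <= expR (y / 4) by apply: expR_ge1Dx.
have -> : expR y = (expR (y / 4) ^+ 2) ^+ 2.
  by rewrite -exprM -expRM_natl; congr expR; lra.
have h2 : y <= expR (y / 4) ^+ 2.
  apply: (@le_trans _ _ ((1 + y / 4) ^+ 2)).
    by have := sqr_ge0 (1 - y / 4); lra.
  by rewrite ler_sqr ?nnegrE ?expR_ge0 //; lra.
by rewrite ler_sqr ?nnegrE ?sqr_ge0.
Qed.

(* Since p_i p_0 <= exp (- |x_i . w|), the constant kappa is so small that
   kappa (x_i . w)^2 never exceeds 1; this keeps the bounds free of B. *)
Lemma mnl_prob_mul_le1 w (i : 'I_N) : i \in S ->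
  mnl_prob x S w (Some i) * mnl_prob x S w None * dotv (x i) w ^+ 2 <= 1.
Proof.
move=> iS; rewrite !mnl_probE ?None_alternatives ?Some_alternatives //=.
rewrite dotv0l expR0; set a := dotv _ _; set Z := mnl_norm _ _ _.
have Z1 : 1 + expR a <= Z.
  by rewrite /Z /mnl_norm lerD2l (bigD1 i) //= lerDl sumr_ge0 // => j _; apply: expR_ge0.
have Z0 : 0 < Z by apply: mnl_norm_gt0.
have ea := expR_gt0 a.
have -> : expR a / Z * (1 / Z) * a ^+ 2 = expR a * a ^+ 2 / (Z * Z).
  by rewrite invfM; lra.
rewrite ler_pdivrMr ?mulr_gt0 // mul1r.
have [a0|a0] := lerP 0 a.
  apply: (@le_trans _ _ (expR a * expR a)).
    by rewrite ler_wpM2l ?expR_ge0 // sqr_le_expR.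
  by apply: ler_pM; rewrite ?expR_ge0 //; lra.
have h : (- a) ^+ 2 <= expR (- a) by apply: sqr_le_expR; lra.
rewrite sqrrN in h.
apply: (@le_trans _ _ (expR a * expR (- a))); first by rewrite ler_wpM2l ?expR_ge0.
by rewrite expRxMexpNx_1 -[leLHS]mulr1; apply: ler_pM => //; lra.
Qed.

Lemma loss_gap_kappa c w v (kappa : R) (i : 'I_N) :
  c \in alternatives S -> i \in S -> 0 <= kappa ->
  (forall u, u \in [:: w; v; 2^-1 *: (w + v)] ->
     kappa <= mnl_prob x S u (Some i) * mnl_prob x S u None) ->
  kappa * dotv (x i) (w - v) ^+ 2 / 32 <= loss_gap c w v.
Proof.
move=> cS iS k0 hk; apply: le_trans (loss_gap_ge _ w v cS).
set m := 2^-1 *: _ in hk *; set z := fun i => _.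
set y := kappa * dotv (x i) (w - v) ^+ 2 / 16.
have y0 : 0 <= y by rewrite divr_ge0 // mulr_ge0 // sqr_ge0.
have hy u : u \in [:: w; v; m] -> kappa * dotv (x i) u ^+ 2 <= 1.
  move=> /hk h; apply: le_trans (mnl_prob_mul_le1 u i iS).
  by rewrite ler_wpM2r // sqr_ge0.
(* Needed to linearise the logarithm: kappa (x_i . w)^2 <= 1 at both ends bounds kappa times the
   squared difference by 4. *)
have y1 : y <= 1.
  have hw := hy w (mem_head _ _).
  have hv : kappa * dotv (x i) v ^+ 2 <= 1 by apply: hy; rewrite !inE eqxx orbT.
  rewrite /y dotvBr.
  have : 0 <= kappa * (dotv (x i) w + dotv (x i) v) ^+ 2 by rewrite mulr_ge0 // sqr_ge0.
  lra.
have hv : y <= pvar (mnl_prob x S m) z / 16.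
  rewrite /y ler_wpM2r //.
  have := @pvar_pair R _ _ (mnl_prob_ge0 m) (mnl_prob_sum m) z None (Some i) isT.
  rewrite /z /= dotv0l => /(_ erefl); apply: le_trans.
  rewrite ler_wpM2r ?sqr_ge0 // mulrC; apply: hk.
  by rewrite !inE eqxx !orbT.
have -> : kappa * dotv (x i) (w - v) ^+ 2 / 32 = y / 2 by rewrite /y; lra.
apply: (@le_trans _ _ (ln (1 + y))); first by rewrite ln1Dx_ge_half // y0.
by rewrite ler_ln ?posrE ?lerD2l // ltr_pwDl // (le_trans y0).
Qed.

(** With deviations at most 1, moving to the midpoint costs at most a factor 2 in each numerator and
    2 in the normaliser, hence 4 in the variance. With 16 from [loss_gap_ge] and 2 from the
    logarithm this makes 128. *)
Lemma loss_gap_var c w v : c \in alternatives S ->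
  (forall j, j \in S -> `|dotv (x j) (w - v)| <= 1) ->
  pvar (mnl_prob x S v) (fun i => dotv (feature x i) (w - v)) / 128
  <= loss_gap c w v.
Proof.
move=> cS hz; apply: le_trans (loss_gap_ge _ w v cS).
set m := 2^-1 *: _; set z := fun i => _.
have z1 i : i \in alternatives S -> `|z i| <= 1.
  case: i => [j|_]; first by rewrite Some_alternatives => /hz.
  by rewrite /z /= dotv0l normr0 ler01.
have em : m = v + 2^-1 *: (w - v) by apply/rowP => k; rewrite !mxE; lra.
have half : 2^-1 <= expR (- 2^-1 : R) by apply: le_trans (expR_ge1Dx _); lra.
have two : expR (2^-1 : R) <= 2.
  by rewrite -[2^-1]opprK expRN -[leRHS]invrK lef_pV2 ?posrE ?expR_gt0.
have pm i : i \in alternatives S -> mnl_prob x S v i / 4 <= mnl_prob x S m i.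
  move=> iS; rewrite !mnl_probE //.
  set e := expR (dotv _ v); set Z := mnl_norm x S v.
  have h1 : e / 2 <= expR (dotv (feature x i) m).
    rewrite em dotvDr dotvZr expRD -/e -/(z i) ler_wpM2l ?expR_ge0 //.
    apply: le_trans half _; rewrite ler_expR.
    by have := z1 i iS; rewrite ler_norml; lra.
  have h2 : mnl_norm x S m <= 2 * Z.
    rewrite /Z !mnl_normE mulr_sumr; apply: ler_sum => j jS.
    rewrite em dotvDr dotvZr expRD -/(z j) mulrC ler_wpM2r ?expR_ge0 //.
    apply: le_trans two; rewrite ler_expR.
    by have := z1 j jS; rewrite ler_norml; lra.
  have Z0 : 0 < Z by apply: mnl_norm_gt0.
  apply: (@le_trans _ _ ((e / 2) / (2 * Z))).
    by rewrite invfM; lra.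
  apply: ler_pM => //; first by rewrite divr_ge0 ?expR_ge0.
    by rewrite invr_ge0 mulr_ge0 // ltW.
  by rewrite lef_pV2 ?posrE ?mulr_gt0 ?mnl_norm_gt0.
set V := pvar _ z.
have V0 : 0 <= V by apply/pvar_ge0/mnl_prob_ge0.
have V1 : V <= 1.
  apply: le_trans (@pvar_le R _ _ (mnl_prob_sum v) z 0) _.
  rewrite -(mnl_prob_sum v); apply: ler_sum => i _; rewrite subr0.
  have [iS|/mnl_prob_notin ->] := boolP (i \in alternatives S); last by rewrite mul0r.
  rewrite ler_piMr ?mnl_prob_ge0 //.
  by rewrite -real_normK ?num_real // expr_le1 ?z1.
have hV : V / 4 <= pvar (mnl_prob x S m) z.
  set c0 := \sum_k mnl_prob x S m k * z k.
  apply: (@le_trans _ _ ((\sum_j mnl_prob x S v j * (z j - c0) ^+ 2) / 4)).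
    by rewrite ler_wpM2r // pvar_le // mnl_prob_sum.
  rewrite mulr_suml; apply: ler_sum => i _.
  have [iS|/mnl_prob_notin ->] := boolP (i \in alternatives S); last first.
    by rewrite !mul0r mulr_ge0 ?sqr_ge0 ?mnl_prob_ge0.
  by rewrite mulrAC ler_wpM2r ?sqr_ge0 // pm.
apply: (@le_trans _ _ (V / 64 / 2)); first by lra.
apply: le_trans (@ln1Dx_ge_half R (V / 64) _) _; first by lra.
by rewrite ler_ln ?posrE; lra.
Qed.
End MNL.

(** * Regret of one round *)

Lemma cauchy_schwarz_sum {R : realType} {I : Type} (s : seq I) (a b : I -> R) :
  \sum_(i <- s) a i * b i <=
  Num.sqrt (\sum_(i <- s) a i ^+ 2) * Num.sqrt (\sum_(i <- s) b i ^+ 2).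
Proof.
set A := \sum_(i <- s) a i ^+ 2; set B := \sum_(i <- s) b i ^+ 2.
set C := \sum_(i <- s) _.
have A0 : 0 <= A by apply: sumr_ge0 => i _; apply: sqr_ge0.
have B0 : 0 <= B by apply: sumr_ge0 => i _; apply: sqr_ge0.
have h : C ^+ 2 <= A * B.
  have h t : 0 <= A + t ^+ 2 * B - 2 * t * C.
    rewrite /A /B /C !mulr_sumr -big_split -sumrB /=.
    by apply: sumr_ge0 => i _; have := sqr_ge0 (a i - t * b i); lra.
  have [B00|Bn0] := eqVneq B 0.
    (* For [B = 0] and nonzero [C], this choice of [t] yields 0 <= A - (A + 1), a contradiction. *)
    have h1 := h ((A + 1) / 2 * C^-1); rewrite B00 mulr0 addr0 in h1.
    have [->|Cn0] := eqVneq C 0; first by rewrite expr0n /= B00 mulr0.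
    have e : (A + 1) / 2 * C^-1 * C = (A + 1) / 2 by rewrite -mulrA mulVf ?mulr1.
    by rewrite -[2 * _ * C]mulrA e in h1; lra.
  have h1 := h (C / B).
  have Bp : 0 < B by rewrite lt_def Bn0.
  have hb : B * B^-1 = 1 by rewrite mulfV.
  have h2 : A + (C / B) ^+ 2 * B - 2 * (C / B) * C = A - C ^+ 2 / B.
    have -> : (C / B) ^+ 2 * B = C ^+ 2 / B * (B * B^-1) by lra.
    by rewrite hb; lra.
  by move: h1; rewrite h2 subr_ge0 ler_pdivrMr.
apply: le_trans (ler_norm _) _.
rewrite -sqrtrM // -sqrtr_sqr ler_sqrt //; exact: mulr_ge0.
Qed.

(** * Revenue as a function of the attraction weights *)

Definition revenue {R : realType} {N : nat} (v r : 'I_N -> R)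
    (A : {set 'I_N}) : R :=
  (\sum_(i in A) v i * r i) / (1 + \sum_(i in A) v i).

Section Revenue.
Context {R : realType} {N : nat} (K : nat) (v r : 'I_N -> R).
Hypothesis v0 : forall i, 0 < v i.

Lemma revenue_den_gt0 (A : {set 'I_N}) : 0 < 1 + \sum_(i in A) v i.
Proof. by rewrite ltr_pwDl // sumr_ge0 // => i _; rewrite ltW. Qed.

(** The fixed-point form of the revenue: once rho is subtracted from the rewards, comparisons become
    linear in the weights [v]. *)
Lemma revenue_eq (A : {set 'I_N}) :
  \sum_(i in A) v i * (r i - revenue v r A) = revenue v r A.
Proof.
under eq_bigr => i _ do rewrite mulrBr.
rewrite sumrB -mulr_suml.
have h : revenue v r A * (1 + \sum_(i in A) v i) = \sum_(i in A) v i * r i.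
  by rewrite /revenue mulfVK // gt_eqF // revenue_den_gt0.
by rewrite -h; lra.
Qed.

(** Dropping an item whose reward is below the revenue would raise the revenue, and the smaller set
    still respects the size limit. *)
Lemma revenue_argmax_ge (A : {set 'I_N}) i :
  is_argmax (assortments K) (revenue v r) A -> i \in A -> revenue v r A <= r i.
Proof.
move=> [AK hA] iA.
have /hA : assortments K (A :\ i)%SET.
  by rewrite /assortments /= (leq_trans _ AK) // subset_leq_card // subD1set.
have D0 := revenue_den_gt0 A; have D1 := revenue_den_gt0 (A :\ i)%SET.
have e1 : \sum_(j in A) v j = v i + \sum_(j in (A :\ i)%SET) v j.
  by rewrite (big_setD1 i).
have e2 : \sum_(j in A) v j * r j = v i * r i + \sum_(j in (A :\ i)%SET) v j * r j.
  by rewrite (big_setD1 i).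
move: D0 D1; rewrite /revenue e1 e2.
set a := \sum_(j in _) v j; set b := \sum_(j in _) v j * r j => D0 D1.
rewrite ler_pdivrMr // mulrAC ler_pdivlMr // => h.
rewrite ler_pdivrMr //.
by have vi := v0 i; rewrite -(ler_pM2l vi); lra.
Qed.

(** Larger weights can lower the revenue of an arbitrary set. At a maximiser all differences
    [r i - rho] are nonnegative, so the sum in [revenue_eq] can only grow. *)
Lemma revenue_optimism (v' : 'I_N -> R) (A : {set 'I_N}) :
  is_argmax (assortments K) (revenue v r) A -> (forall i, v i <= v' i) ->
  revenue v r A <= revenue v' r A.
Proof.
move=> hA hv.
have D0 : 0 < 1 + \sum_(i in A) v' i.
  by rewrite ltr_pwDl // sumr_ge0 // => i _; rewrite (le_trans _ (hv i)) // ltW.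
rewrite [leRHS]/revenue ler_pdivlMr //.
have := revenue_eq A; set rho := revenue v r A => h.
have : \sum_(i in A) v i * (r i - rho) <= \sum_(i in A) v' i * (r i - rho).
  apply: ler_sum => i iA; rewrite ler_wpM2r // subr_ge0.
  exact: revenue_argmax_ge.
rewrite h; under eq_bigr => i _ do rewrite mulrBr.
by rewrite sumrB -mulr_suml; lra.
Qed.

Lemma revenue_diff (v' : 'I_N -> R) (A : {set 'I_N}) :
  (forall i, v i <= v' i) ->
  revenue v' r A - revenue v r A =
  (\sum_(i in A) (v' i - v i) * (r i - revenue v r A))
    / (1 + \sum_(i in A) v' i).
Proof.
move=> hv.
have D0 : 0 < 1 + \sum_(i in A) v' i.
  by rewrite ltr_pwDl // sumr_ge0 // => i _; rewrite (le_trans _ (hv i)) // ltW.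
have := revenue_eq A; set rho := revenue v r A => h.
under eq_bigr => i _ do rewrite mulrBl.
rewrite sumrB h /revenue.
apply: (mulIf (lt0r_neq0 D0)); rewrite mulfVK ?gt_eqF // mulrBl mulfVK ?gt_eqF //.
under [in RHS]eq_bigr => i _ do rewrite mulrBr.
by rewrite sumrB -mulr_suml; lra.
Qed.

End Revenue.

Lemma expR_sub1_le {R : realType} (y : R) : 0 <= y <= 1 -> expR y - 1 <= 3 * y.
Proof.
move=> /andP[y0 y1].
have h : 1 - y / 2 <= expR (- (y / 2)) by apply: expR_ge1Dx.
have h1 : (1 - y / 2) ^+ 2 <= expR (- y).
  have -> : expR (- y) = expR (- (y / 2)) ^+ 2.
    by rewrite expr2 -expRD; congr expR; lra.
  by rewrite ler_sqr ?nnegrE ?expR_ge0 //; lra.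
have : (1 - y / 2) ^+ 2 * expR y <= 1.
  by rewrite -[leRHS](expRxMexpNx_1 y) [leRHS]mulrC ler_wpM2r // expR_ge0.
(* The difference of the two sides factors as y (1 - y) (2 - 3y/4). *)
have h2 : 1 <= (1 - y / 2) ^+ 2 * (1 + 3 * y).
  have : 0 <= y * ((1 - y) * (2 - 3 / 4 * y)).
    by rewrite !mulr_ge0 //; lra.
  lra.
have q : 0 < (1 - y / 2) ^+ 2 by rewrite exprn_gt0 //; lra.
move=> h3; have : expR y <= 1 + 3 * y by rewrite -(ler_pM2l q); lra.
lra.
Qed.

Section RoundRegret.
Context {R : realType} {d N : nat} (K : nat) (x : 'I_N -> 'rV[R]_d).
Context (r : 'I_N -> R) (S Sstar : {set 'I_N}) (wstar : 'rV[R]_d).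
Context (wtil : 'I_N -> 'rV[R]_d).
Hypothesis r01 : forall i, 0 <= r i <= 1.
Hypothesis offer : is_argmax (assortments K) (optimistic_revenue x r wtil) S.
Hypothesis best :
  is_argmax (assortments K) (fun A => exp_revenue x r A wstar) Sstar.
Hypothesis optimism : forall i, dotv (x i) wstar <= dotv (x i) (wtil i).

Let v i := expR (dotv (x i) wstar).
Let v' i := expR (dotv (x i) (wtil i)).
Let p := mnl_prob x S wstar.
Let rho := exp_revenue x r S wstar.

Lemma exp_revenueE A : exp_revenue x r A wstar = revenue v r A.
Proof.
rewrite /exp_revenue /revenue mulr_suml; apply: eq_bigr => i iA.
by rewrite mnl_probE ?Some_alternatives // mulrAC.
Qed.

Lemma exp_revenue_ge0 A : 0 <= exp_revenue x r A wstar.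
Proof.
apply: sumr_ge0 => i _; rewrite mulr_ge0 ?mnl_prob_ge0 //.
by have /andP[] := r01 i.
Qed.

Lemma exp_revenue_le1 A : exp_revenue x r A wstar <= 1.
Proof.
rewrite -(mnl_prob_sum x A wstar) -[X in _ <= X]/(\sum_i _).
apply: (@le_trans _ _ (\sum_(i in alternatives A) mnl_prob x A wstar i)).
  rewrite sum_alternatives ler_wpDl ?mnl_prob_ge0 //.
  apply: ler_sum => i _; rewrite ler_piMr ?mnl_prob_ge0 //.
  by have /andP[] := r01 i.
by rewrite [leRHS](bigID (mem (alternatives A))) /= lerDl sumr_ge0 // => i _; rewrite mnl_prob_ge0.
Qed.

Lemma round_regret_le1 : exp_revenue x r Sstar wstar - rho <= 1.
Proof. by have := exp_revenue_ge0 S; have := exp_revenue_le1 Sstar; rewrite /rho; lra. Qed.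

Let v0 i : 0 < v i. Proof. exact: expR_gt0. Qed.
Let v'0 i : 0 < v' i. Proof. exact: expR_gt0. Qed.
Let vv' i : v i <= v' i. Proof. by rewrite ler_expR. Qed.

Let best' : is_argmax (assortments K) (revenue v r) Sstar.
Proof.
by case: best => h1 h2; split=> // b /h2; rewrite !exp_revenueE.
Qed.

Lemma optimistic_ge : exp_revenue x r Sstar wstar <= revenue v' r S.
Proof.
rewrite exp_revenueE.
apply: le_trans (revenue_optimism K v r v0 _ _ best' vv') _.
by case: offer => _; apply; case: best.
Qed.

(** [S] maximises the optimistic revenue and not the revenue under [wstar], so the comparison passes
    through the former: rho is at most the optimal revenue, hence at most the optimistic revenue of
    [S], hence at most each reward offered. *)
Lemma offered_reward_ge i : i \in S -> rho <= r i.
Proof.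
move=> iS; apply: (@le_trans _ _ (revenue v' r S)).
  apply: le_trans optimistic_ge.
  by case: best => _; apply; case: offer.
exact: (@revenue_argmax_ge _ _ K v' r v'0).
Qed.

Lemma round_regret_le : (forall i, i \in S -> dotv (x i) (wtil i - wstar) <= 1) ->
  exp_revenue x r Sstar wstar - rho <=
  3 * \sum_(i in S) p (Some i) * (r i - rho) * dotv (x i) (wtil i - wstar).
Proof.
move=> hD; apply: (@le_trans _ _ (revenue v' r S - revenue v r S)).
  by rewrite /rho (exp_revenueE S) lerD2r optimistic_ge.
have erho : revenue v r S = rho by rewrite /rho exp_revenueE.
rewrite revenue_diff // erho.
have Z0 : 0 < 1 + \sum_(i in S) v i by apply: revenue_den_gt0.
(* The numerator is nonnegative by [offered_reward_ge], so the optimistic normaliser may be replaced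
   by the smaller true one. *)
apply: (@le_trans _ _ ((\sum_(i in S) (v' i - v i) * (r i - rho)) /
    (1 + \sum_(i in S) v i))).
  rewrite ler_wpM2l //.
    apply: sumr_ge0 => i iS; rewrite mulr_ge0 // subr_ge0 //.
    exact: offered_reward_ge.
  rewrite lef_pV2 ?posrE ?revenue_den_gt0 // lerD2l.
  exact: ler_sum.
rewrite mulr_suml mulr_sumr; apply: ler_sum => i iS.
rewrite /p mnl_probE ?Some_alternatives //=.
rewrite -/(mnl_norm x S wstar) -/(v i).
set Z := mnl_norm _ _ _; set g := r i - rho; set D := dotv (x i) (wtil i - wstar).
have g0 : 0 <= g by rewrite subr_ge0 offered_reward_ge.
have D0 : 0 <= D by rewrite /D dotvBr subr_ge0.
have h : v' i - v i <= v i * (3 * D).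
  have -> : v' i = v i * expR D by rewrite /v /D dotvBr -expRD addrC subrK.
  rewrite -[X in _ - X]mulr1 -mulrBr ler_wpM2l ?expR_ge0 // expR_sub1_le //.
  by rewrite D0 hD.
have zi : 0 <= Z^-1 by rewrite invr_ge0 ltW.
have : 0 <= (v i * (3 * D) - (v' i - v i)) * (g * Z^-1).
  by rewrite mulr_ge0 ?subr_ge0 // mulr_ge0.
by lra.
Qed.

(** Settles the degenerate case kappa > 1, in which no item can be offered. *)
Lemma round_regret_empty : (forall i, i \notin S) ->
  exp_revenue x r Sstar wstar - rho <= 0.
Proof.
move=> S0; apply: le_trans (round_regret_le _) _ => [i iS|].
  by have := S0 i; rewrite iS.
by rewrite big1 ?mulr0 // => i iS; have := S0 i; rewrite iS.
Qed.

Definition centered (i : option 'I_N) : 'rV[R]_d :=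
  feature x i - \sum_j p j *: feature x j.

(* Centring the features costs nothing: the extra term
   sum_(i in S) p_i (r_i - rho) = p_0 rho is the contribution of the outside
   option to the weighted sum of |reward - rho|. *)
Lemma weighted_gap_le (V : 'M[R]_d) (G : R) : posdef V -> 0 <= G ->
  (forall i, i \in S ->
     bilf V (wtil i - wstar) (wtil i - wstar) <= G ^+ 2) ->
  \sum_(i in S) p (Some i) * (r i - rho) * dotv (x i) (wtil i - wstar) <=
  G * (Num.sqrt (reward_variance x r S wstar) *
       Num.sqrt (\sum_j p j * bilf (invmx V) (centered j) (centered j))).
Proof.
move=> pV G0 hG.
pose n j := Num.sqrt (bilf (invmx V) (centered j) (centered j)).
have n0 j : 0 <= n j by apply: sqrtr_ge0.
have nsq j : n j ^+ 2 = bilf (invmx V) (centered j) (centered j).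
  by rewrite sqr_sqrtr // bilf_inv_ge0.
have cs i j : i \in S -> `|dotv (centered j) (wtil i - wstar)| <= G * n j.
  move=> iS; rewrite -ler_sqr ?nnegrE ?mulr_ge0 // real_normK ?num_real //.
  apply: le_trans (dual_CS _ _ _ pV) _.
  by rewrite exprMn nsq mulrC ler_wpM2r ?bilf_inv_ge0 // hG.
have rho0 : 0 <= rho by apply: exp_revenue_ge0.
have p0 j : 0 <= p j by apply: mnl_prob_ge0.
pose g j := `|reward r j - rho|.
have sumg : \sum_(i in S) p (Some i) * (r i - rho) = p None * rho.
  under eq_bigr => i _ do rewrite mulrBr.
  rewrite sumrB -mulr_suml -[\sum_(i in S) _ * r i]/rho.
  have : \sum_(i in alternatives S) p i = 1.
    have := mnl_meanE x S wstar (fun=> 1).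
    rewrite /mnl_mean; under eq_bigr => i _ do rewrite mulr1.
    under [in RHS]eq_bigr => i _ do rewrite mulr1.
    by rewrite mnl_prob_sum.
  rewrite sum_alternatives => h.
  have -> : \sum_(i in S) p (Some i) = 1 - p None by rewrite -h; lra.
  lra.
apply: (@le_trans _ _ (G * \sum_j p j * (g j * n j))).
  have -> : \sum_j p j * (g j * n j) =
      \sum_(i in alternatives S) p i * (g i * n i).
    rewrite [RHS]big_mkcond; apply: eq_bigr => j _; case: ifPn => // jS.
    by rewrite /p mnl_prob_notin // mul0r.
  rewrite sum_alternatives /g /= sub0r normrN (ger0_norm rho0).
  rewrite mulrDr mulr_sumr [p None * _]mulrA -sumg mulr_suml mulr_sumr -big_split /=.
  apply: ler_sum => i iS.
  have gi : 0 <= r i - rho by rewrite subr_ge0 offered_reward_ge.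
  rewrite (ger0_norm gi).
  have h1 := cs i (Some i) iS; have h2 := cs i None iS.
  have -> : dotv (x i) (wtil i - wstar) =
     dotv (centered (Some i)) (wtil i - wstar) -
     dotv (centered None) (wtil i - wstar).
    by rewrite /centered /= !dotvBl dotv0l; lra.
  have h : dotv (centered (Some i)) (wtil i - wstar) -
     dotv (centered None) (wtil i - wstar) <= G * n None + G * n (Some i).
    by move: h1 h2; rewrite !ler_norml; lra.
  have pg : 0 <= p (Some i) * (r i - rho) by rewrite mulr_ge0.
  have := ler_wpM2l pg h; lra.
rewrite ler_wpM2l // reward_varianceE /pvar.
have -> : \sum_k mnl_prob x S wstar k * reward r k = rho.
  rewrite -mnl_meanE /mnl_mean sum_alternatives /= mulr0 add0r //.
have -> : \sum_j p j * (g j * n j) =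
    \sum_j (Num.sqrt (p j) * g j) * (Num.sqrt (p j) * n j).
  apply: eq_bigr => j _.
  by rewrite mulrACA -expr2 sqr_sqrtr.
apply: le_trans (cauchy_schwarz_sum _ _ _) _.
rewrite le_eqVlt; apply/orP; left; apply/eqP; congr (Num.sqrt _ * Num.sqrt _).
  by apply: eq_bigr => j _; rewrite exprMn sqr_sqrtr // real_normK ?num_real.
by apply: eq_bigr => j _; rewrite exprMn sqr_sqrtr // nsq.
Qed.
End RoundRegret.

(** * Regret on the good event *)

Lemma l2ball_mid {R : realType} {d : nat} (B : R) (u v : 'rV[R]_d) :
  0 <= B -> l2ball d B u -> l2ball d B v -> l2ball d B (2^-1 *: (u + v)).
Proof.
rewrite /l2ball /l2norm /= => B0.
have h w : (Num.sqrt (dotv w w) <= B) = (dotv w w <= B ^+ 2 :> R).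
  by rewrite -ler_sqr ?nnegrE ?sqrtr_ge0 // sqr_sqrtr // dotv_ge0.
rewrite !h dotvZl dotvZr !(dotvDl, dotvDr) (dotvC v u).
by have := dotv_ge0 (u - v); rewrite dotvBl !dotvBr (dotvC v u); lra.
Qed.

Lemma l2ball_diff {R : realType} {d : nat} (B : R) (u v : 'rV[R]_d) :
  0 <= B -> l2ball d B u -> l2ball d B v ->
  dotv (u - v) (u - v) <= 4 * B ^+ 2.
Proof.
rewrite /l2ball /l2norm /= => B0.
have h w : (Num.sqrt (dotv w w) <= B) = (dotv w w <= B ^+ 2 :> R).
  by rewrite -ler_sqr ?nnegrE ?sqrtr_ge0 // sqr_sqrtr // dotv_ge0.
rewrite !h !(dotvBl, dotvBr) (dotvC v u).
by have := dotv_ge0 (u + v); rewrite dotvDl !dotvDr (dotvC v u); lra.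
Qed.

Lemma ln2_ge_half {R : realType} : 2^-1 <= ln (2 : R).
Proof.
by have := @ln1Dx_ge_half R 1; rewrite ler01 lexx => /(_ isT); rewrite (_ : 1 + 1 = 2) //; lra.
Qed.

(** With l = ln(BT) >= ln 2 >= 1/2, the logarithm of 4e BT is 2 ln 2 + 1 + l <= 5 l, and ln(1/delta)
    is at most 2 ln(1/delta) d l. *)
Lemma conf_radius2_le {R : realType} (d T t : nat) (B delta : R) :
  (0 < d)%N -> 2 <= B * T%:R -> 0 < delta <= 1 -> (1 <= t <= T)%N ->
  conf_radius2 d B delta t <=
  (5 + 2 * ln (1 / delta)) * (d%:R * ln (B * T%:R)).
Proof.
move=> d0 BT /andP[de0 de1] /andP[t1 tT].
set l := ln (B * T%:R); set g := ln (1 / delta).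
have T0 : 0 < T%:R :> R by rewrite ltr0n (leq_trans t1).
have B0 : 0 < B by rewrite -(pmulr_lgt0 _ T0) (lt_le_trans _ BT).
have g0 : 0 <= g by rewrite ln_ge0 // div1r invf_ge1.
have l2 : ln 2 <= l by rewrite ler_ln ?posrE // (lt_le_trans _ BT).
have lh : 2^-1 <= l by apply: le_trans ln2_ge_half l2.
have d1 : 1 <= d%:R :> R by rewrite ler1n.
have hmax : ln (Num.max (expR 1) (4 * expR 1 * B * t.-1%:R / d%:R)) <= 5 * l.
  apply: (@le_trans _ _ (ln (4 * expR 1 * (B * T%:R)))).
    have p : 0 < 4 * expR 1 * (B * T%:R) by rewrite !mulr_gt0 ?expR_gt0.
    rewrite ler_ln ?posrE //; last by rewrite lt_max expR_gt0.
    rewrite ge_max; apply/andP; split.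
      by have := expR_gt0 (1 : R) => e0; rewrite -[leLHS]mulr1; nra.
    rewrite ler_pdivrMr ?(lt_le_trans ltr01) // -mulrA.
    apply: (@le_trans _ _ (4 * expR 1 * (B * T%:R) * 1)); last first.
      by rewrite ler_wpM2l // ltW.
    rewrite mulr1 ler_wpM2l ?mulr_ge0 ?expR_ge0 // ler_wpM2l ?(ltW B0) //.
    by rewrite ler_nat (leq_trans (leq_pred _)).
  rewrite !lnM ?posrE ?mulr_gt0 ?expR_gt0 // expRK -[ln B + _]lnM ?posrE // -/l.
  have -> : ln (4 : R) = 2 * ln 2.
    by rewrite mulr_natl -lnXn // expr2; congr ln; lra.
  lra.
rewrite /conf_radius2 -/g.
have gd : g <= g * 2 * (d%:R * l).
  rewrite -mulrA ler_peMr //; nra.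
have : d%:R * ln (Num.max (expR 1) (4 * expR 1 * B * t.-1%:R / d%:R)) <= d%:R * (5 * l).
  by rewrite ler_wpM2l // (le_trans ler01).
lra.
Qed.

(** Under the root, 256 * 6 = 1536, and 24 D <= 48 D^2 since D >= 1/2; the constant exceeds 1, hence
    also its own square root. *)
Lemma regret_arith1 {R : realType} (a D : R) : 5 <= a -> 2^-1 <= D ->
  Num.sqrt (256 * (a * D) + 4) * Num.sqrt (6 * D) <= (1536 * a + 48) * D.
Proof.
move=> a5 Dh.
have D0 : 0 <= D by lra.
have a0 : 0 <= a by lra.
have aD0 : 0 <= a * D by apply: mulr_ge0.
have p0 : 0 <= 256 * (a * D) + 4 by lra.
have h1 : 0 <= (D - 2^-1) * D by apply: mulr_ge0 => //; lra.
have [b bE] : exists b, b = 1536 * a + 48 by exists (1536 * a + 48).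
have b1 : 1 <= b by lra.
have q0 : 0 <= b * D by apply: mulr_ge0; lra.
rewrite -bE.
have <- : Num.sqrt ((b * D) ^+ 2) = b * D by rewrite sqrtr_sqr ger0_norm.
have <- : Num.sqrt ((256 * (a * D) + 4) * (6 * D)) =
    Num.sqrt (256 * (a * D) + 4) * Num.sqrt (6 * D) by apply: sqrtrM.
rewrite ler_sqrt ?sqr_ge0 //.
apply: (@le_trans _ _ (b * D ^+ 2)); first by rewrite bE; lra.
rewrite exprMn; apply: ler_wpM2r; first exact: sqr_ge0.
by rewrite expr2 ler_peMr //; lra.
Qed.

(** Origin of the final constant: the variance term gives 3 (1536 a + 48), the bad rounds give 64 *
    3 a = 192 a, and the remaining 15 D + 6 D is at most 42 D^2 / kappa because D >= 1/2 and kappa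
    <= 1. *)
Lemma regret_arith2 {R : realType} (a D V kappa q s1 s2 s3 : R) :
  5 <= a -> 2^-1 <= D -> 0 <= V -> 0 < kappa <= 1 -> 0 <= q ->
  s1 <= 3 * D -> s2 <= 3 * D -> s3 <= V * Num.sqrt (6 * D) ->
  q * Num.sqrt (6 * D) <= (1536 * a + 48) * D ->
  (64 * (a * D) / kappa + 5) * s1 + 2 * s2 + 3 * q * s3 <=
  (4608 * a + 144 + 42 + 192 * a) * (D * V + 1 / kappa * D ^+ 2).
Proof.
move=> a5 Dh V0 /andP[k0 k1] q0 h1 h2 h3 hq.
have D0 : 0 <= D by lra.
have a0 : 0 <= a by lra.
have aD0 : 0 <= a * D by apply: mulr_ge0.
have ki : 1 <= kappa^-1 by rewrite invf_ge1.
rewrite div1r; set k := kappa^-1 in ki *.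
have e3 : q * s3 <= (1536 * a + 48) * (D * V).
  have := ler_wpM2l q0 h3; have := ler_wpM2l V0 hq; lra.
have e1 : (64 * (a * D) * k + 5) * s1 <= (64 * (a * D) * k + 5) * (3 * D).
  have p : 0 <= a * D * k by apply: mulr_ge0 => //; lra.
  by apply: ler_wpM2l => //; lra.
have D2 : 0 <= D ^+ 2 by apply: sqr_ge0.
have hD2 : 0 <= (D - 2^-1) * D by apply: mulr_ge0 => //; lra.
have hk : 0 <= (k - 1) * D ^+ 2 by apply: mulr_ge0 => //; lra.
have DV0 : 0 <= D * V by apply: mulr_ge0.
have aDV0 : 0 <= a * (D * V) by apply: mulr_ge0.
have ak0 : 0 <= a * (k * D ^+ 2) by apply: mulr_ge0 => //; lra.
lra.
Qed.

Section RegretBound.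
Context {R : realType} {d N : nat} (K T : nat) (B delta kappa : R).
Context (wstar : 'rV[R]_d).
Context (x : nat -> 'I_N -> 'rV[R]_d) (r : nat -> 'I_N -> R).
Context (S Sstar : nat -> {set 'I_N}) (c : nat -> option 'I_N).
Context (what : nat -> 'rV[R]_d) (wtil : nat -> 'I_N -> 'rV[R]_d).
Hypothesis d0 : (0 < d)%N.
Hypothesis BT : 2 <= B * T%:R.
Hypothesis delta01 : 0 < delta <= 1.
Hypothesis x1 : forall t i, (1 <= t)%N -> l2norm (x t i) <= 1.
Hypothesis r01 : forall t i, (1 <= t)%N -> 0 <= r t i <= 1.
Hypothesis wstarB : l2norm wstar <= B.
Hypothesis kappa0 : 0 < kappa.
Hypothesis kappa_le : forall t (A : {set 'I_N}) (i : 'I_N) (w : 'rV[R]_d),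
  (1 <= t <= T)%N -> assortments K A -> i \in A -> l2ball d B w ->
  kappa <= mnl_prob (x t) A w (Some i) * mnl_prob (x t) A w None.
Hypothesis cS : forall t, (1 <= t <= T)%N -> c t \in alternatives (S t).
Hypothesis algo : forall t, (1 <= t <= T)%N ->
  mle_algorithm_round K B delta x r S c t (what t) (wtil t).
Hypothesis best : forall t, (1 <= t <= T)%N ->
  is_argmax (assortments K) (fun A => exp_revenue (x t) (r t) A wstar) (Sstar t).
Hypothesis covered : forall t, (1 <= t <= T)%N ->
  conf_set B delta x S c t (what t) wstar.

Let D := d%:R * ln (B * T%:R).
Let a := 5 + 2 * ln (1 / delta).
(** Ridge parameter that balances two costs: on differences of points of the ball the regulariser is
    at most 4, and the potential d ln(1 + T / lam) stays of order d ln(BT). *)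
Let lam := (B ^+ 2)^-1.

Let T0 : (0 < T)%N.
Proof. by rewrite lt0n; apply/eqP => T0; move: BT; rewrite T0 mulr0; lra. Qed.

Let B0 : 0 < B.
Proof.
have T0' : 0 < T%:R :> R by rewrite ltr0n.
by rewrite -(pmulr_lgt0 _ T0') (lt_le_trans _ BT).
Qed.

Let lam0 : 0 < lam. Proof. by rewrite invr_gt0 exprn_gt0. Qed.

Let lnh : 2^-1 <= ln (B * T%:R).
Proof.
apply: le_trans ln2_ge_half _; rewrite ler_ln ?posrE //.
exact: lt_le_trans BT.
Qed.

Let Dh : 2^-1 <= D.
Proof.
apply: le_trans lnh _; rewrite /D ler_peMl ?ler1n //.
by apply: le_trans lnh; lra.
Qed.

Let a5 : 5 <= a.
Proof.
have /andP[de0 de1] := delta01.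
by rewrite /a lerDl mulr_ge0 // ln_ge0 // div1r invf_ge1.
Qed.

Let aD0 : 0 <= a * D.
Proof. by rewrite mulr_ge0 //; move: Dh a5; lra. Qed.

Lemma conf_set_loss_gap b w : (1 <= b <= T)%N ->
  conf_set B delta x S c b (what b) w ->
  \sum_(1 <= s < b) loss_gap (x s) (S s) (c s) w wstar <= 2 * (a * D).
Proof.
move=> bT [wB hw]; have [_ hs] := covered _ bT.
have [_ hmin] := mle_estimate (algo _ bT).
have mB : l2ball d B (2^-1 *: (w + wstar)) by apply: l2ball_mid => //; apply: ltW.
have hm := hmin _ mB.
have hr := conf_radius2_le _ _ _ _ _ d0 BT delta01 bT.
have -> : \sum_(1 <= s < b) loss_gap (x s) (S s) (c s) w wstar =
    cumulative_loss x S c b w + cumulative_loss x S c b wstar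
    - 2 * cumulative_loss x S c b (2^-1 *: (w + wstar)).
  by rewrite /cumulative_loss mulr_sumr -big_split -sumrB.
apply: (@le_trans _ _ (2 * conf_radius2 d B delta b)); last by rewrite ler_wpM2l.
move: hw hs hm; move: (cumulative_loss x S c b w) (cumulative_loss x S c b wstar)
  (cumulative_loss x S c b (2^-1 *: (w + wstar)))
  (cumulative_loss x S c b (what b)) (conf_radius2 d B delta b).
by move=> *; lra.
Qed.

(* Later confidence sets (b >= t) are included on purpose: a round in which no
   item deviates then gives usable curvature information at every later round. *)
Definition deviates (t : nat) (i : 'I_N) : Prop :=
  exists b w, [/\ (t <= b <= T)%N, conf_set B delta x S c b (what b) w &
    1 < `|dotv (x t i) (w - wstar)|].

Definition bad_item (t : nat) : option 'I_N :=
  [pick i in S t | `[< deviates t i >]].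

(** The weights sqrt(p_j) make the squared projections add up to the variance under [wstar]. Bad
    rounds contribute nothing, as they do not provide that curvature. *)
Definition good_dir (t : nat) (j : option 'I_N) : 'rV[R]_d :=
  if bad_item t is Some _ then 0 else
  Num.sqrt (mnl_prob (x t) (S t) wstar j) *: centered (x t) (S t) wstar j.

(** A single direction per round, indexed by ['I_1] so that [gram] and the potential argument apply
    unchanged. *)
Definition bad_dir (t : nat) (j : 'I_1) : 'rV[R]_d :=
  if bad_item t is Some i then x t i else 0.

Lemma bad_item_None t b w i : bad_item t = None -> (t <= b <= T)%N ->
  conf_set B delta x S c b (what b) w -> i \in S t ->
  `|dotv (x t i) (w - wstar)| <= 1.
Proof.
rewrite /bad_item; case: pickP => // h _ tb hw iS.
rewrite leNgt; apply/negP => hlt; have := h i; rewrite iS /= => /asboolPn.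
by apply; exists b, w.
Qed.

Lemma bad_item_Some t i : bad_item t = Some i -> i \in S t /\ deviates t i.
Proof.
by rewrite /bad_item; case: pickP => // j /andP[jS /asboolP h] [<-].
Qed.

Lemma good_dirE t u : bad_item t = None ->
  \sum_j dotv (good_dir t j) u ^+ 2 =
  pvar (mnl_prob (x t) (S t) wstar) (fun i => dotv (feature (x t) i) u).
Proof.
rewrite /good_dir /pvar => ->; apply: eq_bigr => j _.
rewrite dotvZl exprMn sqr_sqrtr ?mnl_prob_ge0 // /centered dotvBl dotv_suml.
congr (_ * (_ - _) ^+ 2); apply: eq_bigr => k _.
by rewrite dotvZl.
Qed.

Lemma lamB (u : 'rV[R]_d) : dotv u u <= 4 * B ^+ 2 -> lam * dotv u u <= 4.
Proof. by move=> h; rewrite /lam mulrC ler_pdivrMr // exprn_gt0. Qed.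

Lemma good_width t w : (1 <= t <= T)%N ->
  conf_set B delta x S c t (what t) w ->
  bilf (gram lam good_dir t) (w - wstar) (w - wstar) <= 256 * (a * D) + 4.
Proof.
move=> tT hw; rewrite bilf_gram addrC lerD //; last first.
  by apply/lamB/l2ball_diff; [apply: ltW| case: hw|].
apply: (@le_trans _ _ (128 * (2 * (a * D)))); last by lra.
apply: le_trans (_ : _ <= 128 * \sum_(1 <= s < t) loss_gap (x s) (S s) (c s) w wstar) _; last first.
  by rewrite ler_wpM2l // conf_set_loss_gap.
rewrite mulr_sumr !big_nat; apply: ler_sum => s /andP[s1 st].
have sT : (1 <= s <= T)%N.
  by rewrite s1 (leq_trans (ltnW st)) //; case/andP: tT.
case E : (bad_item s) => [i|].
  rewrite big1 ?mulr_ge0 ?loss_gap_ge0 ?cS // => j _.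
  by rewrite /good_dir E dotv0l expr0n.
rewrite good_dirE // mulrC -ler_pdivrMr //.
apply: loss_gap_var; first exact: cS.
move=> j jS; apply: (bad_item_None _ _ _ _ E _ hw jS).
by rewrite (ltnW st); case/andP: tT.
Qed.

(* Bad rounds only enjoy the curvature kappa, but each of them has elliptical
   width bounded below, so the potential argument bounds their number. *)
Lemma bad_width t i : (1 <= t <= T)%N -> bad_item t = Some i ->
  (64 * (a * D) / kappa + 4)^-1 <=
  bilf (invmx (gram lam bad_dir t)) (bad_dir t ord0) (bad_dir t ord0).
Proof.
move=> /andP[t1 tT] E; have [iS [b [w [/andP[tb bT] hw hi]]]] := bad_item_Some _ _ E.
have b1 : (1 <= b <= T)%N by rewrite (leq_trans t1).
set H := _ + 4.
have H0 : 0 < H.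
  by rewrite /H ltr_wpDl // divr_ge0 ?(ltW kappa0) // mulr_ge0.
have wB : l2ball d B w by case: hw.
have mB : l2ball d B (2^-1 *: (w + wstar)) by apply: l2ball_mid => //; apply: ltW.
have hH : bilf (gram lam bad_dir t) (w - wstar) (w - wstar) <= H.
  rewrite bilf_gram addrC lerD //; last first.
    by apply/lamB/l2ball_diff => //; apply: ltW.
  rewrite ler_pdivlMr //.
  apply: (@le_trans _ _ (32 * \sum_(1 <= s < b) loss_gap (x s) (S s) (c s) w wstar)); last first.
    by have := conf_set_loss_gap _ _ b1 hw; lra.
  (* The Gram matrix only sees rounds before [t], while the loss bound runs up to [b]; the gaps in
     between are nonnegative and are dropped. *)
  rewrite [in leRHS](@big_cat_nat _ _ _ t 1 b) //= mulrDr ler_wpDr //.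
    rewrite mulr_ge0 // big_nat sumr_ge0 // => s /andP[ts sb].
    by rewrite loss_gap_ge0 // cS // (leq_trans t1 ts) (leq_trans (ltnW sb)).
  rewrite mulr_sumr mulr_suml !big_nat; apply: ler_sum => s /andP[s1 st].
  have sT : (1 <= s <= T)%N by rewrite s1 (leq_trans (ltnW st)).
  rewrite big_ord1 /bad_dir; case Es : (bad_item s) => [j|]; last first.
    by rewrite dotv0l expr0n mul0r mulr_ge0 ?loss_gap_ge0 ?cS.
  have [jS _] := bad_item_Some _ _ Es.
  rewrite mulrC [leRHS]mulrC -ler_pdivrMr //.
  apply: loss_gap_kappa => //; [exact: cS|exact: ltW|].
  move=> u hu; apply: kappa_le => //.
    by have [] := mle_offer (algo _ sT).
  by move: hu; rewrite !inE => /or3P[] /eqP ->.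
have := dual_CS _ (bad_dir t ord0) (w - wstar) (posdef_gram _ bad_dir t lam0).
set X := bilf (invmx _) _ _ => h.
have X0 : 0 <= X by apply/bilf_inv_ge0/posdef_gram.
have h1 : 1 < X * H.
  apply: lt_le_trans (_ : _ < dotv (bad_dir t ord0) (w - wstar) ^+ 2) _.
    rewrite /bad_dir E -real_normK ?num_real // expr2.
    by rewrite -[ltLHS]mulr1; apply: ltr_pM.
  by apply: le_trans h _; rewrite ler_wpM2l.
by rewrite -[leLHS]mul1r ler_pdivrMr // ltW.
Qed.

(** Since Z = BT >= 2, one has 1 + T B^2 <= 1 + Z^2 <= Z^3, whence the factor 3. *)
Lemma potential_le (J : finType) (Y : nat -> J -> 'rV[R]_d) :
  (forall t k, (1 <= t <= T)%N -> \sum_j (Y t j 0 k) ^+ 2 <= 1) ->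
  \sum_(1 <= t < T.+1)
     ln (1 + \sum_j bilf (invmx (gram lam Y t)) (Y t j) (Y t j)) <= 3 * D.
Proof.
move=> hY; apply: le_trans (elliptical_potential _ _ _ lam0 hY) _.
rewrite /D mulrCA ler_wpM2l // /lam invrK.
have Z0 : 0 < B * T%:R by apply: lt_le_trans BT.
have T1 : 1 <= T%:R :> R by rewrite ler1n.
rewrite [leRHS](mulr_natl (ln _) 3) -lnXn // ler_ln ?posrE ?exprn_gt0 //; last first.
  by rewrite ltr_pwDl // mulr_ge0 // exprn_ge0 // ltW.
set Z := B * T%:R in Z0 *.
have h : T%:R * B ^+ 2 <= Z ^+ 2.
  by rewrite /Z exprMn mulrC ler_wpM2l ?sqr_ge0 // expr2 ler_peMr.
have : 0 <= Z ^+ 2 * (Z - 2) by rewrite mulr_ge0 ?sqr_ge0 // subr_ge0.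
have : 0 <= (Z - 2) * (Z + 2) by rewrite mulr_ge0 //; move: BT; rewrite -/Z; lra.
have -> : Z ^+ 3 = Z ^+ 2 * Z by rewrite exprSr.
lra.
Qed.

Lemma feature_coord_le t j k : (1 <= t)%N -> feature (x t) j 0 k ^+ 2 <= 1.
Proof.
move=> t1; case: j => [i|] /=; last by rewrite mxE expr0n.
have := x1 _ i t1; rewrite /l2norm -ler_sqr ?nnegrE ?sqrtr_ge0 //.
rewrite sqr_sqrtr ?dotv_ge0 // expr1n; apply: le_trans.
rewrite /dotv (bigD1 k) //= -expr2 lerDl sumr_ge0 // => i' _.
by rewrite -expr2 sqr_ge0.
Qed.

Lemma good_potential : \sum_(1 <= t < T.+1)
  ln (1 + \sum_j bilf (invmx (gram lam good_dir t)) (good_dir t j) (good_dir t j))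
  <= 3 * D.
Proof.
apply: potential_le => t k /andP[t1 tT].
case E : (bad_item t) => [i|].
  by rewrite big1 ?ler01 // => j _; rewrite /good_dir E mxE expr0n.
set p := mnl_prob (x t) (S t) wstar.
(* In each coordinate the squares sum to the variance of that feature coordinate, which is at most
   its second moment. *)
apply: (@le_trans _ _ (pvar p (fun j => feature (x t) j 0 k))).
  rewrite /pvar; apply: ler_sum => j _.
  rewrite /good_dir E mxE exprMn sqr_sqrtr ?mnl_prob_ge0 // /centered !mxE summxE.
  rewrite (_ : \sum_k0 _ = \sum_k0 p k0 * feature (x t) k0 0 k) //.
  by apply: eq_bigr => i _; rewrite mxE.
apply: le_trans (@pvar_le _ _ _ (mnl_prob_sum _ _ _) _ 0) _.
rewrite -(mnl_prob_sum (x t) (S t) wstar); apply: ler_sum => j _.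
by rewrite subr0 ler_piMr ?mnl_prob_ge0 // feature_coord_le.
Qed.

Lemma bad_potential : \sum_(1 <= t < T.+1)
  ln (1 + \sum_j bilf (invmx (gram lam bad_dir t)) (bad_dir t j) (bad_dir t j))
  <= 3 * D.
Proof.
apply: potential_le => t k /andP[t1 tT].
rewrite big_ord1 /bad_dir; case: (bad_item t) => [i|].
  exact: (feature_coord_le t (Some i) k t1).
by rewrite mxE expr0n ler01.
Qed.

(** Each summand pays for one kind of round. In a bad round the regret is at most 1 and the width at
    least 1 / (H + 4), so its logarithm is at least 1 / (H + 5). In a good round with width X > 1,
    again 1 <= 2 ln(1 + X). Otherwise X <= 2 ln(1 + X), and the optimistic bound applies. *)
Lemma round_bound t : (1 <= t <= T)%N ->
  exp_revenue (x t) (r t) (Sstar t) wstar - exp_revenue (x t) (r t) (S t) wstar <=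
  (64 * (a * D) / kappa + 5) *
    ln (1 + \sum_j bilf (invmx (gram lam bad_dir t)) (bad_dir t j) (bad_dir t j))
  + 2 * ln (1 + \sum_j bilf (invmx (gram lam good_dir t)) (good_dir t j) (good_dir t j))
  + 3 * Num.sqrt (256 * (a * D) + 4) *
    (Num.sqrt (reward_variance (x t) (r t) (S t) wstar) *
     Num.sqrt (2 * ln (1 + \sum_j bilf (invmx (gram lam good_dir t))
                              (good_dir t j) (good_dir t j)))).
Proof.
move=> tT; have /andP[t1 tT'] := tT.
have [hmle hopt hoff] := algo _ tT.
rewrite big_ord1; set X := \sum_j _; set Xb := bilf _ (bad_dir t ord0) _.
have X0 : 0 <= X by apply: sumr_ge0 => j _; apply/bilf_inv_ge0/posdef_gram.
have Xb0 : 0 <= Xb by apply/bilf_inv_ge0/posdef_gram.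
set H := 64 * _ / kappa.
have H0 : 0 <= H by rewrite divr_ge0 ?(ltW kappa0) // mulr_ge0.
have L0 : 0 <= ln (1 + X) by rewrite ln_ge0 // lerDl.
have Lb0 : 0 <= ln (1 + Xb) by rewrite ln_ge0 // lerDl.
set Q := 3 * _ * _.
have Q0 : 0 <= Q.
  by apply: mulr_ge0; apply: mulr_ge0; rewrite ?sqrtr_ge0 ?ler0n.
have W0 : 0 <= 256 * (a * D) + 4.
  by apply: addr_ge0; [apply: mulr_ge0 aD0; exact: ler0n|exact: ler0n].
have optim i : dotv (x t i) wstar <= dotv (x t i) (wtil t i).
  by have [_] := hopt i; apply; exact: covered.
have le1 := @round_regret_le1 R d N (x t) (r t) (S t) (Sstar t) wstar (fun i => r01 t i t1).
case E : (bad_item t) => [i|].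
  have hX : (H + 4)^-1 <= Xb by apply: bad_width E.
  have : 1 <= (H + 5) * ln (1 + Xb); last first.
    by move=> h; have h2 : 0 <= 2 * ln (1 + X); [rewrite mulr_ge0 | lra].
  rewrite mulrC -ler_pdivrMr ?ltr_wpDl //.
  apply: le_trans (_ : _ <= ln (1 + (H + 4)^-1)) _; last first.
    have i0 : 0 <= (H + 4)^-1 by rewrite invr_ge0 addr_ge0.
    by rewrite ler_ln ?posrE ?lerD2l // ltr_pwDl.
  have i0 : 0 <= (H + 4)^-1 by rewrite invr_ge0 addr_ge0.
  apply: le_trans (ln1Dx_ge _ i0).
  have hp : 0 < H + 4 by rewrite ltr_wpDl.
  have -> : 1 + (H + 4)^-1 = (H + 5) / (H + 4).
    rewrite -[X in X + _](mulfV (lt0r_neq0 hp)) -[in X in _ + X](mul1r (H + 4)^-1) -mulrDl.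
    by congr (_ / _); lra.
  by rewrite invf_div mulrA mulVf ?gt_eqF.
have b1 : 0 <= (H + 5) * ln (1 + Xb) by rewrite mulr_ge0 // addr_ge0.
have [X1|X1] := lerP X 1; last first.
  have : ln 2 <= ln (1 + X) by rewrite ler_ln ?posrE; lra.
  by have := @ln2_ge_half R; lra.
have wtilC i : conf_set B delta x S c t (what t) (wtil t i) by case: (hopt i).
have hD i : i \in S t -> dotv (x t i) (wtil t i - wstar) <= 1.
  move=> iS; apply: le_trans (ler_norm _) _.
  by apply: (bad_item_None _ _ _ _ E _ (wtilC i) iS); rewrite leqnn.
apply: le_trans (@round_regret_le R d N K _ _ _ _ _ _ hoff (best _ tT) optim hD) _.
rewrite -[leLHS]add0r lerD //; first by rewrite addr_ge0 // mulr_ge0.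
rewrite /Q -mulrA ler_wpM2l //.
have hG i : i \in S t -> bilf (gram lam good_dir t) (wtil t i - wstar) (wtil t i - wstar)
   <= Num.sqrt (256 * (a * D) + 4) ^+ 2.
  by move=> _; rewrite (sqr_sqrtr W0); apply: good_width.
apply: le_trans (@weighted_gap_le R d N K _ _ _ _ _ _ (fun i => r01 t i t1)
   hoff (best _ tT) optim _ _ (posdef_gram _ good_dir t lam0) (sqrtr_ge0 _) hG) _.
rewrite ler_wpM2l ?sqrtr_ge0 // ler_wpM2l ?sqrtr_ge0 //.
rewrite ler_sqrt ?mulr_ge0 //.
have -> : \sum_j mnl_prob (x t) (S t) wstar j *
   bilf (invmx (gram lam good_dir t)) (centered (x t) (S t) wstar j)
     (centered (x t) (S t) wstar j) = X.
  rewrite /X; apply: eq_bigr => j _.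
  have -> : good_dir t j =
      Num.sqrt (mnl_prob (x t) (S t) wstar j) *: centered (x t) (S t) wstar j.
    by rewrite /good_dir E.
  by rewrite bilfZl bilfZr mulrA -expr2 sqr_sqrtr // mnl_prob_ge0.
by have := @ln1Dx_ge_half R X; rewrite X0 X1 => /(_ isT); lra.
Qed.

Lemma regret_bound :
  regret x r S Sstar wstar T <=
  (4608 * a + 144 + 42 + 192 * a) *
    (d%:R * ln (B * T%:R) * Num.sqrt (total_variance x r S wstar T)
     + 1 / kappa * d%:R ^+ 2 * ln (B * T%:R) ^+ 2).
Proof.
have -> : 1 / kappa * d%:R ^+ 2 * ln (B * T%:R) ^+ 2 = 1 / kappa * D ^+ 2.
  by rewrite /D exprMn !mulrA.
rewrite -/D.
have C0 : 0 <= 4608 * a + 144 + 42 + 192 * a by move: a5; lra.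
have l0 : 0 <= ln (B * T%:R) by move: lnh; lra.
have k0 : 0 <= 1 / kappa by rewrite divr_ge0 // ltW.
have D0 : 0 <= D by move: Dh; lra.
have V0 : 0 <= total_variance x r S wstar T.
  rewrite /total_variance big_nat sumr_ge0 // => t _.
  rewrite reward_varianceE pvar_ge0 // => j; exact: mnl_prob_ge0.
(* If kappa > 1, then p_i p_0 <= 1 forces every offered set to be empty. The other case supplies the
   kappa <= 1 of [regret_arith2]. *)
have [k1|k1] := lerP kappa 1; last first.
  apply: (@le_trans _ _ 0); last first.
    by rewrite mulr_ge0 // addr_ge0 // mulr_ge0 ?sqrtr_ge0 ?sqr_ge0.
  rewrite /regret big_nat sumr_le0 // => t /andP[t1 tT].
  have tT' : (1 <= t <= T)%N by rewrite t1.
  have [hmle hopt hoff] := algo _ tT'.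
  apply: (@round_regret_empty R d N K (x t) (r t) (S t) (Sstar t) wstar (wtil t)) => //.
  - exact: best.
  - by move=> i; have [_] := hopt i; apply; exact: covered.
  move=> i; apply/negP => iS.
  have := kappa_le _ _ _ _ tT' hoff.1 iS wstarB.
  rewrite leNgt => /negP; apply; apply: le_lt_trans k1.
  by rewrite -[leRHS]mulr1 ler_pM ?mnl_prob_ge0 ?mnl_prob_le1.
set L := fun t => ln (1 + \sum_j bilf (invmx (gram lam good_dir t))
                              (good_dir t j) (good_dir t j)).
set Lb := fun t => ln (1 + \sum_j bilf (invmx (gram lam bad_dir t))
                              (bad_dir t j) (bad_dir t j)).
pose sg t := Num.sqrt (reward_variance (x t) (r t) (S t) wstar).
have hsum : regret x r S Sstar wstar T <=
   \sum_(1 <= t < T.+1) ((64 * (a * D) / kappa + 5) * Lb t + 2 * L t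
     + 3 * Num.sqrt (256 * (a * D) + 4) * (sg t * Num.sqrt (2 * L t))).
  rewrite /regret !big_nat; apply: ler_sum => t /andP[t1 tT].
  by apply: round_bound; rewrite t1.
apply: le_trans hsum _.
rewrite !big_split /= -!mulr_sumr.
have hLb : \sum_(1 <= t < T.+1) Lb t <= 3 * D := bad_potential.
have hL : \sum_(1 <= t < T.+1) L t <= 3 * D := good_potential.
have L0 t : 0 <= L t.
  rewrite ln_ge0 // lerDl sumr_ge0 // => j _.
  by apply/bilf_inv_ge0/posdef_gram.
have hCS : \sum_(1 <= t < T.+1) sg t * Num.sqrt (2 * L t) <=
    Num.sqrt (total_variance x r S wstar T) * Num.sqrt (6 * D).
  apply: le_trans (cauchy_schwarz_sum _ _ _) _.
  apply: ler_pM; rewrite ?sqrtr_ge0 //.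
    rewrite ler_sqrt // /total_variance; apply: ler_sum => t _.
    by rewrite sqr_sqrtr // reward_varianceE pvar_ge0 // => j; apply: mnl_prob_ge0.
  rewrite ler_sqrt ?mulr_ge0 //.
  apply: le_trans (_ : _ <= 2 * \sum_(1 <= t < T.+1) L t) _; last by lra.
  rewrite mulr_sumr; apply: ler_sum => t _.
  by rewrite sqr_sqrtr // mulr_ge0.
have k01 : 0 < kappa <= 1 by rewrite kappa0.
exact: (regret_arith2 _ _ _ _ _ _ _ _ a5 Dh (sqrtr_ge0 _) k01 (sqrtr_ge0 _)
  hLb hL hCS (regret_arith1 _ _ a5 Dh)).
Qed.

End RegretBound.

(** * Analytic and combinatorial preliminaries on the prior *)

Lemma ge0_of_derive_ge0 {R : realType} (f df : R -> R) :
  (forall y : R, is_derive y 1 f (df y)) -> (forall y, 0 <= y -> 0 <= df y) ->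
  0 <= f 0 -> forall y, 0 <= y -> 0 <= f y.
Proof.
move=> hf hdf f0 y; rewrite le_eqVlt => /predU1P[<-//|y0].
have [|z zI e] := @MVT R f df 0 y y0 (fun z _ => hf z).
  apply: continuous_subspaceT => z; apply: differentiable_continuous.
  by apply/derivable1_diffP; have [] := hf z.
have : 0 <= f y - f 0.
  rewrite e subr0 mulr_ge0 // ?hdf ?(ltW y0) //.
  by move: zI; rewrite in_itv /= => /andP[/ltW].
lra.
Qed.

(** Two applications of monotonicity: y cosh y - sinh y has derivative y sinh y, and it carries the
    sign of the derivative of - cosh y exp(- y^2 / 2). *)
Lemma cosh_le_expR {R : realType} (y : R) :
  expR y + expR (- y) <= 2 * expR (y ^+ 2 / 2).
Proof.
wlog y0 : y / 0 <= y => [H|].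
  have [/H//|/ltW yn] := lerP 0 y.
  by have := H (- y); rewrite oppr_ge0 opprK sqrrN addrC => /(_ yn).
pose ch (y : R) := expR y + expR (- y).
pose sh (y : R) := expR y - expR (- y).
have dch (z : R) : is_derive z (1:R) ch (sh z).
  by rewrite /ch /sh; apply: is_derive_eq; rewrite /GRing.scale /=; lra.
have dsh (z : R) : is_derive z (1:R) sh (ch z).
  by rewrite /ch /sh; apply: is_derive_eq; rewrite /GRing.scale /=; lra.
have sh0 z : 0 <= z -> 0 <= sh z.
  by move=> z0; rewrite /sh subr_ge0 ler_expR; lra.
have g0 z : 0 <= z -> 0 <= z * ch z - sh z.
  apply: (@ge0_of_derive_ge0 R (fun z => z * ch z - sh z) (fun z => z * sh z)).
  - by move=> t; apply: is_derive_eq; rewrite /GRing.scale /=; lra.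
  - by move=> t t0; rewrite mulr_ge0 ?sh0.
  - by rewrite /sh oppr0 subrr mul0r subr0.
have k0 : 0 <= 2 - ch y * expR (- (y ^+ 2 / 2)).
  apply: (@ge0_of_derive_ge0 R (fun z => 2 - ch z * expR (- (z ^+ 2 / 2)))
     (fun z => (z * ch z - sh z) * expR (- (z ^+ 2 / 2)))) => //.
  - by move=> t; apply: is_derive_eq; rewrite /GRing.scale /=; lra.
  - by move=> t t0; rewrite mulr_ge0 ?g0 ?expR_ge0.
  - by rewrite /ch expr0n mul0r oppr0 expR0; lra.
rewrite -[leLHS]mulr1 -[X in _ * X](expRxMexpNx_1 (- (y ^+ 2 / 2))) opprK mulrA.
by rewrite ler_wpM2r ?expR_ge0 // -subr_ge0.
Qed.

Lemma jensen_subset {R : realType} (G J : finType) (w : G -> R) (e : J -> G)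
    (v : J -> R) : (0 < #|J|)%N -> injective e -> (forall g, 0 <= w g) ->
  (forall j, expR (v j) <= w (e j)) ->
  #|J|%:R * expR ((\sum_j v j) / #|J|%:R) <= \sum_g w g.
Proof.
move=> J0 inje w0 hv; set m := _ / _.
have Jn : #|J|%:R != 0 :> R by rewrite pnatr_eq0 -lt0n.
apply: (@le_trans _ _ (\sum_j w (e j))); last first.
  rewrite [leRHS](bigID (mem [set e j | j in J]%SET)) /=.
  by rewrite big_imset /= ?lerDl ?sumr_ge0 // => j1 j2 _ _; apply: inje.
apply: (@le_trans _ _ (\sum_j expR (v j))); last by apply: ler_sum.
apply: (@le_trans _ _ (\sum_j expR m * (1 + (v j - m)))); last first.
  apply: ler_sum => j _.
  have -> : expR (v j) = expR m * expR (v j - m) by rewrite -expRD addrC subrK.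
  by rewrite ler_wpM2l ?expR_ge0 // expR_ge1Dx.
rewrite -mulr_sumr !big_split /= sumrN !sumr_const -[m *+ _]mulr_natl /m.
by rewrite mulrCA mulfV // mulr1 subrr addr0 mulrC.
Qed.

Lemma sum_ffun_coord {R : realType} (d n : nat) (i : 'I_d) (phi : 'I_n -> R) :
  (0 < n)%N ->
  (\sum_(j : {ffun 'I_d -> 'I_n}) phi (j i)) / (n ^ d)%:R
  = (\sum_k phi k) / n%:R.
Proof.
move=> n0; have nn : n%:R != 0 :> R by rewrite pnatr_eq0 -lt0n.
(* Written as a product with trivial factors off [i], the sum over the box distributes over the
   coordinates. *)
pose F (k : 'I_d) (l : 'I_n) := if k == i then phi l else 1.
have -> : \sum_(j : {ffun 'I_d -> 'I_n}) phi (j i) =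
    \sum_(j : {ffun 'I_d -> 'I_n}) \prod_k F k (j k).
  apply: eq_bigr => j _; rewrite (bigD1 i) //= /F eqxx big1 ?mulr1 //.
  by move=> k /negbTE ->.
rewrite -bigA_distr_bigA (bigD1 i) //= /F eqxx.
rewrite [X in _ * X / _](eq_bigr (fun=> n%:R)); last first.
  by move=> k /negbTE ->; rewrite sumr_const card_ord.
rewrite prodr_const cardC1 card_ord natrX.
have d0 : (0 < d)%N by apply: leq_ltn_trans (ltn_ord i).
have -> : n%:R ^+ d = n%:R * n%:R ^+ d.-1 :> R by rewrite -exprS prednK.
by rewrite invfM [_^-1 * _]mulrC mulrA mulfK // expf_neq0.
Qed.

Lemma sum_centered {R : realType} (n : nat) :
  \sum_(k < n) ((k : nat)%:R - (n%:R - 1) / 2) = 0 :> R.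
Proof.
rewrite big_split /= sumr_const card_ord -mulr_natl.
have -> : \sum_(k < n) (k : nat)%:R = n%:R * (n%:R - 1) / 2 :> R.
  elim: n => [|n IH]; first by rewrite big_ord0 !mul0r.
  by rewrite big_ord_recr /= IH -(@natr1 _ n); lra.
lra.
Qed.

Lemma sum_centered_sqr {R : realType} (n : nat) :
  \sum_(k < n) ((k : nat)%:R - (n%:R - 1) / 2) ^+ 2 =
  n%:R * (n%:R ^+ 2 - 1) / 12 :> R.
Proof.
(* The centre is freed from the length: it depends on [n], which would block the induction. *)
have h c m : \sum_(k < m) ((k : nat)%:R - c) ^+ 2 =
  m%:R * c ^+ 2 - c * m%:R * (m%:R - 1)
  + m%:R * (m%:R - 1) * (2 * m%:R - 1) / 6 :> R.
  elim: m => [|m IH]; first by rewrite big_ord0 !(mul0r, mulr0); lra.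
  by rewrite big_ord_recr /= IH -(@natr1 _ m); lra.
by rewrite h; lra.
Qed.

(** * The logistic grid prior *)

Definition sigmoid {R : realType} (y : R) : R := (1 + expR (- y))^-1.

(* Mass given by the logistic law to the k-th cell of the grid of mesh h
   centred at 0: the masses telescope, and cosh y <= exp (y^2 / 2) gives them
   Gaussian lower bounds. *)
Definition cell {R : realType} (h : R) (M k : nat) : R :=
  sigmoid (h * (k.+1%:R - M%:R)) - sigmoid (h * (k%:R - M%:R)).

Lemma sigmoid01 {R : realType} (y : R) : 0 <= sigmoid y <= 1.
Proof.
have e0 := expR_gt0 (- y); rewrite /sigmoid invr_ge0; apply/andP; split.
  by lra.
by rewrite invf_le1; lra.
Qed.

Lemma cell_sum_le1 {R : realType} (h : R) (M n : nat) :
  \sum_(k < n) cell h M k <= 1.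
Proof.
have -> : \sum_(k < n) cell h M k =
    sigmoid (h * (n%:R - M%:R)) - sigmoid (h * (0%:R - M%:R)).
  elim: n => [|n IH]; first by rewrite big_ord0 subrr.
  by rewrite big_ord_recr /= IH /cell; lra.
have /andP[_ h1] := sigmoid01 (h * (n%:R - M%:R)).
have /andP[h2 _] := sigmoid01 (h * (0%:R - M%:R)).
lra.
Qed.

(** From 1 + exp(-y) = 2 exp(-y/2) cosh(y/2), [cosh_le_expR] bounds both denominators by Gaussian
    exponentials, and the numerator is at least h exp(-a-h). The factor 1/4 is the density of the
    logistic law at 0. *)
Lemma sigmoid_diff_ge {R : realType} (a h : R) : 0 < h ->
  expR (ln (h / 4) - h / 2 - (a ^+ 2 + (a + h) ^+ 2) / 8) <=
  sigmoid (a + h) - sigmoid a.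
Proof.
move=> h0; set b := a + h; rewrite /sigmoid.
have bound (y : R) : 1 + expR (- y) <= 2 * expR (y ^+ 2 / 8 - y / 2).
  have := cosh_le_expR (y / 2).
  have -> : (y / 2) ^+ 2 / 2 = y ^+ 2 / 8 by lra.
  move=> /(ler_wpM2l (expR_ge0 (- (y / 2)))).
  rewrite mulrDr -!expRD addNr expR0 mulrCA -expRD.
  have -> : - (y / 2) - y / 2 = - y by lra.
  by rewrite [- (y / 2) + _]addrC.
set A := 1 + expR (- a); set Bb := 1 + expR (- b).
have A0 : 0 < A by rewrite /A ltr_pwDl // expR_ge0.
have B0 : 0 < Bb by rewrite /Bb ltr_pwDl // expR_ge0.
have -> : Bb^-1 - A^-1 = (expR (- a) - expR (- b)) / (A * Bb).
  have e1 : A * A^-1 = 1 by rewrite mulfV ?gt_eqF.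
  have e2 : Bb * Bb^-1 = 1 by rewrite mulfV ?gt_eqF.
  have -> : expR (- a) - expR (- b) = A - Bb by rewrite /A /Bb; lra.
  rewrite invfM; transitivity (A * A^-1 * Bb^-1 - Bb * Bb^-1 * A^-1); last by lra.
  by rewrite e1 e2 !mul1r.
rewrite ler_pdivlMr ?mulr_gt0 //.
apply: (@le_trans _ _ (expR (ln (h / 4) - h / 2 - (a ^+ 2 + b ^+ 2) / 8) *
   (2 * expR (a ^+ 2 / 8 - a / 2) * (2 * expR (b ^+ 2 / 8 - b / 2))))).
  rewrite ler_wpM2l ?expR_ge0 //; apply: ler_pM; rewrite ?bound //; exact: ltW.
have -> : expR (ln (h / 4) - h / 2 - (a ^+ 2 + b ^+ 2) / 8) *
   (2 * expR (a ^+ 2 / 8 - a / 2) * (2 * expR (b ^+ 2 / 8 - b / 2))) =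
   h * expR (- b).
  have -> : ln (h / 4) - h / 2 - (a ^+ 2 + b ^+ 2) / 8 =
    ln (h / 4) + (- b - (a ^+ 2 / 8 - a / 2) - (b ^+ 2 / 8 - b / 2)).
    by rewrite /b; lra.
  set P := a ^+ 2 / 8 - a / 2; set Q := b ^+ 2 / 8 - b / 2.
  rewrite expRD lnK ?posrE ?divr_gt0 // (expRB (- b - P) Q) (expRB (- b) P).
  have p1 : expR P * (expR P)^-1 = 1 by rewrite mulfV ?gt_eqF ?expR_gt0.
  have q1 : expR Q * (expR Q)^-1 = 1 by rewrite mulfV ?gt_eqF ?expR_gt0.
  transitivity (h * expR (- b) * (expR P * (expR P)^-1) * (expR Q * (expR Q)^-1)).
    by lra.
  by rewrite p1 q1 !mulr1.
have -> : expR (- a) = expR (- b) * expR h by rewrite -expRD; congr expR; rewrite /b; lra.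
have := expR_ge1Dx h; have := expR_ge0 (- b) => e0 e1.
have := ler_wpM2l e0 e1; lra.
Qed.

Lemma cell_gt0 {R : realType} (h : R) (M k : nat) : 0 < h -> 0 < cell h M k.
Proof.
move=> h0; rewrite /cell -(@natr1 _ k).
have -> : h * (k%:R + 1 - M%:R) = h * (k%:R - M%:R) + h by lra.
exact: lt_le_trans (expR_gt0 _) (sigmoid_diff_ge _ _ h0).
Qed.

(** The parallelogram identity recentres the two endpoint squares at the midpoint of the cell, which
    costs h^2 / 16. *)
Lemma cell_ge {R : realType} (h : R) (M k : nat) : 0 < h ->
  expR (ln (h / 4) - h / 2 - h ^+ 2 / 16
        - (h * (k%:R + 2^-1 - M%:R)) ^+ 2 / 4) <= cell h M k.
Proof.
move=> h0; rewrite /cell -(@natr1 _ k).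
have -> : h * (k%:R + 1 - M%:R) = h * (k%:R - M%:R) + h by lra.
apply: le_trans (sigmoid_diff_ge (h * (k%:R - M%:R)) _ h0).
by rewrite ler_expR; lra.
Qed.

(** Points are cell midpoints. The law lives at unit scale and [U] will be B / sqrt d, so that U^2 d
    = B^2 matches the ball. *)
Definition grid {R : realType} {d : nat} (U h : R) (M : nat)
    (g : {ffun 'I_d -> 'I_(M + M)}) : 'rV[R]_d :=
  \row_i (U * (h * ((g i : nat)%:R + 2^-1 - M%:R))).

Definition prior {R : realType} {d : nat} (h : R) (M : nat)
    (g : {ffun 'I_d -> 'I_(M + M)}) : R :=
  \prod_i cell h M (g i).

Lemma prior_ge0 {R : realType} {d : nat} (h : R) (M : nat)
    (g : {ffun 'I_d -> 'I_(M + M)}) : 0 < h -> 0 <= prior h M g.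
Proof. by move=> h0; apply: prodr_ge0 => i _; rewrite ltW // cell_gt0. Qed.

Lemma prior_sum_le1 {R : realType} {d : nat} (h : R) (M : nat) : 0 < h ->
  \sum_(g : {ffun 'I_d -> 'I_(M + M)}) prior h M g <= 1.
Proof.
move=> h0; rewrite /prior -(bigA_distr_bigA (fun _ (k : 'I_(M + M)) => cell h M k)) /=.
have {2}<- : \prod_(i < d) (1 : R) = 1 by rewrite big1_eq.
apply: ler_prod => i _; rewrite cell_sum_le1 andbT sumr_ge0 // => k _.
by rewrite ltW // cell_gt0.
Qed.

(** The squared norm, unlike the norm, splits over coordinates and can be averaged over a box
    exactly. *)
Lemma l2norm_amgm {R : realType} {d : nat} (u : 'rV[R]_d) (tau : R) :
  0 < tau -> l2norm u <= (dotv u u / tau + tau) / 2.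
Proof.
move=> t0; have n0 : 0 <= l2norm u by apply: sqrtr_ge0.
have <- : l2norm u ^+ 2 = dotv u u by rewrite sqr_sqrtr // dotv_ge0.
rewrite -(ler_pM2r t0).
have -> : (l2norm u ^+ 2 / tau + tau) / 2 * tau =
   (l2norm u ^+ 2 * (tau^-1 * tau) + tau ^+ 2) / 2 by lra.
by rewrite mulVf ?gt_eqF //; have := sqr_ge0 (l2norm u - tau); lra.
Qed.

(** * Lower bound for the mixture by a box around the estimator *)

Section MixtureLower.
Context {R : realType} {d : nat} (B U h Nn tau : R) (M n : nat).
Context (k0 : 'I_d -> nat) (A : 'rV[R]_d -> R) (b what : 'rV[R]_d).
Hypotheses (B0 : 0 < B) (UB : U ^+ 2 * d%:R = B ^+ 2) (h0 : 0 < h).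
Hypotheses (N0 : 0 <= Nn) (tau0 : 0 < tau) (n0 : (0 < n)%N).
Hypothesis k0M : forall i, (k0 i + n <= M + M)%N.
Hypothesis ALip : forall v w, A v - A w <= Nn * l2norm (v - w).
Hypothesis bLip : forall u, `|dotv b u| <= Nn * l2norm u.

(** Centre of the box in coordinate [i], in units of [U]: the midpoints k + 1/2 of the n cells from
    [k0 i] on average to k0 + n/2. *)
Let mu i : R := h * ((k0 i)%:R + n%:R / 2 - M%:R).
Let e (l : 'I_n) : R := (l : nat)%:R - (n%:R - 1) / 2.

Hypothesis near_what : forall i, `|mu i - what 0 i / U| <= h.

(** The part of the log-weight carried by coordinate [i], so that the exponent is additive over
    coordinates. *)
Let psi i l : R :=
  ln (h / 4) - h / 2 - h ^+ 2 / 16 - (mu i + h * e l) ^+ 2 / 4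
  + (b 0 i * (U * h * e l) - Nn * (U * h * e l) ^+ 2 / (2 * tau)).

Let shift_lt i (l : 'I_n) : (k0 i + l < M + M)%N.
Proof. by apply: leq_trans (k0M i); rewrite ltn_add2l. Qed.

Let shift (j : {ffun 'I_d -> 'I_n}) : {ffun 'I_d -> 'I_(M + M)} :=
  [ffun i => Ordinal (shift_lt i (j i))].

Let shift_inj : injective shift.
Proof.
move=> j1 j2 /ffunP h12; apply/ffunP => i; apply/val_inj.
by have := congr1 val (h12 i); rewrite !ffunE /= => /addnI.
Qed.

Let U0 : U != 0.
Proof.
apply/eqP => U0; have := exprn_gt0 2 B0.
by rewrite -UB U0 expr0n mul0r ltxx.
Qed.

Let center : 'rV[R]_d := \row_i (U * mu i).

Let center_near : l2norm (center - what) <= B * h.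
Proof.
have Bh : 0 <= B * h by rewrite mulr_ge0 // ltW.
rewrite -ler_sqr ?nnegrE ?sqrtr_ge0 // sqr_sqrtr ?dotv_ge0 //.
rewrite exprMn -UB mulrAC mulrC -[d in d%:R]card_ord -sumr_const mulr_suml.
apply: ler_sum => i _; rewrite !mxE mul1r -expr2.
have -> : U * mu i - what 0 i = U * (mu i - what 0 i / U).
  by rewrite mulrBr (mulrCA U (what 0 i)) mulfV // mulr1.
rewrite exprMn ler_wpM2l ?sqr_ge0 // -[leLHS]real_normK ?num_real //.
by rewrite ler_sqr ?nnegrE // ltW.
Qed.

Let grid_shift (j : {ffun 'I_d -> 'I_n}) : grid U h M (shift j) = center + \row_i (U * h * e (j i)).
Proof.
apply/rowP => i; rewrite !mxE ffunE /= natrD /mu /e; lra.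
Qed.

(** The linear part along the box is kept exactly and only [A] is estimated by its Lipschitz bound.
    The rounding error between [center] and [what] is paid twice, once through [A] and once through
    [b]. *)
Let loss_bound (j : {ffun 'I_d -> 'I_n}) :
  \sum_i (b 0 i * (U * h * e (j i)) - Nn * (U * h * e (j i)) ^+ 2 / (2 * tau))
  - Nn * tau / 2 - 2 * Nn * (B * h) <=
  (A what - dotv b what)
  - (A (grid U h M (shift j)) - dotv b (grid U h M (shift j))).
Proof.
rewrite grid_shift; set v := \row_i _.
have h1 := ALip (center + v) center.
have -> : \sum_i (b 0 i * (U * h * e (j i)) - Nn * (U * h * e (j i)) ^+ 2 / (2 * tau))
   = dotv b v - Nn * (dotv v v / tau) / 2.
  rewrite sumrB; congr (_ - _).
    by apply: eq_bigr => i _; rewrite mxE.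
  rewrite /dotv mulr_suml mulr_sumr mulr_suml; apply: eq_bigr => i _.
  by rewrite mxE invfM; lra.
rewrite addrAC subrr add0r in h1.
have h2 := ler_wpM2l N0 (l2norm_amgm v _ tau0).
have h3 := ALip center what.
have h4 := bLip (center - what).
have h5 := ler_wpM2l N0 center_near.
rewrite dotvBr ler_norml in h4; rewrite dotvDr; lra.
Qed.

(* Jensen's inequality with the uniform law on a box of n^d grid points around
   [what]. The box is symmetric around its centre, so the linear part
   [dotv b] of the loss averages out. *)
Lemma mixture_lower :
  (n ^ d)%:R * expR (\sum_i (ln (h / 4) - h / 2 - h ^+ 2 / 16
       - (mu i ^+ 2 + h ^+ 2 * n%:R ^+ 2 / 12) / 4)
     - Nn * (B ^+ 2 * (h ^+ 2 * n%:R ^+ 2) / 12 / tau + tau) / 2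
     - 2 * Nn * (B * h)) <=
  \sum_(g : {ffun 'I_d -> 'I_(M + M)}) prior h M g *
    expR ((A what - dotv b what) - (A (grid U h M g) - dotv b (grid U h M g))).
Proof.
pose v (j : {ffun 'I_d -> 'I_n}) : R :=
  \sum_i psi i (j i) - Nn * tau / 2 - 2 * Nn * (B * h).
have cJ : #|{: {ffun 'I_d -> 'I_n}}| = (n ^ d)%N.
  by rewrite card_ffun !card_ord.
have := @jensen_subset R _ _
  (fun g => prior h M g * expR ((A what - dotv b what)
     - (A (grid U h M g) - dotv b (grid U h M g)))) shift v.
rewrite cJ expn_gt0 n0 => /(_ isT shift_inj).
have hw g : 0 <= prior h M g * expR ((A what - dotv b what)
     - (A (grid U h M g) - dotv b (grid U h M g))).
  by rewrite mulr_ge0 ?prior_ge0 ?expR_ge0.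
move=> /(_ hw) H; apply: le_trans (H _); last first.
  move=> j.
  have -> : v j = \sum_i (ln (h / 4) - h / 2 - h ^+ 2 / 16
        - (mu i + h * e (j i)) ^+ 2 / 4)
     + (\sum_i (b 0 i * (U * h * e (j i))
                - Nn * (U * h * e (j i)) ^+ 2 / (2 * tau))
        - Nn * tau / 2 - 2 * Nn * (B * h)).
    by rewrite /v /psi big_split /= !addrA.
  rewrite [leLHS]expRD; cbv beta.
  apply: ler_pM; rewrite ?expR_ge0 //.
    rewrite expR_sum; apply: ler_prod => i _; rewrite expR_ge0 /=.
    apply: le_trans (cell_ge _ _ _ h0); rewrite ler_expR /mu /e ffunE /= natrD.
    lra.
  by rewrite ler_expR; apply: loss_bound.
have nn : n%:R != 0 :> R by rewrite pnatr_eq0 -lt0n.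
have nd : (n ^ d)%:R != 0 :> R by rewrite pnatr_eq0 expn_eq0 negb_and -lt0n n0.
rewrite ler_wpM2l // ler_expR.
have -> : (\sum_j v j) / (n ^ d)%:R =
    \sum_i (\sum_l psi i l) / n%:R - Nn * tau / 2 - 2 * Nn * (B * h).
  have -> : \sum_j v j = \sum_i \sum_(j : {ffun 'I_d -> 'I_n}) psi i (j i)
     + (n ^ d)%:R * (- (Nn * tau / 2) - 2 * Nn * (B * h)).
    rewrite /v exchange_big /= big_split /= big_split /= !sumr_const cJ.
    rewrite -(mulr_natl (- (Nn * tau / 2)) (n ^ d)).
    by rewrite -(mulr_natl (- (2 * Nn * (B * h))) (n ^ d)); lra.
  rewrite mulrDl mulr_suml mulrAC mulfV // mul1r.
  by under eq_bigr => i _ do rewrite sum_ffun_coord //; lra.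
(* Averaging over [l] removes the terms linear in [e] and turns e^2 into (n^2 - 1)/12 <= n^2/12. *)
have hpsi i : ln (h / 4) - h / 2 - h ^+ 2 / 16
       - (mu i ^+ 2 + h ^+ 2 * n%:R ^+ 2 / 12) / 4
       - Nn * U ^+ 2 * (h ^+ 2 * n%:R ^+ 2) / 12 / (2 * tau)
    <= (\sum_l psi i l) / n%:R.
  have -> : \sum_l psi i l =
     n%:R * (ln (h / 4) - h / 2 - h ^+ 2 / 16 - mu i ^+ 2 / 4)
     + (b 0 i * (U * h) - mu i * h / 2) * (\sum_l e l)
     - (h ^+ 2 / 4 + Nn * U ^+ 2 * h ^+ 2 / (2 * tau)) * \sum_l e l ^+ 2.
    set C := ln (h / 4) - h / 2 - h ^+ 2 / 16 - mu i ^+ 2 / 4.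
    have -> : n%:R * C = \sum_(l < n) C by rewrite sumr_const card_ord mulr_natl.
    rewrite !mulr_sumr -big_split -sumrB /=; apply: eq_bigr => l _.
    rewrite /psi /C; lra.
  rewrite /e sum_centered sum_centered_sqr mulr0 addr0.
  set c1 := h ^+ 2 / 4 + _; set c2 := ln (h / 4) - h / 2 - h ^+ 2 / 16 - mu i ^+ 2 / 4.
  have c10 : 0 <= c1.
    rewrite /c1 addr_ge0 //; first by rewrite divr_ge0 ?sqr_ge0.
    apply: divr_ge0; last by rewrite mulr_ge0 // ltW.
    by rewrite mulr_ge0 ?sqr_ge0 // mulr_ge0 ?sqr_ge0.
  have -> : (n%:R * c2 - c1 * (n%:R * (n%:R ^+ 2 - 1) / 12)) / n%:R =
     c2 - c1 * (n%:R ^+ 2 - 1) / 12.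
    transitivity ((n%:R / n%:R) * (c2 - c1 * (n%:R ^+ 2 - 1) / 12)); first by lra.
    by rewrite mulfV // mul1r.
  have -> : Nn * U ^+ 2 * (h ^+ 2 * n%:R ^+ 2) / 12 / (2 * tau) =
     Nn * U ^+ 2 * h ^+ 2 / (2 * tau) * n%:R ^+ 2 / 12 by lra.
  by rewrite /c1 /c2 in c10 *; lra.
have := ler_sum (index_enum 'I_d) (fun i (_ : true) => hpsi i).
rewrite sumrB sumr_const card_ord -(mulr_natl _ d).
have -> : d%:R * (Nn * U ^+ 2 * (h ^+ 2 * n%:R ^+ 2) / 12 / (2 * tau)) =
   Nn * (U ^+ 2 * d%:R) * (h ^+ 2 * n%:R ^+ 2) / 12 / (2 * tau) by lra.
rewrite UB invfM; lra.
Qed.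
End MixtureLower.

(** The error budget in units of D: 3/8 for mesh and box width, 11/40 for the distance to the
    origin, 5/16 for the variation of the loss over the box and 1/100 for rounding, together below
    1. *)
Lemma prior_arith {R : realType} (D c h s w bias tail Smu : R) :
  0 <= D -> 0 < c <= 1 -> 0 < h -> h <= c / 50 -> 0 <= s -> s <= 4 * c + h ->
  w <= D / 4 -> tail <= 5 / 4 * w -> bias <= w / 25 ->
  Smu <= D * (1 + h) ^+ 2 ->
  - D <= - (D * (h / 2 + h ^+ 2 / 16 + s ^+ 2 / 48)) - Smu / 4 - tail - bias.
Proof.
move=> D0 /andP[c0 c1] h0 hc s0 sc w1 tl bs Sm.
have h1 : h <= 1 / 50 by lra.
have h2 : h ^+ 2 <= 1 / 50 * h by rewrite expr2 ler_wpM2r // ltW.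
have s2 : s ^+ 2 <= 17.
  apply: (@le_trans _ _ ((41 / 10) ^+ 2)); last by lra.
  by rewrite ler_sqr ?nnegrE; lra.
have e1 : h / 2 + h ^+ 2 / 16 + s ^+ 2 / 48 <= 3 / 8 by lra.
have e2 : (1 + h) ^+ 2 <= 11 / 10 by lra.
have := ler_wpM2l D0 e1; have := ler_wpM2l D0 e2.
by move: D0 w1 tl bs Sm; clear; lra.
Qed.

(* The box has side n h close to 4 c in units of U = B / sqrt d, where 1 / c is
   max(1, 4 B (t - 1) / d): the resulting exponent d (ln c - 1) is exactly the
   one in the confidence radius. *)
Lemma prior_covers {R : realType} (d T : nat) (B : R) :
  (0 < d)%N -> 0 < B ->
  exists U h (M : nat), 0 < h /\
  forall (t : nat) (A : 'rV[R]_d -> R) (b what : 'rV[R]_d),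
  (1 <= t <= T)%N -> l2ball d B what ->
  (forall v w, A v - A w <= (t.-1)%:R * l2norm (v - w)) ->
  (forall u, `|dotv b u| <= (t.-1)%:R * l2norm u) ->
  expR (- (d%:R * ln (Num.max (expR 1) (4 * expR 1 * B * (t.-1)%:R / d%:R)))) <=
  \sum_(g : {ffun 'I_d -> 'I_(M + M)}) prior h M g *
    expR ((A what - dotv b what)
          - (A (grid U h M g) - dotv b (grid U h M g))).
Proof.
move=> d0 B0.
pose D : R := d%:R; have D0 : 0 < D by rewrite ltr0n.
pose sd := Num.sqrt D; have sd0 : 0 < sd by rewrite sqrtr_gt0.
have sd2 : sd ^+ 2 = D by rewrite sqr_sqrtr // ltW.
pose U := B / sd; have U0 : 0 < U by rewrite divr_gt0.
have UB : U ^+ 2 * d%:R = B ^+ 2.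
  by rewrite /U expr_div_n -/D -sd2 mulfVK // gt_eqF // exprn_gt0.
pose Kf (m : nat) := Num.max 1 (4 * B * m%:R / D).
have Kf1 m : 1 <= Kf m by rewrite le_max lexx.
have Kf0 m : 0 < Kf m by apply: lt_le_trans ltr01 (Kf1 m).
(* The mesh cannot depend on [t]; since [Kf] is monotone, the horizon [T] gives h <= c / 50 at every
   round. *)
pose h := (Kf T)^-1 / 50.
have h0 : 0 < h by rewrite divr_gt0 // invr_gt0.
(* A single coordinate of [what / U] can be as large as sqrt d; the rest is room for half a box and
   for rounding. *)
pose M := (Num.truncn ((sd + 4) / h) + 10)%N.
have MM : (sd + 4) / h + 9 <= M%:R.
  have q0 : 0 <= (sd + 4) / h by rewrite divr_ge0 ?(ltW h0) // addr_ge0 // ltW.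
  have /andP[_] := truncn_itv q0; rewrite /M natrD -natr1; lra.
exists U, h, M; split=> // t A b what /andP[t1 tT] whatB AL bL.
set m := t.-1 in AL bL *.
have mT : (m <= T)%N by rewrite (leq_trans (leq_pred _)).
pose c := (Kf m)^-1.
have c0 : 0 < c by rewrite invr_gt0.
have c1 : c <= 1 by rewrite invf_le1.
have hc : h <= c / 50.
  rewrite ler_pM2r ?invr_gt0 // lef_pV2 ?posrE //.
  rewrite /Kf ge_max le_max lexx /= le_max ler_pM2r ?invr_gt0 //.
  by rewrite ler_pM2l ?mulr_gt0 // ler_nat mT orbT.
(* The reason for the scale [c]: over a box of Euclidean size of order B c, the loss of m rounds
   varies by only O(d). *)
have cB : m%:R * (B * c) <= D / 4.
  have : 4 * B * m%:R / D <= Kf m by rewrite le_max lexx orbT.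
  rewrite ler_pdivrMr // => hK.
  have := ler_wpM2l (ltW c0) hK.
  have -> : c * (Kf m * D) = D by rewrite mulrA mulVf ?gt_eqF ?mul1r.
  lra.
have emax : Num.max (expR 1) (4 * expR 1 * B * m%:R / d%:R) = expR 1 / c.
  rewrite /c invrK /Kf maxr_pMr ?expR_ge0 // mulr1; congr Num.max; rewrite -/D; lra.
rewrite emax ln_div ?posrE ?expR_gt0 // expRK.
pose n := (Num.truncn (4 * c / h)).+1.
have q0 : 0 <= 4 * c / h by rewrite divr_ge0 ?(ltW h0) // mulr_ge0 // ltW.
have /andP[n1 n2] := truncn_itv q0.
rewrite -/n in n2.
have n3 : n%:R <= 4 * c / h + 1 by rewrite /n -natr1; lra.
have n4 : 4 * c < n%:R * h by rewrite -ltr_pdivrMr.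
have hh : h * h^-1 = 1 by rewrite mulfV ?gt_eqF.
have n5 : n%:R * h <= 4 * c + h.
  have := ler_wpM2r (ltW h0) n3.
  by rewrite mulrDl mul1r mulfVK ?gt_eqF.
pose u i := what 0 i / U.
have usum : \sum_i u i ^+ 2 <= D.
  have : dotv what what <= B ^+ 2.
    move: whatB; rewrite /l2ball /l2norm /= -ler_sqr ?nnegrE ?sqrtr_ge0 ?(ltW B0) //.
    by rewrite sqr_sqrtr // dotv_ge0.
  have -> : \sum_i u i ^+ 2 = dotv what what / U ^+ 2.
    by rewrite /dotv mulr_suml; apply: eq_bigr => i _; rewrite /u expr_div_n expr2.
  by rewrite -UB -/D ler_pdivrMr ?exprn_gt0 // mulrC.
have ubound i : `|u i| <= sd.
  rewrite -ler_sqr ?nnegrE ?(ltW sd0) // sd2 real_normK ?num_real //.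
  apply: le_trans usum; rewrite (bigD1 i) //= lerDl sumr_ge0 // => j _.
  exact: sqr_ge0.
have uh i : `|u i / h| + n%:R / 2 <= M%:R - 1.
  apply: le_trans (_ : _ <= (sd + 4) / h + 8) _; last by lra.
  rewrite normrM (ger0_norm (ltW _ : 0 <= h^-1)) ?invr_gt0 //.
  have hi0 : 0 <= h^-1 by rewrite invr_ge0 ltW.
  have := ler_wpM2r hi0 (ubound i); have := ler_wpM2r hi0 c1; lra.
(* Real index of the first cell that would centre the box exactly at [u i]; [k0] rounds it down. *)
pose y i := u i / h - n%:R / 2 + M%:R.
have y0 i : 0 <= y i.
  by have := uh i; have := ler_norm (- (u i / h)); rewrite normrN /y; lra.
pose k0 i := Num.truncn (y i).
have k0y i := truncn_itv (y0 i).
have k0M i : (k0 i + n <= M + M)%N.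
  rewrite -(ler_nat R) (natrD _ (k0 i) n) (natrD _ M M); have /andP[k1 _] := k0y i.
  by have := uh i; have := ler_norm (u i / h); rewrite /k0; move: k1; rewrite /y; lra.
pose mu i := h * ((k0 i)%:R + n%:R / 2 - M%:R).
have mue i : mu i = u i - h * (y i - (k0 i)%:R).
  rewrite /mu /y; have -> : u i = h * (u i / h) by rewrite mulrCA hh mulr1.
  have -> : h * (u i / h) / h = u i / h by rewrite mulrCA hh mulr1.
  lra.
have near i : `|mu i - what 0 i / U| <= h.
  have /andP[k1 k2] := k0y i; rewrite -natr1 -/(k0 i) in k2.
  rewrite mue -/(u i) addrAC subrr add0r normrN ger0_norm; last first.
    by rewrite mulr_ge0 ?(ltW h0) // subr_ge0.
  by rewrite -[leRHS]mulr1 ler_wpM2l ?(ltW h0) //; lra.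
have tau0 : 0 < B * c by rewrite mulr_gt0.
have := @mixture_lower R d B U h m%:R (B * c) M n k0 A b what B0 UB h0 (ler0n _ _)
  tau0 isT k0M AL bL near.
apply: le_trans.
have n0 : 0 < n%:R :> R by rewrite ltr0n.
have -> : (n ^ d)%:R = expR (D * ln n%:R) :> R.
  by rewrite expRM_natl lnK ?posrE // natrX.
rewrite -expRD ler_expR.
rewrite sumrB sumr_const card_ord.
rewrite -(mulr_natl (ln (h / 4) - h / 2 - h ^+ 2 / 16) d) -/D.
have Smu : \sum_i mu i ^+ 2 <= D * (1 + h) ^+ 2.
  (* The slack over (|u| + h)^2 is h (|u| - 1)^2; this form sums to D (1 + h)^2. *)
  have h1 i : mu i ^+ 2 <= (1 + h) * (u i ^+ 2 + h).
    have h2 : `|mu i| <= `|u i| + h.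
      by have := near i; have := ler_normD (mu i - u i) (u i); rewrite subrK /u; lra.
    rewrite -(real_normK (num_real (mu i))) -(real_normK (num_real (u i))).
    apply: (@le_trans _ _ ((`|u i| + h) ^+ 2)).
      by rewrite ler_sqr ?nnegrE // addr_ge0 // ltW.
    by have := mulr_ge0 (ltW h0) (sqr_ge0 (`|u i| - 1)); lra.
  apply: le_trans (ler_sum (index_enum 'I_d) (fun i (_ : true) => h1 i)) _.
  rewrite -mulr_sumr big_split /= sumr_const card_ord -(mulr_natl h d) -/D.
  have h3 : 0 <= 1 + h by rewrite addr_ge0 // ltW.
  by have := ler_wpM2l h3 usum; lra.
have -> : \sum_i (mu i ^+ 2 + h ^+ 2 * n%:R ^+ 2 / 12) / 4 =
    (\sum_i mu i ^+ 2) / 4 + D * (h ^+ 2 * n%:R ^+ 2 / 12 / 4).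
  rewrite -mulr_suml big_split /= sumr_const card_ord.
  by rewrite -(mulr_natl (h ^+ 2 * n%:R ^+ 2 / 12) d) -/D; lra.
set s := n%:R * h in n4 n5.
have es : h ^+ 2 * n%:R ^+ 2 = s ^+ 2 by rewrite /s; lra.
rewrite es.
have s0 : 0 <= s by apply: ltW; apply: lt_trans n4; rewrite mulr_gt0.
(* The number of cells compensates the mass of one cell: the side 4 c was chosen to cancel the peak
   density 1/4. *)
have lnc : ln c <= ln n%:R + ln (h / 4).
  have -> : ln n%:R + ln (h / 4) = ln (n%:R * (h / 4)).
    by rewrite [RHS]lnM ?posrE // divr_gt0.
  rewrite ler_ln ?posrE //; first by move: n4; rewrite /s; lra.
  by rewrite mulr_gt0 // divr_gt0.
have tail : B ^+ 2 * s ^+ 2 / 12 / (B * c) <= 3 / 2 * (B * c).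
  rewrite ler_pdivrMr //.
  have sc : s <= 41 / 10 * c by lra.
  have : s ^+ 2 <= (41 / 10 * c) ^+ 2 by rewrite ler_sqr ?nnegrE //; lra.
  move=> h1; have := ler_wpM2l (sqr_ge0 B) h1.
  have : 0 <= (B * c) ^+ 2 by apply: sqr_ge0.
  lra.
have m0 : 0 <= m%:R :> R by rewrite ler0n.
have tail2 : m%:R * (B ^+ 2 * s ^+ 2 / 12 / (B * c) + B * c) / 2 <=
   5 / 4 * (m%:R * (B * c)).
  by have := ler_wpM2l m0 tail; lra.
have bias : 2 * m%:R * (B * h) <= (m%:R * (B * c)) / 25.
  have mB : 0 <= m%:R * B by rewrite mulr_ge0 // ltW.
  by have := ler_wpM2l mB hc; lra.
have c01 : 0 < c <= 1 by rewrite c0.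
have := @prior_arith R D c h s _ _ _ _ (ltW D0) c01 h0 hc s0 n5 cB tail2 bias Smu.
have := ler_wpM2l (ltW D0) lnc.
lra.
Qed.

(** * Conditioning and Ville's inequality *)

Section SubSigmaAlgebra.
Context {R : realType} {disp : measure_display} {Omega : measurableType disp}.
Context (G : set (set Omega)).
Hypothesis salgG : sigma_algebra setT G.
Hypothesis subG : G `<=` measurable.

(** Stated on the type generated by [G], so that the closure lemmas for measurable functions apply
    to the sub-sigma-algebra. *)
Definition gmeas (f : Omega -> R) : Prop :=
  measurable_fun (setT : set (g_sigma_algebraType G))
    (f : g_sigma_algebraType G -> R).

Lemma measurable_gE (A : set Omega) :
  measurable (A : set (g_sigma_algebraType G)) = G A.
Proof. by rewrite -[in RHS](measurable_g_measurableTypeE salgG). Qed.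

Lemma gmeas_preimage (f : Omega -> R) (Y : set R) :
  gmeas f -> measurable Y -> G (f @^-1` Y).
Proof. by move=> hf mY; rewrite -measurable_gE -[X in measurable X]setTI; apply: hf. Qed.

Lemma preimage_gmeas (f : Omega -> R) :
  (forall Y, measurable Y -> G (f @^-1` Y)) -> gmeas f.
Proof. by move=> hf _ Y mY; rewrite setTI measurable_gE; apply: hf. Qed.

Lemma gmeas_measurable (f : Omega -> R) : gmeas f -> measurable_fun setT f.
Proof.
by move=> hf _ Y mY; rewrite setTI; apply: subG; apply: gmeas_preimage.
Qed.

(** Reduces a random index, here the offered assortment, to fixed ones by a finite sum of
    indicators. *)
Lemma gmeas_finite_choice {K : finType} (k : Omega -> K) (f : K -> Omega -> R) :
  (forall a, G (k @^-1` [set a])) -> (forall a, gmeas (f a)) ->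
  gmeas (fun omega => f (k omega) omega).
Proof.
move=> hk hf.
have -> : (fun omega => f (k omega) omega) =
    (fun omega => \sum_a f a omega * \1_(k @^-1` [set a]) omega).
  apply/funext => omega; rewrite (bigD1 (k omega)) //= big1 ?addr0.
    by rewrite indicE mem_set // mulr1.
  move=> a ak; rewrite indicE memNset ?mulr0 //= => e.
  by move: ak; rewrite e eqxx.
apply: measurable_sum => a; apply: measurable_funM; first exact: hf.
apply: (@measurable_indic _ (g_sigma_algebraType G) R setT).
by rewrite measurable_gE.
Qed.

Context (P : probability Omega R).

(** The case of a single level set in the simple-function argument for [integral_cond]. *)
Lemma integral_indicM_G (y : R) (A B E : set Omega) (q : Omega -> R) :
  0 <= y -> G A -> G B -> measurable E -> gmeas q -> (forall omega, 0 <= q omega) ->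
  (forall C, G C -> P (C `&` E) = \int[P]_(omega in C) (q omega)%:E)%E ->
  (\int[P]_(omega in A) (y * \1_B omega * \1_E omega)%:E =
   \int[P]_(omega in A) (y * \1_B omega * q omega)%:E)%E.
Proof.
move=> y0 GA GB mE mq q0 hE.
have mA := subG _ GA; have mB := subG _ GB.
have mq' : measurable_fun A q by apply/measurable_funTS/gmeas_measurable.
have -> : (\int[P]_(omega in A) (y * \1_B omega * \1_E omega)%:E =
    y%:E * P (A `&` B `&` E))%E.
  transitivity (\int[P]_(omega in A) (y%:E * (\1_(B `&` E) omega)%:E))%E.
    by apply: eq_integral => omega _; rewrite indicI /= -EFinM mulrA.
  rewrite ge0_integralZl_EFin //.
  - rewrite integral_indic //; last exact: measurableI.
    by rewrite setIC setIA.
  - apply/measurable_EFinP; apply: measurable_indic; exact: measurableI.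
have -> : (\int[P]_(omega in A) (y * \1_B omega * q omega)%:E =
    y%:E * \int[P]_(omega in A `&` B) (q omega)%:E)%E.
  rewrite integral_mkcondr -ge0_integralZl_EFin //.
  - apply: eq_integral => omega _; rewrite patchE indicE.
    by case: ifPn => _; [rewrite mulr1 EFinM | rewrite mulr0 mul0r mule0].
  - by move=> omega _; rewrite patchE; case: ifPn => // _; rewrite lee_fin.
  - apply/(measurable_restrict _ mB mA)/measurable_funS; last exact/measurable_EFinP/mq'.
      exact: mA.
    exact: subIsetl.
rewrite hE //; rewrite -measurable_gE; apply: measurableI; rewrite measurable_gE //.
Qed.

(* The hypothesis on q says that q is a version of P(E | G). *)
Lemma integral_cond (A E : set Omega) (Z q : Omega -> R) :
  G A -> measurable E -> gmeas q -> (forall omega, 0 <= q omega) ->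
  gmeas Z -> (forall omega, 0 <= Z omega) ->
  (forall C, G C -> P (C `&` E) = \int[P]_(omega in C) (q omega)%:E)%E ->
  (\int[P]_(omega in A) (Z omega * \1_E omega)%:E =
   \int[P]_(omega in A) (Z omega * q omega)%:E)%E.
Proof.
move=> GA mE mq q0 mZ Z0 hE.
have mA := subG _ GA.
have mZ' : measurable_fun (setT : set (g_sigma_algebraType G)) (EFin \o Z).
  exact/measurable_EFinP.
(* Approximating over the type generated by [G] keeps the level sets in [G], where the hypothesis on
   [q] can be used. *)
have [g [gnd gZ]] := @approximation _ (g_sigma_algebraType G) R setT
  measurableT _ mZ' (fun t _ => Z0 t).
pose gf (n : nat) : Omega -> R := fun o => g n (o : g_sigma_algebraType G).
have gm n : gmeas (gf n) by apply: (@measurable_funPT _ _ _ _ (g n)).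
have gfin n : finite_set (range (gf n)) by apply: (@fimfunP _ _ (g n)).
have g0 n o : 0 <= gf n o by apply: (@fun_ge0 _ _ (g n)).
have gs n : exists s : seq R,
    [/\ uniq s, forall o, gf n o \in s & forall y, y \in s -> 0 <= y].
  have [s hs] := (finite_seqP _).1 (gfin n); exists (undup s).
  split=> [|o|y]; rewrite ?undup_uniq ?mem_undup //.
    by have : range (gf n) (gf n o) by [exists o]; rewrite hs.
  move=> ys; have : range (gf n) y by rewrite hs.
  by case=> o _ <-; apply: g0.
have key n s (v : Omega -> R) : uniq s -> (forall o, gf n o \in s) ->
    (forall y, y \in s -> 0 <= y) ->
    measurable_fun setT v -> (forall omega, 0 <= v omega) ->
    (\int[P]_(omega in A) (gf n omega * v omega)%:E =
     \sum_(y <- s)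
       \int[P]_(omega in A) (y * \1_(gf n @^-1` [set y]) omega * v omega)%:E)%E.
  move=> us sm s0 mv v0.
  have gsum omega : gf n omega = \sum_(y <- s) y * \1_(gf n @^-1` [set y]) omega.
    rewrite (bigD1_seq (gf n omega)) //= indicE mem_set // mulr1 big1 ?addr0 //.
    by move=> y ye; rewrite indicE memNset ?mulr0 //= => e; move: ye; rewrite e eqxx.
  (* Set to 0 off [s], since the exchange of sum and integral asks for nonnegativity at every
     [y]. *)
  pose F y omega : \bar R := if y \in s
    then (y * \1_(gf n @^-1` [set y]) omega * v omega)%:E else 0%E.
  transitivity (\int[P]_(omega in A) \sum_(y <- s) F y omega)%E.
    apply: eq_integral => omega _; rewrite gsum mulr_suml -sumEFin.
    by rewrite !big_seq; apply: eq_bigr => y ys; rewrite /F ys.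
  rewrite ge0_integral_sum //.
  - by rewrite !big_seq; apply: eq_bigr => y ys; apply: eq_integral => omega _; rewrite /F ys.
  - move=> y; rewrite /F; case: (y \in s); last exact: measurable_cst.
    apply/measurable_EFinP/measurable_funTS/measurable_funM => //.
    apply: measurable_funM => //; apply: measurable_indic; apply: subG.
    exact: gmeas_preimage.
  - move=> y omega _; rewrite /F; case: ifPn => // ys.
    by rewrite lee_fin mulr_ge0 // mulr_ge0 // s0.
have lim (v : Omega -> R) : measurable_fun setT v -> (forall omega, 0 <= v omega) ->
    ((\int[P]_(omega in A) (gf n omega * v omega)%:E) @[n --> \oo] -->
     \int[P]_(omega in A) (Z omega * v omega)%:E)%E.
  move=> mv v0.
  have -> : (\int[P]_(omega in A) (Z omega * v omega)%:E =
     \int[P]_(omega in A) limn (fun n => (gf n omega * v omega)%:E))%E.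
    apply: eq_integral => omega _; apply/esym/cvg_lim => //.
    under eq_fun => n do rewrite EFinM muleC.
    rewrite mulrC EFinM; apply: cvgeZl => //; exact: gZ.
  apply: cvg_monotone_convergence => //.
  - move=> n; apply/measurable_EFinP/measurable_funTS/measurable_funM => //.
    exact: gmeas_measurable.
  - by move=> n omega _; rewrite lee_fin mulr_ge0.
  - move=> omega _ m n mn; rewrite lee_fin ler_wpM2r //.
    by have /lefP := gnd _ _ mn; apply.
have mq' := gmeas_measurable _ mq.
have mE' : measurable_fun setT (\1_E : Omega -> R) by apply: measurable_indic.
have e0 omega : 0 <= (\1_E omega : R) by [].
have h1 := lim _ mE' e0; have h2 := lim _ mq' q0.
have he : (fun n => \int[P]_(omega in A) (gf n omega * \1_E omega)%:E)%E =
          (fun n => \int[P]_(omega in A) (gf n omega * q omega)%:E)%E.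
  apply/funext => n; have [s [us sm s0]] := gs n.
  rewrite !(key n s) // !big_seq; apply: eq_bigr => y ys.
  apply: integral_indicM_G => //; first exact: s0.
  exact: gmeas_preimage.
rewrite he in h1.
by rewrite -(cvg_lim (@ereal_hausdorff R) h1) -(cvg_lim (@ereal_hausdorff R) h2).
Qed.

End SubSigmaAlgebra.

(** Backward induction on the starting round instead of stopping times: for [A] in [F t], the part
    where [M t] already reaches [a] is handled by Markov's inequality, and the rest is passed to
    round t + 1, where the supermartingale property brings the integral back to round t. *)
Lemma ville {R : realType} {disp : measure_display} {Omega : measurableType disp}
    (P : probability Omega R) (F : nat -> set (set Omega)) (M : nat -> Omega -> R)
    (T : nat) (a : R) : 0 < a ->
  (forall t, sigma_algebra setT (F t)) -> (forall t, F t `<=` measurable) ->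
  (forall s t, (s <= t)%N -> F s `<=` F t) ->
  (forall t omega, 0 <= M t omega) ->
  (forall t, (1 <= t <= T.+1)%N -> gmeas (F t) (M t)) ->
  (forall t A, (1 <= t <= T)%N -> F t A ->
     (\int[P]_(omega in A) (M t.+1 omega)%:E <=
      \int[P]_(omega in A) (M t omega)%:E)%E) ->
  measurable [set omega | exists2 s, (1 <= s <= T)%N & (a <= M s omega)%R] /\
  (a%:E * P [set omega | exists2 s, (1 <= s <= T)%N & (a <= M s omega)%R] <=
   \int[P]_omega (M 1 omega)%:E)%E.
Proof.
move=> a0 sF subF incF M0 mM super.
pose H t := [set omega | exists2 s, (t <= s <= T)%N & (a <= M s omega)%R].
have HS t : (t <= T)%N -> H t = [set omega | (a <= M t omega)%R] `|` H t.+1.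
  move=> tT; apply/seteqP; split=> omega.
    move=> [s /andP[ts sT] h]; move: ts; rewrite leq_eqVlt => /predU1P[->|ts].
      by left.
    by right; exists s => //; rewrite ts.
  move=> [h|[s /andP[ts sT] h]]; first by exists t => //; rewrite leqnn.
  by exists s => //; rewrite sT andbT ltnW.
have FB t : (1 <= t <= T)%N -> F t [set omega | (a <= M t omega)%R].
  move=> /andP[t1 tT].
  have -> : [set omega | (a <= M t omega)%R] = M t @^-1` `[a, +oo[%classic.
    by apply/seteqP; split=> omega /=; rewrite in_itv /= andbT.
  apply: (gmeas_preimage _ (sF t)); last exact: measurable_itv.
  by apply: mM; rewrite t1 leqW.
have key k : forall t A, (1 <= t)%N -> (t + k = T.+1)%N -> F t A ->
  measurable (H t) /\
  (a%:E * P (A `&` H t) <= \int[P]_(omega in A) (M t omega)%:E)%E.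
  elim: k => [|k IH] t A t1 tk FA.
    have -> : H t = set0.
      rewrite addn0 in tk; rewrite tk; apply/seteqP; split=> omega //.
      by move=> [s /andP[h1 h2] _]; have := leq_trans h1 h2; rewrite ltnn.
    split; first exact: measurable0.
    by rewrite setI0 measure0 mule0 integral_ge0 // => omega _; rewrite lee_fin.
  have tT : (t <= T)%N by rewrite -ltnS -tk addnS ltnS leq_addr.
  have t1T : (1 <= t <= T)%N by rewrite t1.
  set B := [set omega | (a <= M t omega)%R].
  have mA := subF _ _ FA.
  have FtB : F t B by apply: FB.
  have mB := subF _ _ FtB.
  have FAB : F t (A `\` B).
    rewrite -(measurable_gE _ (sF t)); apply: measurableD; rewrite (measurable_gE _ (sF t)) //.
  have FAB' : F t.+1 (A `\` B) by apply: incF FAB.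
  have [mH hH] := IH t.+1 (A `\` B) isT (etrans (addSnnS t k) tk) FAB'.
  have mAB := subF _ _ FAB.
  split; first by rewrite HS //; apply: measurableU.
  have mMt : measurable_fun setT (M t).
    by apply: (gmeas_measurable _ (sF t) (subF t)); apply: mM; rewrite t1 leqW.
  have -> : A `&` H t = (A `&` B) `|` ((A `\` B) `&` H t.+1).
    rewrite HS // -/B; apply/seteqP; split=> omega.
      move=> [Ao [Bo|Ho]]; first by left.
      by have [Bo|Bo] := pselect (B omega); [left|right].
    by move=> [[Ao Bo]|[[Ao _] Ho]]; split=> //; [left|right].
  have dj : [disjoint A `&` B & A `\` B].
    by apply/disj_setPS => omega [[_ Bo] [_ nBo]].
  have e : A = (A `&` B) `|` (A `\` B) by rewrite setUIDK.
  rewrite [in leRHS]e ge0_integral_setU //; last 3 first.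
  - exact: measurableI.
  - by apply/measurable_EFinP/measurable_funTS.
  - by move=> omega _; rewrite lee_fin.
  apply: le_trans (_ : _ <= a%:E * (P (A `&` B) + P ((A `\` B) `&` H t.+1)))%E _.
    by rewrite lee_pmul2l ?lte_fin // measureU2 //; apply: measurableI.
  rewrite ge0_muleDr //; apply: leeD; last exact: le_trans hH (super _ _ t1T FAB).
  rewrite -integral_cst; last exact: measurableI.
  apply: ge0_le_integral => //.
  - exact: measurableI.
  - by move=> omega _; rewrite lee_fin ltW.
  - by apply/measurable_EFinP/measurable_funTS.
  - by move=> omega [_ Bo]; rewrite lee_fin.
have F1 : F 1%N setT by rewrite -(measurable_gE _ (sF 1%N)); apply: measurableT.
by have [mH] := key T 1%N setT isT (add1n T) F1; rewrite setTI.
Qed.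

(** * Confidence sets *)

Lemma dotv_le {R : realType} {d : nat} (u v : 'rV[R]_d) :
  dotv u v <= l2norm u * l2norm v.
Proof.
apply: le_trans (cauchy_schwarz_sum _ _ _) _.
by rewrite /l2norm /dotv; under [in leRHS]eq_bigr do rewrite -expr2;
   under [X in _ <= _ * Num.sqrt X]eq_bigr do rewrite -expr2.
Qed.

Lemma ler_norm_dotv {R : realType} {d : nat} (u v : 'rV[R]_d) :
  l2norm u <= 1 -> `|dotv u v| <= l2norm v.
Proof.
move=> u1; have n0 : 0 <= l2norm v by apply: sqrtr_ge0.
have nN : l2norm (- v) = l2norm v by rewrite /l2norm dotvNl dotvNr opprK.
rewrite ler_norml lerNl -dotvNr -{1}nN; apply/andP; split.
  by apply: le_trans (dotv_le _ _) _; rewrite nN ler_piMl.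
by apply: le_trans (dotv_le _ _) _; rewrite ler_piMl.
Qed.

Section Confidence.
Context {R : realType} {d N : nat} (B delta : R) (wstar : 'rV[R]_d).
Context (x : nat -> 'I_N -> 'rV[R]_d) (S : nat -> {set 'I_N}).
Context (c : nat -> option 'I_N) (what : 'rV[R]_d) (t : nat).
Hypothesis x1 : forall s i, (1 <= s)%N -> l2norm (x s i) <= 1.
Hypothesis cS : forall s, (1 <= s < t)%N -> c s \in alternatives (S s).

Let A (w : 'rV[R]_d) : R := \sum_(1 <= s < t) ln (mnl_norm (x s) (S s) w).
Let b : 'rV[R]_d := \sum_(1 <= s < t) feature (x s) (c s).

Lemma cumulative_lossE w : cumulative_loss x S c t w = A w - dotv b w.
Proof.
rewrite /A /b /cumulative_loss.
have -> : dotv (\sum_(1 <= s < t) feature (x s) (c s)) w =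
    \sum_(1 <= s < t) dotv (feature (x s) (c s)) w.
  elim/big_rec2: _ => [|s y1 y2 _ <-]; first by rewrite dotv0l.
  by rewrite dotvDl.
rewrite -sumrB !big_nat; apply: eq_bigr => s st.
by rewrite round_lossE ?cS.
Qed.

Lemma feature_dotv s i (u : 'rV[R]_d) : (1 <= s)%N ->
  `|dotv (feature (x s) i) u| <= l2norm u.
Proof.
move=> s1; case: i => [i|] /=; first by rewrite ler_norm_dotv // x1.
by rewrite dotv0l normr0 sqrtr_ge0.
Qed.

(** Unit features change each exponential by a factor at most exp(|v - w|), hence also their sum, in
    each of the t - 1 past rounds. *)
Lemma log_partition_lip v w : A v - A w <= (t.-1)%:R * l2norm (v - w).
Proof.
rewrite /A -sumrB.
apply: (@le_trans _ _ (\sum_(1 <= s < t) l2norm (v - w))); last first.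
  by rewrite sumr_const_nat subn1 mulr_natl.
rewrite !big_nat; apply: ler_sum => s /andP[s1 _].
have e0 := expR_gt0 (l2norm (v - w)).
rewrite lerBlDr -(expRK (l2norm (v - w))) -lnM ?posrE ?mnl_norm_gt0 //.
rewrite ler_ln ?posrE ?mulr_gt0 ?mnl_norm_gt0 //.
rewrite !mnl_normE mulr_sumr; apply: ler_sum => i _.
rewrite -expRD ler_expR -lerBlDr -dotvBr.
exact: le_trans (ler_norm _) (feature_dotv _ _ _ s1).
Qed.

Lemma sum_feature_dotv u : `|dotv b u| <= (t.-1)%:R * l2norm u.
Proof.
have -> : dotv b u = \sum_(1 <= s < t) dotv (feature (x s) (c s)) u.
  rewrite /b; elim/big_rec2: _ => [|s y1 y2 _ <-]; first by rewrite dotv0l.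
  by rewrite dotvDl.
apply: le_trans (ler_norm_sum _ _ _) _.
apply: (@le_trans _ _ (\sum_(1 <= s < t) l2norm u)); last first.
  by rewrite sumr_const_nat subn1 mulr_natl.
rewrite !big_nat; apply: ler_sum => s /andP[s1 _].
exact: feature_dotv.
Qed.

(** Rebasing the mixture from [wstar] to [what] pulls out the factor exp(L(wstar) - L(what)). Were
    [wstar] outside, this would exceed the exponential of the radius, whose d log(...) part cancels
    the covering bound and leaves 1 / delta. *)
Lemma conf_set_of_mixture (U h : R) (M : nat) : 0 < h -> 0 < delta ->
  (forall (A : 'rV[R]_d -> R) (b what : 'rV[R]_d),
    l2ball d B what ->
    (forall v w, A v - A w <= (t.-1)%:R * l2norm (v - w)) ->
    (forall u, `|dotv b u| <= (t.-1)%:R * l2norm u) ->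
    expR (- (d%:R * ln (Num.max (expR 1) (4 * expR 1 * B * (t.-1)%:R / d%:R)))) <=
    \sum_(g : {ffun 'I_d -> 'I_(M + M)}) prior h M g *
      expR ((A what - dotv b what)
            - (A (grid U h M g) - dotv b (grid U h M g)))) ->
  l2ball d B wstar -> l2ball d B what ->
  \sum_(g : {ffun 'I_d -> 'I_(M + M)}) prior h M g *
     expR (cumulative_loss x S c t wstar - cumulative_loss x S c t (grid U h M g))
    < 1 / delta ->
  conf_set B delta x S c t what wstar.
Proof.
move=> h0 de0 cov wB whB hlt; split=> //.
rewrite leNgt; apply/negP => hgt.
move: hlt; rewrite ltNge => /negP; apply.
have hc := cov A b what whB log_partition_lip sum_feature_dotv.
set L := cumulative_loss x S c t in hgt *.
have -> : \sum_(g : {ffun 'I_d -> 'I_(M + M)}) prior h M g *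
     expR (L wstar - L (grid U h M g)) =
   expR (L wstar - L what) *
   \sum_(g : {ffun 'I_d -> 'I_(M + M)}) prior h M g *
      expR ((A what - dotv b what)
            - (A (grid U h M g) - dotv b (grid U h M g))).
  rewrite mulr_sumr; apply: eq_bigr => g _; rewrite mulrCA -expRD.
  by rewrite /L !cumulative_lossE; congr (_ * expR _); lra.
have de : 0 < 1 / delta by rewrite divr_gt0.
rewrite -[1 / delta](lnK) ?posrE //.
set D := d%:R * _ in hc.
apply: (@le_trans _ _ (expR (conf_radius2 d B delta t) * expR (- D))).
  by rewrite -expRD ler_expR /conf_radius2 -/D; lra.
apply: ler_pM; rewrite ?expR_ge0 // ler_expR; exact: ltW.
Qed.
End Confidence.

(** * Likelihood ratios as supermartingales *)

Section LikelihoodRatio.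
Context {R : realType} {d N T : nat} {disp : measure_display}.
Context {Omega : measurableType disp} (P : probability Omega R).
Context (F : nat -> set (set Omega)) (wstar : 'rV[R]_d).
Context (x : nat -> Omega -> 'I_N -> 'rV[R]_d) (r : nat -> Omega -> 'I_N -> R).
Context (S : nat -> Omega -> {set 'I_N}) (c : nat -> Omega -> option 'I_N).
Hypothesis bandit : mnl_bandit T P F wstar x r S c.

Let sF := mnl_sigma_algebra bandit.
Let subF := mnl_sub bandit.
Let incF := mnl_filtration bandit.

Definition likelihood_ratio (w : 'rV[R]_d) (t : nat) (omega : Omega) : R :=
  expR (cumulative_loss (x ^~ omega) (S ^~ omega) (c ^~ omega) t wstar
        - cumulative_loss (x ^~ omega) (S ^~ omega) (c ^~ omega) t w).

Lemma gmeas_incr s t (f : Omega -> R) : (s <= t)%N -> gmeas (F s) f -> gmeas (F t) f.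
Proof.
move=> st hf; apply: (preimage_gmeas _ (sF t)) => Y mY; apply: incF st _ _.
exact: (gmeas_preimage _ (sF s)).
Qed.

Lemma gmeas_dotv t i w : (1 <= t <= T)%N ->
  gmeas (F t) (fun omega => dotv (x t omega i) w).
Proof.
move=> tT; apply: measurable_sum => k; apply: measurable_funM; last exact: measurable_cst.
apply: (preimage_gmeas _ (sF t)) => Y mY.
exact: (mnl_features_measurable bandit).
Qed.

Lemma gmeas_mnl_norm t (A : {set 'I_N}) w : (1 <= t <= T)%N ->
  gmeas (F t) (fun omega => mnl_norm (x t omega) A w).
Proof.
move=> tT; apply: measurable_funD; first exact: measurable_cst.
have -> : (fun omega => \sum_(j in A) expR (dotv (x t omega j) w)) =
    (fun omega => \sum_j (if j \in A then expR (dotv (x t omega j) w) else 0)).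
  by apply/funext => omega; rewrite big_mkcond.
apply: measurable_sum => j; case: (j \in A); last exact: measurable_cst.
by apply: measurableT_comp; [exact: measurable_expR|exact: gmeas_dotv].
Qed.

Lemma gmeas_mnl_prob_cst t (A : {set 'I_N}) w i : (1 <= t <= T)%N ->
  gmeas (F t) (fun omega => mnl_prob (x t omega) A w i).
Proof.
move=> tT; have [iA|iA] := boolP (i \in alternatives A); last first.
  have -> : (fun omega => mnl_prob (x t omega) A w i) = (fun=> 0).
    by apply/funext => omega; rewrite mnl_prob_notin.
  exact: measurable_cst.
have -> : (fun omega => mnl_prob (x t omega) A w i) =
    (fun omega => expR (dotv (feature (x t omega) i) w
       - ln (mnl_norm (x t omega) A w))).
  apply/funext => omega; rewrite mnl_probE // expRB lnK //.
  by rewrite posrE mnl_norm_gt0.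
apply: measurableT_comp; first exact: measurable_expR.
apply: measurable_funB.
  case: i iA => [i|] _ /=; first exact: gmeas_dotv.
  have -> : (fun=> dotv (0 : 'rV[R]_d) w) = (fun _ : Omega => 0 : R).
    by apply/funext => omega; rewrite dotv0l.
  exact: measurable_cst.
by apply: measurableT_comp; [exact: measurable_ln|exact: gmeas_mnl_norm].
Qed.

Lemma gmeas_mnl_prob t w i : (1 <= t <= T)%N ->
  gmeas (F t) (fun omega => mnl_prob (x t omega) (S t omega) w i).
Proof.
move=> tT.
apply: (gmeas_finite_choice _ (sF t) (S t) (fun A omega => mnl_prob (x t omega) A w i)).
  by move=> A; apply: (mnl_offer_measurable bandit).
by move=> A; apply: gmeas_mnl_prob_cst.
Qed.

Lemma F_choice t i : (1 <= t <= T)%N -> F t.+1 (c t @^-1` [set i]).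
Proof. by move=> tT; apply: (mnl_choice_measurable bandit). Qed.

Lemma likelihood_ratio1 w omega : likelihood_ratio w 1 omega = 1.
Proof. by rewrite /likelihood_ratio /cumulative_loss !big_geq // subrr expR0. Qed.

(** In each term only the indicator of the choice is not known before round t is played, which is
    the form required by [integral_cond]. *)
Lemma likelihood_ratioS w t omega : (1 <= t <= T)%N ->
  likelihood_ratio w t.+1 omega =
  \sum_i likelihood_ratio w t omega
    * (mnl_prob (x t omega) (S t omega) w i
       / mnl_prob (x t omega) (S t omega) wstar i)
    * \1_(c t @^-1` [set i]) omega.
Proof.
move=> tT; have /andP[t1 _] := tT.
have cA := mnl_choice_offered bandit tT omega.
rewrite (bigD1 (c t omega)) //= big1 ?addr0; last first.
  move=> i ic; rewrite indicE memNset ?mulr0 //= => e.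
  by move: ic; rewrite e eqxx.
rewrite indicE mem_set // mulr1 /likelihood_ratio /cumulative_loss.
rewrite !big_nat_recr //=.
set a := \sum_(1 <= s < t) _; set a' := \sum_(1 <= s < t) _.
have rl v : round_loss (x t omega) (S t omega) (c t omega) v =
    - ln (mnl_prob (x t omega) (S t omega) v (c t omega)).
  rewrite /round_loss (bigD1 (c t omega)) //= eqxx mul1r big1 ?addr0 //.
  by move=> i /andP[_ /negbTE ic]; rewrite eq_sym ic mul0r.
rewrite !rl.
have -> : a - ln (mnl_prob (x t omega) (S t omega) wstar (c t omega)) -
   (a' - ln (mnl_prob (x t omega) (S t omega) w (c t omega))) =
   (a - a') + (ln (mnl_prob (x t omega) (S t omega) w (c t omega))
     - ln (mnl_prob (x t omega) (S t omega) wstar (c t omega))) by lra.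
rewrite [LHS]expRD; congr (_ * _).
by rewrite expRB !lnK // posrE mnl_prob_gt0.
Qed.

Lemma likelihood_ratio_ge0 w t omega : 0 <= likelihood_ratio w t omega.
Proof. exact: expR_ge0. Qed.

Lemma gmeas_prob_ratio w t i : (1 <= t <= T)%N ->
  gmeas (F t) (fun omega => mnl_prob (x t omega) (S t omega) w i
       / mnl_prob (x t omega) (S t omega) wstar i).
Proof.
move=> tT.
apply: (gmeas_finite_choice _ (sF t) (S t) (fun A omega =>
   mnl_prob (x t omega) A w i / mnl_prob (x t omega) A wstar i)).
  by move=> A; apply: (mnl_offer_measurable bandit).
move=> A; have [iA|iA] := boolP (i \in alternatives A); last first.
  have -> : (fun omega => mnl_prob (x t omega) A w i / mnl_prob (x t omega) A wstar i)
     = (fun=> 0).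
    by apply/funext => omega; rewrite mnl_prob_notin // mul0r.
  exact: measurable_cst.
have -> : (fun omega => mnl_prob (x t omega) A w i / mnl_prob (x t omega) A wstar i)
   = (fun omega => expR (ln (mnl_prob (x t omega) A w i)
        - ln (mnl_prob (x t omega) A wstar i))).
  by apply/funext => omega; rewrite expRB !lnK // posrE mnl_prob_gt0.
apply: measurableT_comp; first exact: measurable_expR.
by apply: measurable_funB; apply: measurableT_comp;
  [exact: measurable_ln|exact: gmeas_mnl_prob_cst|
   exact: measurable_ln|exact: gmeas_mnl_prob_cst].
Qed.

Lemma gmeas_likelihood_ratio w t : (1 <= t <= T.+1)%N ->
  gmeas (F t) (likelihood_ratio w t).
Proof.
elim: t => [//|[|t] IH] tT.
  have -> : likelihood_ratio w 1 = fun=> 1.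
    by apply/funext => omega; rewrite likelihood_ratio1.
  exact: measurable_cst.
have t1 : (1 <= t.+1 <= T)%N by move: tT; rewrite ltnS.
have -> : likelihood_ratio w t.+2 = (fun omega =>
  \sum_i likelihood_ratio w t.+1 omega
    * (mnl_prob (x t.+1 omega) (S t.+1 omega) w i
       / mnl_prob (x t.+1 omega) (S t.+1 omega) wstar i)
    * \1_(c t.+1 @^-1` [set i]) omega).
  by apply/funext => omega; rewrite likelihood_ratioS.
apply: measurable_sum => i; apply: measurable_funM.
  apply: (@gmeas_incr t.+1) => //; apply: measurable_funM.
    by apply: IH; case/andP: t1 => _ /leqW ->.
  exact: gmeas_prob_ratio.
apply: (@measurable_indic _ (g_sigma_algebraType (F t.+2)) R setT).
rewrite (measurable_gE _ (sF t.+2)); exact: F_choice.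
Qed.

(** Conditionally on [F t], choice [i] has the probability under [wstar], which cancels the
    denominator; the remaining probabilities under [w] sum to 1. *)
Lemma likelihood_ratio_super w t A : (1 <= t <= T)%N -> F t A ->
  (\int[P]_(omega in A) (likelihood_ratio w t.+1 omega)%:E <=
   \int[P]_(omega in A) (likelihood_ratio w t omega)%:E)%E.
Proof.
move=> tT FA; have mA := subF _ _ FA; have /andP[t1 tT'] := tT.
have gl : gmeas (F t) (likelihood_ratio w t).
  by apply: gmeas_likelihood_ratio; rewrite t1 leqW.
pose q i omega := mnl_prob (x t omega) (S t omega) w i
       / mnl_prob (x t omega) (S t omega) wstar i.
have q0 i omega : 0 <= q i omega by rewrite divr_ge0 ?mnl_prob_ge0.
have gq i : gmeas (F t) (q i) by apply: gmeas_prob_ratio.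
pose Z i omega := likelihood_ratio w t omega * q i omega.
have Z0 i omega : 0 <= Z i omega by rewrite mulr_ge0 ?likelihood_ratio_ge0.
have gZ i : gmeas (F t) (Z i) by exact: (measurable_funM gl (gq i)).
have mZ i : measurable_fun setT (Z i) by apply: (gmeas_measurable _ (sF t) (subF t)).
pose ps i omega := mnl_prob (x t omega) (S t omega) wstar i.
have ps0 i omega : 0 <= ps i omega by apply: mnl_prob_ge0.
have gps i : gmeas (F t) (ps i) by apply: gmeas_mnl_prob.
have mps i : measurable_fun setT (ps i) by apply: (gmeas_measurable _ (sF t) (subF t)).
have mc i : measurable (c t @^-1` [set i]) by apply: (subF t.+1); apply: F_choice.
have -> : (\int[P]_(omega in A) (likelihood_ratio w t.+1 omega)%:E =
    \sum_i \int[P]_(omega in A) (Z i omega * \1_(c t @^-1` [set i]) omega)%:E)%E.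
  rewrite -ge0_integral_sum //.
  - by apply: eq_integral => omega _; rewrite likelihood_ratioS // -sumEFin.
  - move=> i; apply/measurable_EFinP/measurable_funTS/measurable_funM.
      exact: mZ.
    by apply: measurable_indic.
  - by move=> i omega _; rewrite lee_fin mulr_ge0.
have -> : (\sum_i \int[P]_(omega in A) (Z i omega * \1_(c t @^-1` [set i]) omega)%:E =
    \int[P]_(omega in A) (\sum_i Z i omega * ps i omega)%:E)%E.
  transitivity (\sum_i \int[P]_(omega in A) (Z i omega * ps i omega)%:E)%E.
    apply: eq_bigr => i _.
    apply: (integral_cond _ (sF t) (subF t) P A _ _ _ FA (mc i) (gps i) (ps0 i) (gZ i) (Z0 i)).
    by move=> C FC; apply: (mnl_choice_law bandit).
  rewrite -ge0_integral_sum //.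
  - by apply: eq_integral => omega _; rewrite -sumEFin.
  - by move=> i; apply/measurable_EFinP/measurable_funTS/measurable_funM.
  - by move=> i omega _; rewrite lee_fin mulr_ge0.
apply: ge0_le_integral => //.
- by move=> omega _; rewrite lee_fin sumr_ge0 // => i _; rewrite mulr_ge0.
- apply/measurable_EFinP/measurable_funTS/measurable_sum => i.
  exact: measurable_funM.
- apply/measurable_EFinP/measurable_funTS.
  exact: (gmeas_measurable _ (sF t) (subF t)).
move=> omega _; rewrite lee_fin.
rewrite -[leRHS]mulr1 -(mnl_prob_sum (x t omega) (S t omega) w) mulr_sumr.
apply: ler_sum => i _; rewrite /Z /q -mulrA ler_wpM2l ?likelihood_ratio_ge0 //.
(* For an alternative not offered the quotient in [q] has denominator 0, and the term vanishes. *)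
have [e0|e0] := eqVneq (ps i omega) 0; first by rewrite e0 mulr0 mnl_prob_ge0.
by rewrite mulfVK.
Qed.

Lemma mixture_ville (G : finType) (q : G -> R) (pt : G -> 'rV[R]_d) (delta : R) :
  0 < delta -> (forall g, 0 <= q g) -> \sum_g q g <= 1 ->
  let crossing := [set omega | exists2 s, (1 <= s <= T)%N &
       (1 / delta <= \sum_g q g * likelihood_ratio (pt g) s omega)%R] in
  measurable crossing /\ (P crossing <= delta%:E)%E.
Proof.
move=> de0 q0 q1 crossing.
pose M t omega := \sum_g q g * likelihood_ratio (pt g) t omega.
have M0 t omega : 0 <= M t omega.
  by apply: sumr_ge0 => g _; rewrite mulr_ge0 ?likelihood_ratio_ge0.
have gM t : (1 <= t <= T.+1)%N -> gmeas (F t) (M t).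
  move=> tT; apply: measurable_sum => g; apply: measurable_funM.
    exact: measurable_cst.
  exact: gmeas_likelihood_ratio.
have intM t A : (1 <= t <= T.+1)%N -> F t A \/ measurable A ->
   (\int[P]_(omega in A) (M t omega)%:E =
    \sum_g (q g)%:E * \int[P]_(omega in A) (likelihood_ratio (pt g) t omega)%:E)%E.
  move=> tT FA; have mA : measurable A by case: FA => // FA; apply: (subF _ _ FA).
  have ml g : measurable_fun setT (likelihood_ratio (pt g) t).
    apply: (gmeas_measurable _ (sF t) (subF t)); exact: gmeas_likelihood_ratio.
  transitivity (\sum_g \int[P]_(omega in A) (q g * likelihood_ratio (pt g) t omega)%:E)%E.
    rewrite -ge0_integral_sum //.
    - by apply: eq_integral => omega _; rewrite -sumEFin.
    - move=> g; apply/measurable_EFinP/measurable_funTS/measurable_funM => //.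
    - by move=> g omega _; rewrite lee_fin mulr_ge0 ?likelihood_ratio_ge0.
  apply: eq_bigr => g _; under eq_integral => omega _ do rewrite EFinM.
  rewrite ge0_integralZl_EFin //.
  - by move=> omega _; rewrite lee_fin likelihood_ratio_ge0.
  - by apply/measurable_EFinP/measurable_funTS.
have super t A : (1 <= t <= T)%N -> F t A ->
   (\int[P]_(omega in A) (M t.+1 omega)%:E <= \int[P]_(omega in A) (M t omega)%:E)%E.
  move=> tT FA; have /andP[t1 tT'] := tT.
  have tT1 : (1 <= t <= T.+1)%N by rewrite t1 leqW.
  rewrite (intM t.+1 A) ?(intM t A) //; [|by left|by right; apply: (subF _ _ FA)].
  apply: lee_sum => g _; rewrite lee_wpmul2l ?lee_fin //.
  exact: likelihood_ratio_super.
have a0 : 0 < 1 / delta by rewrite divr_gt0.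
have := ville P F M T _ a0 sF subF incF M0 gM super.
have -> : (\int[P]_omega (M 1 omega)%:E = (\sum_g q g)%:E)%E.
  rewrite (eq_integral (fun=> (\sum_g q g)%:E)).
    rewrite integral_cst //; apply: etrans (mule1 _); congr (_ * _)%E.
    exact: probability_setT.
  by move=> omega _; congr EFin; apply: eq_bigr => g _; rewrite likelihood_ratio1 mulr1.
move=> [mH h]; split=> //; have h1 : ((\sum_g q g)%:E <= 1%:E)%E by rewrite lee_fin.
have h2 := le_trans h h1.
rewrite -(@lee_pmul2l _ (1 / delta)%:E) ?lte_fin //.
by apply: le_trans h2 _; rewrite -EFinM div1r mulVf ?gt_eqF.
Qed.
End LikelihoodRatio.

(** * Measurability of the regret *)

Lemma measurable_sum_nat {R : realType} {disp : measure_display}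
    {Omega : measurableType disp} (f : nat -> Omega -> R) (T : nat) :
  (forall t, (1 <= t <= T)%N -> measurable_fun setT (f t)) ->
  measurable_fun setT (fun omega => \sum_(1 <= t < T.+1) f t omega).
Proof.
move=> hf.
have -> : (fun omega => \sum_(1 <= t < T.+1) f t omega) =
    (fun omega => \sum_(1 <= t < T.+1) (if (1 <= t < T.+1)%N then f t omega else 0)).
  by apply/funext => omega; rewrite big_nat big_mkcond.
apply: measurable_sum => t; have [tT|_] := boolP (1 <= t < T.+1)%N.
  exact: hf.
exact: measurable_cst.
Qed.

Lemma measurable_bigmax {R : realType} {disp : measure_display}
    {Omega : measurableType disp} {I : Type} (s : seq I) (Q : pred I)
    (f : I -> Omega -> R) :
  (forall i, measurable_fun setT (f i)) ->
  measurable_fun setT (fun omega => \big[Num.max/0]_(i <- s | Q i) f i omega).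
Proof.
move=> hf; elim: s => [|i s IH].
  have -> : (fun omega => \big[Num.max/0]_(i <- [::] | Q i) f i omega) = (fun=> 0).
    by apply/funext => omega; rewrite big_nil.
  exact: measurable_cst.
case: (boolP (Q i)) => Qi.
  have -> : (fun omega => \big[Num.max/0]_(j <- i :: s | Q j) f j omega) =
     (f i \max (fun omega => \big[Num.max/0]_(j <- s | Q j) f j omega))%R.
    by apply/funext => omega; rewrite big_cons Qi.
  exact: measurable_maxr.
have -> : (fun omega => \big[Num.max/0]_(j <- i :: s | Q j) f j omega) =
   (fun omega => \big[Num.max/0]_(j <- s | Q j) f j omega).
  by apply/funext => omega; rewrite big_cons (negbTE Qi).
exact: IH.
Qed.

Section RegretEvent.
Context {R : realType} {d N K T : nat} {disp : measure_display}.
Context {Omega : measurableType disp} (P : probability Omega R).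
Context (F : nat -> set (set Omega)) (wstar : 'rV[R]_d).
Context (x : nat -> Omega -> 'I_N -> 'rV[R]_d) (r : nat -> Omega -> 'I_N -> R).
Context (S Sstar : nat -> Omega -> {set 'I_N}) (c : nat -> Omega -> option 'I_N).
Hypothesis bandit : mnl_bandit T P F wstar x r S c.
Hypothesis r01 : forall t omega i, (1 <= t)%N -> 0 <= r t omega i <= 1.
Hypothesis best : forall t omega, (1 <= t <= T)%N ->
  is_argmax (assortments K)
    (fun A => exp_revenue (x t omega) (r t omega) A wstar) (Sstar t omega).

Let sF := mnl_sigma_algebra bandit.
Let subF := mnl_sub bandit.

Lemma gmeas_reward t j : (1 <= t <= T)%N ->
  gmeas (F t) (fun omega => reward (r t omega) j).
Proof.
move=> tT; case: j => [i|] /=; last exact: measurable_cst.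
apply: (preimage_gmeas _ (sF t)) => Y mY.
exact: (mnl_rewards_measurable bandit).
Qed.

Lemma gmeas_exp_revenue t A : (1 <= t <= T)%N ->
  gmeas (F t) (fun omega => exp_revenue (x t omega) (r t omega) A wstar).
Proof.
move=> tT.
have -> : (fun omega => exp_revenue (x t omega) (r t omega) A wstar) =
  (fun omega => \sum_i (if i \in A then
     mnl_prob (x t omega) A wstar (Some i) * reward (r t omega) (Some i) else 0)).
  by apply/funext => omega; rewrite /exp_revenue big_mkcond.
apply: measurable_sum => i; case: (i \in A); last exact: measurable_cst.
apply: measurable_funM; last exact: gmeas_reward.
exact: (gmeas_mnl_prob_cst P F wstar x r S c bandit).
Qed.

Lemma gmeas_reward_variance t : (1 <= t <= T)%N ->
  gmeas (F t) (fun omega => reward_variance (x t omega) (r t omega) (S t omega) wstar).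
Proof.
move=> tT.
apply: (gmeas_finite_choice _ (sF t) (S t)
  (fun A omega => reward_variance (x t omega) (r t omega) A wstar)).
  by move=> A; apply: (mnl_offer_measurable bandit).
move=> A.
have -> : (fun omega => reward_variance (x t omega) (r t omega) A wstar) =
   (fun omega => \sum_j mnl_prob (x t omega) A wstar j *
      (reward (r t omega) j -
       \sum_k mnl_prob (x t omega) A wstar k * reward (r t omega) k) ^+ 2).
  by apply/funext => omega; rewrite reward_varianceE.
have gp j := gmeas_mnl_prob_cst P F wstar x r S c bandit t A wstar j tT.
apply: measurable_sum => j; apply: measurable_funM; first exact: gp.
apply: measurable_funX; apply: measurable_funB; first exact: gmeas_reward.
apply: measurable_sum => k; apply: measurable_funM; first exact: gp.
exact: gmeas_reward.
Qed.

(* [Sstar] need not be measurable, but its revenue is a finite maximum. *)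
Lemma measurable_regret :
  measurable_fun setT (fun omega =>
    regret (x ^~ omega) (r ^~ omega) (S ^~ omega) (Sstar ^~ omega) wstar T).
Proof.
apply: measurable_sum_nat => t tT; have /andP[t1 _] := tT.
apply: measurable_funB; last first.
  apply: (gmeas_measurable _ (sF t) (subF t)).
  apply: (gmeas_finite_choice _ (sF t) (S t)
    (fun A omega => exp_revenue (x t omega) (r t omega) A wstar)).
    by move=> A; apply: (mnl_offer_measurable bandit).
  by move=> A; apply: gmeas_exp_revenue.
have -> : (fun omega => exp_revenue (x t omega) (r t omega) (Sstar t omega) wstar) =
   (fun omega => \big[Num.max/0]_(A : {set 'I_N} | (#|A| <= K)%N)
       exp_revenue (x t omega) (r t omega) A wstar).
  apply/funext => omega; have [hK hmax] := best t omega tT.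
  apply/eqP; rewrite eq_le; apply/andP; split.
    exact: (@le_bigmax_cond _ _ _ 0 (Sstar t omega) (fun A => (#|A| <= K)%N)
      (fun A => exp_revenue (x t omega) (r t omega) A wstar)).
  (* The default 0 of the maximum does no harm because revenues are nonnegative. *)
  apply/bigmax_leP; split=> [|A hA]; last exact: hmax.
  by apply: exp_revenue_ge0 => i; apply: r01.
apply: measurable_bigmax => A.
exact: (gmeas_measurable _ (sF t) (subF t) _ (gmeas_exp_revenue t A tT)).
Qed.

Lemma measurable_regret_event (a b e : R) :
  measurable [set omega |
    regret (x ^~ omega) (r ^~ omega) (S ^~ omega) (Sstar ^~ omega) wstar T <=
    a * (b * Num.sqrt (total_variance (x ^~ omega) (r ^~ omega) (S ^~ omega) wstar T)
         + e)].
Proof.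
rewrite -[X in measurable X]setTI; apply: measurable_fun_le => //.
  exact: measurable_regret.
apply: measurable_funM; first exact: measurable_cst.
apply: measurable_funD; last exact: measurable_cst.
apply: measurable_funM; first exact: measurable_cst.
apply: measurableT_comp.
  by apply: continuous_measurable_fun; exact: sqrt_continuous.
apply: measurable_sum_nat => t tT.
exact: (gmeas_measurable _ (sF t) (subF t) _ (gmeas_reward_variance t tT)).
Qed.
End RegretEvent.

Theorem theorem4p12 (R : realType) (delta : R) (hdelta : 0 < delta <= 1) :
  exists2 C : R, 0 < C &
  forall (d N K T : nat) (B kappa : R) (wstar : 'rV[R]_d)
    (disp : measure_display) (Omega : measurableType disp)
    (P : probability Omega R) (F : nat -> set (set Omega))
    (x : nat -> Omega -> 'I_N -> 'rV[R]_d) (r : nat -> Omega -> 'I_N -> R)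
    (S Sstar : nat -> Omega -> {set 'I_N}) (c : nat -> Omega -> option 'I_N)
    (what : nat -> Omega -> 'rV[R]_d)
    (wtil : nat -> Omega -> 'I_N -> 'rV[R]_d),
  (0 < d)%N ->
  2 <= B * T%:R ->
  (forall t omega i, (1 <= t)%N -> l2norm (x t omega i) <= 1) ->
  (forall t omega i, (1 <= t)%N -> 0 <= r t omega i <= 1) ->
  l2norm wstar <= B ->
  0 < kappa ->
  (forall t omega (A : {set 'I_N}) (i : 'I_N) (w : 'rV[R]_d),
     (1 <= t <= T)%N -> assortments K A -> i \in A -> l2ball d B w ->
     kappa <= mnl_prob (x t omega) A w (Some i)
              * mnl_prob (x t omega) A w None) ->
  mnl_bandit T P F wstar x r S c ->
  (forall t omega, (1 <= t <= T)%N ->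
     mle_algorithm_round K B delta (x ^~ omega) (r ^~ omega) (S ^~ omega)
       (c ^~ omega) t (what t omega) (wtil t omega)) ->
  (forall t omega, (1 <= t <= T)%N ->
     is_argmax (assortments K)
       (fun A => exp_revenue (x t omega) (r t omega) A wstar)
       (Sstar t omega)) ->
  ((1 - delta)%:E <=
   P [set omega |
      (regret (x ^~ omega) (r ^~ omega) (S ^~ omega) (Sstar ^~ omega) wstar T
       <= C * (d%:R * ln (B * T%:R)
               * Num.sqrt (total_variance (x ^~ omega) (r ^~ omega)
                             (S ^~ omega) wstar T)
               + 1 / kappa * d%:R ^+ 2 * ln (B * T%:R) ^+ 2))%R])%E.
Proof.
have /andP[de0 de1] := hdelta.
pose a := 5 + 2 * ln (1 / delta).
have a5 : 5 <= a by rewrite /a lerDl mulr_ge0 // ln_ge0 // div1r invf_ge1.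
(* Fixed before the dimension, the horizon and the instance: it depends on [delta] alone, through
   [a]. *)
exists (4608 * a + 144 + 42 + 192 * a); first by lra.
move=> d N K T B kappa wstar disp Omega P F x r S Sstar c what wtil d0 BT x1 r01
  wB kappa0 hkappa bandit algo best.
have B0 : 0 < B.
  have T0 : 0 < T%:R :> R.
    rewrite ltr0n lt0n; apply/eqP => T0.
    by move: BT; rewrite T0 mulr0; lra.
  by rewrite -(pmulr_lgt0 _ T0) (lt_le_trans _ BT).
have [U [h [M [h0 cov]]]] := prior_covers d T B d0 B0.
have [mbad hbad] := @mixture_ville R d N T disp Omega P F wstar x r S c bandit
  _ (@prior R d h M) (@grid R d U h M) delta de0
  (fun g => prior_ge0 h M g h0) (prior_sum_le1 h M h0).
set bad := [set omega | _] in mbad hbad.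
have mE := measurable_regret_event P F wstar x r S Sstar c bandit r01 best.
apply: (@le_trans _ _ (P (~` bad))).
  rewrite probability_setC // EFinB; exact: leeB.
apply: le_measure; rewrite ?inE.
- exact: measurableC.
- exact: mE.
move=> omega /= nbad.
apply: (@regret_bound R d N K T B delta kappa wstar (x ^~ omega) (r ^~ omega)
  (S ^~ omega) (Sstar ^~ omega) (c ^~ omega) (what ^~ omega) (wtil ^~ omega)) => //.
- by move=> t i t1; apply: x1.
- by move=> t i t1; apply: r01.
- by move=> t A i w; apply: hkappa.
- by move=> t tT; apply: (mnl_choice_offered bandit).
- by move=> t tT; apply: algo.
- by move=> t tT; apply: best.
move=> t tT; have /andP[t1 tT'] := tT.
apply: (@conf_set_of_mixture R d N B delta wstar (x ^~ omega) (S ^~ omega)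
  (c ^~ omega) (what t omega) t _ _ U h M h0 de0) => //.
- by move=> s i s1; apply: x1.
- move=> s /andP[s1 st]; apply: (mnl_choice_offered bandit).
  by rewrite s1 (leq_trans (ltnW st)).
- by move=> A b w; apply: cov.
- by have [[]] := algo t omega tT.
(* A mixture of at least 1 / delta at any one round is a crossing, so the complement of [bad] covers
   all rounds at once. *)
rewrite ltNge; apply/negP => hge; apply: nbad.
by exists t.
Qed.
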